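(* Fix an integer $d\ge 1$. For integers $k=k_N$, let $\mathrm{d}_k(t)$, $t\ge 0$, be the worst-case total variation distance to equilibrium of the $k$-particle binomial splitting process on $\mathbb{T}^d_N$, let $w_k=1\vee\frac{\log k}{N^d}$, and let $T(a)=\frac{t_{\rm rel}}{2}\bigl(\log k+a\,w_k\bigr)$, $a\in\mathbb{R}$, with $t_{\rm rel}=1/(1-\cos(2\pi/N))$. Then: (a) for every sequence $k=k_N\to\infty$ (as $N\to\infty$) satisfying $\log k=o(N^d\log N)$, $$\lim_{a\to-\infty}\liminf_{N\to\infty}\mathrm{d}_k(T(a))=1;$$ (b) for every sequence $k=k_N\to\infty$ (as $N\to\infty$), $$\lim_{a\to\infty}\limsup_{N\to\infty}\mathrm{d}_k(T(a))=0.$$ In particular, total variation cutoff for the binomial splitting process holds for $k=k_N\to\infty$ satisfying $\log k=o(N^d\log N)$.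
   Context: $\mathbb{T}^d_N=(\mathbb{Z}/N\mathbb{Z})^d$ is the discrete torus with nearest-neighbor graph structure, and $\pi\equiv N^{-d}$ is the uniform distribution on it. $\Omega_k=\{\zeta\in\mathbb{N}_0^{\mathbb{T}^d_N}:\sum_x\zeta(x)=k\}$ is the set of configurations of $k$ indistinguishable particles, and $\mathcal{P}(\Omega_k)$ the set of probability distributions on it. Binomial splitting process $(\zeta^k_t)_{t\ge0}$: the continuous-time Markov chain on $\Omega_k$ in which each unordered nearest-neighbor pair $\{x,y\}$ has an independent rate-1 Poisson clock; when the clock of $\{x,y\}$ rings, each of the $\zeta(x)+\zeta(y)$ particles sitting on $x$ or $y$ is independently reassigned to $x$ or $y$ with probability $1/2$ each. Its unique reversible measure is $\mu_{k,\pi}=\mathrm{Multinomial}(k,\pi)$. $(P^k_t)_{t\ge0}$ is its transition semigroup, and $\mu P^k_t$ the law of $\zeta^k_t$ when $\zeta^k_0\sim\mu$. The worst-case distance is $\mathrm{d}_k(t)=\sup_{\mu\in\mathcal{P}(\Omega_k)}\|\mu P^k_t-\mu_{k,\pi}\|_{\rm TV}$. $t_{\rm rel}$ is the relaxation time (inverse spectral gap) of the random walk on $\mathbb{T}^d_N$ with generator $\psi\mapsto\frac12\sum_{y:|x-y|=1}(\psi(y)-\psi(x))$. For each fixed $a\in\mathbb{R}$ and each sequence $k=k_N\to\infty$ (as $N\to\infty$), whether or not it satisfies $\log k=o(N^d\log N)$, $T(a)\geq 0$ for all $N$ large enough. Total variation cutoff means that there are times $t_N$ such that, for every $\delta\in(0,1)$,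 $\mathrm{d}_k((1-\delta)t_N)\to1$ and $\mathrm{d}_k((1+\delta)t_N)\to0$ as $N\to\infty$; here $t_N=\frac{t_{\rm rel}}{2}\log k$. Notation: $a\vee b=\max\{a,b\}$. *)

(* Defs.v *)
From HB Require Import structures.
From mathcomp Require Import all_boot all_order all_algebra.
From mathcomp Require Import all_classical all_reals all_analysis.

Set Implicit Arguments.
Unset Strict Implicit.
Unset Printing Implicit Defensive.

Import Order.TTheory GRing.Theory Num.Theory.
Import numFieldNormedType.Exports.

Local Open Scope classical_set_scope.
Local Open Scope ring_scope.

(* exp(t A), defined like expR by its power series; it converges for every
   linear operator A on the finite-dimensional space S -> R. *)
Definition exp_op (R : realType) (S : finType)
    (A : (S -> R) -> (S -> R)) (t : R) (f : S -> R) : S -> R :=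
  fun x => limn (series (fun n => exp_coeff t n * iter n A f x)).

Definition is_distr (R : realType) (S : finType) (mu : S -> R) : Prop :=
  (forall x, 0 <= mu x) /\ \sum_x mu x = 1.

(* The row vector mu exp(t A). *)
Definition law_at (R : realType) (S : finType)
    (A : (S -> R) -> (S -> R)) (mu : S -> R) (t : R) : S -> R :=
  fun y => \sum_x mu x * exp_op A t (fun z => (z == y)%:R) x.

Definition tv_dist (R : realType) (S : finType) (mu nu : S -> R) : R :=
  \big[Num.max/0]_(E : {set S}) `|\sum_(x in E) mu x - \sum_(x in E) nu x|.

Definition spectral_gap (R : realType) (S : finType)
    (A : (S -> R) -> (S -> R)) : R :=
  inf [set lam : R | 0 < lam /\ exists psi : S -> R,
        (exists x, psi x != 0) /\ forall x, - A psi x = lam * psi x].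

Definition torus (d N : nat) : finType := {ffun 'I_d -> 'I_N}.

(* The condition x != y only matters for
   N = 1; for N = 2 the graph is simple (one edge per pair). *)
Definition nbr (d N : nat) (x y : torus d N) : bool :=
  (x != y) &&
  [exists i, ((y i == ordS (x i)) || (x i == ordS (y i))) &&
             [forall j, (j != i) ==> (y j == x j)]].

Definition rw_gen (R : realType) (d N : nat) (psi : torus d N -> R) :
    torus d N -> R :=
  fun x => 2^-1 * \sum_(y | nbr x y) (psi y - psi x).

Definition trel (R : realType) (d N : nat) : R :=
  (spectral_gap (@rw_gen R d N))^-1.

Definition conf (d N k : nat) : finType :=
  {z : {ffun torus d N -> 'I_k.+1} | (\sum_x z x)%N == k}.

Definition occ (d N k : nat) (z : conf d N k) (x : torus d N) : nat :=
  val z x.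

(* Transition probabilities when the clock of {x, y} rings: the number of
   particles put on x is Binomial(z x + z y, 1/2), the others go to y. Since
   both configurations have k particles, agreement off {x, y} forces
   z' x + z' y = z x + z y. *)
Definition split_kernel (R : realType) (d N k : nat) (x y : torus d N)
    (z z' : conf d N k) : R :=
  if [forall u, (u \notin [:: x; y]) ==> (occ z' u == occ z u)]
  then binomial_pmf (occ z x + occ z y) (2^-1 : R) (occ z' x)
  else 0.

(* Comparing ranks makes each unordered pair {x, y} count exactly once. *)
Definition split_gen (R : realType) (d N k : nat) (f : conf d N k -> R) :
    conf d N k -> R :=
  fun z => \sum_(x : torus d N)
           \sum_(y : torus d N | nbr x y && (enum_rank x < enum_rank y)%N)
             ((\sum_z' split_kernel R x y z z' * f z') - f z).

Definition unif (R : realType) (d N : nat) : torus d N -> R :=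
  fun=> (N%:R ^+ d)^-1.

Definition multinomial (R : realType) (d N k : nat) (p : torus d N -> R) :
    conf d N k -> R :=
  fun z => (k`!%:R / \prod_x (occ z x)`!%:R) * \prod_x p x ^+ occ z x.

Definition dist (R : realType) (d N k : nat) (t : R) : R :=
  sup [set r : R | exists mu : conf d N k -> R, is_distr mu /\
         r = tv_dist (law_at (@split_gen R d N k) mu t)
                     (multinomial (k := k) (@unif R d N))].

Definition window (R : realType) (d N k : nat) : R :=
  Num.max 1 (ln k%:R / N%:R ^+ d).

Definition Tcut (R : realType) (d N k : nat) (a : R) : R :=
  trel R d N / 2 * (ln k%:R + a * window R d N k).

Definition tv_cutoff (R : realType) (D : nat -> R -> R) (t : nat -> R) : Prop :=
  forall delta : R, 0 < delta < 1 ->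
    D N ((1 - delta) * t N) @[N --> \oo] --> (1 : R) /\
    D N ((1 + delta) * t N) @[N --> \oo] --> (0 : R).

(* Main.v *)
Require Import Defs.
From HB Require Import structures.
From mathcomp Require Import all_boot all_order all_algebra.
From mathcomp Require Import all_classical all_reals all_analysis.
From mathcomp Require Import ring lra zify.

(** Given the ringing times, the particles move independently, each following
    the averaging process of its starting site, so the law of the configuration
    is a mixture of laws of sums of independent particles.  Tensorizing the
    chi-square distance bounds the total variation distance to equilibrium by
    the square root of [k (n p(t) - 1)], where [n = N^d] and [p(t)] is the
    probability that two particles started together at a site share a site at
    time [t]; the mixture is handled by expanding the semigroup over the number
    of rings.  The two-particle chain is a free walk except on the diagonal.
    With [u] the law of the second particle relative to the first and [del] the
    drop of [u] across an edge at the origin, symmetry gives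
    [u' = 2 L (u - del/2 1_0)] and [p(s+r) = <u_s, u_r>].  The Nash inequality
    yields [p = O(1/n)] at times of order [N^2], and the Poincare inequality
    applied to [u - del/2 1_0] shows that
    [Y + (2 gamma/d) (p - 1/n)^2], [Y = |u|^2 - 1/n], decays at rate
    [4 gamma (1 - O(1/n))], hence [n p(t) - 1 = O(exp (-2 gamma (1 - O(1/n)) t))].
    The correction [O(1/n)] to the rate is what the window [w_k] absorbs.
    For the lower bound all particles start at the origin and the sum of
    [cos (2 pi x_1 / N)] over the particles separates the two laws by
    Chebyshev's inequality; the variance of its conditional mean is controlled
    by [p] again, and is negligible when [log k = o(N^d log N)]. *)

Set Implicit Arguments.
Unset Strict Implicit.
Unset Printing Implicit Defensive.

Import Order.TTheory GRing.Theory Num.Theory.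
Import numFieldNormedType.Exports.

Local Open Scope ring_scope.

(** * Derivatives and exponentials of operators *)

(** The bound [2 sqrt(X)] on total variation is replaced by [e + X / e] with a free [e > 0]. This is
    affine in [X], hence in the two-particle pairings, so it reproduces itself in an induction on
    the number of rings and can be summed along the exponential series; [e] is chosen only at the
    end. Sums over rings are left unnormalized, without subtracting the identity, so that all
    coefficients are nonnegative and inequalities can be summed term by term. In the decay of [p],
    the Poincare inequality leaves a defect [del (p - 1/n)]. As [p' = - d del], it is a multiple of
    the derivative of [(p - 1/n)^2], whence the coefficient [2 gamma / d]. The leftover square is,
    by Cauchy-Schwarz, [O(1/n)] times a value at a time earlier by some [r0] of order [N^2]; this
    delay is harmless because [gamma r0] is bounded. In the lower bound the relative variance of the
    conditional mean is of order [gamma (1 + (x/n) exp(C x/n))] with [x] at most [log k]. Since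
    [gamma] is of order [N^-2], it suffices that [exp((1 + C) x/n) <= N], and this is how
    [log k = o(N^d log N)] enters. *)

Section RealDerivatives.
Variable R : realType.
Implicit Types (f g : R -> R) (x a b : R).

Lemma is_derive_congr f g x a b :
  is_derive x 1 f a -> f =1 g -> a = b -> is_derive x 1 g b.
Proof. by move=> fa /funext <- <-. Qed.

Lemma is_derive_mulf f g x a b : is_derive x 1 f a -> is_derive x 1 g b ->
  is_derive x 1 (fun s => f s * g s) (a * g x + f x * b).
Proof.
move=> fa gb; apply: (is_derive_congr (is_deriveM fa gb)) => //=.
by rewrite /GRing.scale /= addrC [g x * a]mulrC.
Qed.

Lemma is_derive_addf f g x a b : is_derive x 1 f a -> is_derive x 1 g b ->
  is_derive x 1 (fun s => f s + g s) (a + b).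
Proof. by move=> fa gb; exact: (is_deriveD fa gb). Qed.

Lemma is_derive_scale f x a (c : R) : is_derive x 1 f a ->
  is_derive x 1 (fun s => c * f s) (c * a).
Proof.
move=> fa; apply: (is_derive_congr (is_derive_mulf (is_derive_cst c x 1) fa)) => //=.
by rewrite mul0r add0r.
Qed.

Lemma is_derive_expRM x (c : R) :
  is_derive x 1 (fun s => expR (c * s)) (c * expR (c * x)).
Proof.
have h1 : is_derive x 1 (fun s : R => c * s) c.
  apply: (is_derive_congr (is_derive_scale c (is_derive_id x 1))) => //.
  by rewrite mulr1.
apply: (is_derive_congr (is_derive1_comp (is_derive_expR _) h1)) => //.
by rewrite mulrC.
Qed.

Lemma is_derive_sumf (I : Type) (r : seq I) (P : pred I) (F : I -> R -> R)
    (F' : I -> R) x :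
  (forall i, is_derive x 1 (F i) (F' i)) ->
  is_derive x 1 (fun s => \sum_(i <- r | P i) F i s) (\sum_(i <- r | P i) F' i).
Proof.
move=> dF; elim: r => [|i r ih].
  apply: (is_derive_congr (is_derive_cst 0 x 1)) => [s|]; by rewrite big_nil.
case Pi : (P i); last first.
  by apply: (is_derive_congr ih) => [s|]; rewrite big_cons Pi.
apply: (is_derive_congr (is_derive_addf (dF i) ih)) => [s|];
  by rewrite [RHS]big_cons Pi.
Qed.

Lemma is_derive_affine f (x c e l : R) :
  is_derive (c * x + e) 1 f l -> is_derive x 1 (fun s => f (c * s + e)) (c * l).
Proof.
move=> fl.
have h1 : is_derive x 1 (fun s : R => c * s + e) c.
  apply: (is_derive_congr (is_derive_addf
    (is_derive_scale c (is_derive_id x 1)) (is_derive_cst e x 1))) => //.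
  by rewrite mulr1 addr0.
apply: (is_derive_congr (@is_derive1_comp _ f (fun s => c * s + e) x _ _ fl h1)) => //.
by rewrite mulrC.
Qed.

Lemma derive_le0_le f f' a b : a <= b ->
  (forall x, a <= x <= b -> is_derive x 1 f (f' x)) ->
  (forall x, a <= x <= b -> f' x <= 0) -> f b <= f a.
Proof.
move=> ab df f0.
have [||c cab e] := @MVT_segment R f f' a b ab.
- move=> x; rewrite in_itv /= => /andP[x1 x2]; apply: df; by rewrite !ltW.
- apply: derivable_within_continuous => x; rewrite in_itv /= => xab.
  by case: (df x xab).
rewrite -subr_le0 e; apply: mulr_le0_ge0; last by rewrite subr_ge0.
by apply: f0; rewrite in_itv /= in cab.
Qed.

Lemma derive_le_bound f f' a b (c : R) : a <= b ->
  (forall x, a <= x <= b -> is_derive x 1 f (f' x)) ->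
  (forall x, a <= x <= b -> f' x <= c) -> f b <= f a + c * (b - a).
Proof.
move=> ab df f0.
have := @derive_le0_le (fun x => f x + (- c) * x) (fun x => f' x - c) a b ab.
have h x : a <= x <= b -> is_derive x 1 (fun x => f x + - c * x) (f' x - c).
  move=> xab; apply: (is_derive_congr (is_derive_addf (df x xab)
    (is_derive_scale (- c) (is_derive_id x 1)))) => //.
  by rewrite mulr1.
move=> /(_ h) /(_ _) H.
have : f b + - c * b <= f a + - c * a by apply: H => x /f0; rewrite subr_le0.
lra.
Qed.

Lemma derive0_eq f a b : a <= b ->
  (forall x, a <= x <= b -> is_derive x 1 f 0) -> f b = f a.
Proof.
move=> ab df; apply/eqP; rewrite eq_le; apply/andP; split.
  by apply: (@derive_le0_le f (fun=> 0)).
rewrite -lerN2; apply: (@derive_le0_le (fun s => - f s) (fun=> 0) a b) => // x xab.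
apply: (is_derive_congr (is_derive_scale (-1) (df x xab))) => [s|];
  by rewrite ?mulr0 ?mulN1r.
Qed.

Lemma gronwall_le f f' a b (c : R) : a <= b ->
  (forall x, a <= x <= b -> is_derive x 1 f (f' x)) ->
  (forall x, a <= x <= b -> f' x <= c * f x) ->
  f b <= expR (c * (b - a)) * f a.
Proof.
move=> ab df f0.
have : expR (- c * b) * f b <= expR (- c * a) * f a.
  apply: (@derive_le0_le (fun s => expR (- c * s) * f s)
    (fun s => (- c * expR (- c * s)) * f s + expR (- c * s) * f' s)) => // x xab.
    by apply: is_derive_mulf (df x xab); exact: is_derive_expRM.
  have := f0 x xab; rewrite -subr_ge0 => h.
  rewrite (_ : _ + _ = - (expR (- c * x) * (c * f x - f' x))); last by ring.
  by rewrite oppr_le0 mulr_ge0 // expR_ge0.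
rewrite -(ler_pM2l (expR_gt0 (c * b))) mulrA -expRD mulrA -expRD.
rewrite mulNr subrr expR0 mul1r.
by rewrite mulNr mulrBr.
Qed.

End RealDerivatives.

(** * Exponential generating functions of geometrically bounded sequences *)

Section ExponentialGeneratingFunctions.
Variable R : realType.
Implicit Types (s : nat -> R) (t : R).

Definition expgen s t : R := limn (series (fun n => exp_coeff t n * s n)).

(** Orbits of a matrix satisfy this bound, and it survives sums, multiples and shifts; it makes
    every series below converge for all [t]. *)
Definition geom_bounded s := exists C c : R, forall n, `|s n| <= C * c ^+ n.

Lemma geom_bounded_nonneg s : geom_bounded s ->
  exists C c : R, [/\ 0 <= C, 0 <= c & forall n, `|s n| <= C * c ^+ n].
Proof.
move=> [C [c h]]; exists `|C|, `|c|; split => // n.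
by apply: (le_trans (h n)); rewrite -normrX -normrM ler_norm.
Qed.

Lemma cvg_expgen s t : geom_bounded s ->
  cvgn (series (fun n => exp_coeff t n * s n)).
Proof.
move=> /geom_bounded_nonneg [C [c [C0 c0 h]]]; apply: normed_cvg.
have cC := @is_cvg_seriesZ R _ C (is_cvg_series_exp_coeff (`|t| * c)).
apply: series_le_cvg cC => [n|n|n] //=.
  by rewrite /GRing.scale /=  mulr_ge0 // exp_coeff_ge0 // mulr_ge0.
rewrite /exp_coeff /= normrM normrM normrX normfV.
rewrite (_ : (C *: _) n = C * ((`|t| * c) ^+ n / n`!%:R)) //.
rewrite exprMn (ger0_norm (ler0n _ _)).
have := h n; move: (c ^+ n) => cn hn.
have h1 : 0 <= `|t| ^+ n / n`!%:R by rewrite divr_ge0 ?exprn_ge0.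
apply: (le_trans (ler_wpM2l h1 hn)).
by rewrite mulrCA -!mulrA [_ * cn]mulrC.
Qed.

Lemma geom_boundedS s : geom_bounded s -> geom_bounded (fun n => s n.+1).
Proof.
move=> [C [c h]]; exists (C * c), c => n.
by rewrite -mulrA -exprS.
Qed.

Lemma pseries_exp_coeff s t :
  pseries (fun n => s n / n`!%:R) t = series (fun n => exp_coeff t n * s n).
Proof.
apply/funext => m; rewrite /pseries /series /=; apply: eq_bigr => n _.
by rewrite /exp_coeff /= mulrC mulrA mulrAC.
Qed.

Lemma expgenE s : expgen s = fun t => limn (pseries (fun n => s n / n`!%:R) t).
Proof. by apply/funext => t; rewrite pseries_exp_coeff. Qed.

Lemma is_derive_expgen s t : geom_bounded s ->
  is_derive t 1 (expgen s) (expgen (fun n => s n.+1) t).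
Proof.
move=> hs.
have D (u : nat -> R) : pseries_diffs (fun n => u n / n`!%:R)
    = (fun n => u n.+1 / n`!%:R).
  apply/funext => n; rewrite /pseries_diffs factS natrM invfM.
  by rewrite mulrCA mulVKf ?pnatr_eq0.
have cv (u : nat -> R) K : geom_bounded u -> cvgn (pseries (fun n => u n / n`!%:R) K).
  by move=> hu; rewrite pseries_exp_coeff; exact: cvg_expgen.
rewrite !expgenE -D; apply: (@pseries_snd_diffs R _ (`|t| + 1)); rewrite ?D.
- exact: cv.
- exact/cv/geom_boundedS.
- exact/(cv (fun n => s n.+2))/(geom_boundedS (geom_boundedS _)).
- by rewrite [ltRHS]ger0_norm ?addr_ge0 // ltrDl.
Qed.

Lemma expgen0 s : expgen s 0 = s 0%N.
Proof.
apply: cvg_lim => //; apply: (cvg_near_cst (s 0%N)).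
exists 1%N => // -[//|n] _.
rewrite /series /= big_nat_recl // big1 => [|i _].
  by rewrite /exp_coeff /= expr0 fact0 divr1 mul1r addr0.
by rewrite /exp_coeff /= expr0n mul0r mul0r.
Qed.

Lemma expgen_pow (c t : R) : expgen (fun n => c ^+ n) t = expR (t * c).
Proof.
rewrite /expgen /expR; congr (limn (series _)).
by apply/funext => n; rewrite /exp_coeff /= exprMn mulrAC.
Qed.

Lemma geom_bounded_pow (c : R) : geom_bounded (fun n => c ^+ n).
Proof. by exists 1, `|c| => n; rewrite mul1r normrX. Qed.

Lemma geom_boundedZ (a : R) s : geom_bounded s -> geom_bounded (fun n => a * s n).
Proof.
move=> [C [c h]]; exists (`|a| * C), c => n.
by rewrite normrM -mulrA ler_wpM2l.
Qed.

Lemma geom_boundedD s s' : geom_bounded s -> geom_bounded s' ->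
  geom_bounded (fun n => s n + s' n).
Proof.
move=> /geom_bounded_nonneg [C [c [C0 c0 h]]].
move=> /geom_bounded_nonneg [C' [c' [C'0 c'0 h']]].
exists (C + C'), (c + c') => n.
apply: (le_trans (ler_normD _ _)); rewrite mulrDl; apply: lerD.
  by apply: (le_trans (h n)); rewrite ler_wpM2l // lerXn2r ?nnegrE ?addr_ge0 ?lerDl.
by apply: (le_trans (h' n)); rewrite ler_wpM2l // lerXn2r ?nnegrE ?addr_ge0 ?lerDr.
Qed.

Lemma geom_bounded_sum (I : Type) (r : seq I) (P : pred I) (F : I -> nat -> R) :
  (forall i, geom_bounded (F i)) ->
  geom_bounded (fun n => \sum_(i <- r | P i) F i n).
Proof.
move=> hF; elim: r => [|i r ih].
  by exists 0, 0 => n; rewrite big_nil normr0 mul0r.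
have -> : (fun n => \sum_(j <- i :: r | P j) F j n) =
    (fun n => (P i)%:R * F i n + \sum_(j <- r | P j) F j n).
  by apply/funext => n; rewrite big_cons; case: (P i); rewrite ?mul1r ?mul0r ?add0r.
by apply: geom_boundedD => //; exact: geom_boundedZ.
Qed.

Lemma expgenD s s' t : geom_bounded s -> geom_bounded s' ->
  expgen (fun n => s n + s' n) t = expgen s t + expgen s' t.
Proof.
move=> hs hs'; rewrite /expgen -lim_seriesD; try exact: cvg_expgen.
congr (limn (series _)); apply/funext => n.
by rewrite mulrDr.
Qed.

Lemma expgenZ (a : R) s t : geom_bounded s ->
  expgen (fun n => a * s n) t = a * expgen s t.
Proof.
move=> hs; rewrite /expgen.
rewrite -[RHS]/(a *: _) -lim_seriesZ; last exact: cvg_expgen.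
congr (limn (series _)); apply/funext => n.
by rewrite mulrCA.
Qed.

Lemma expgen_sum (I : Type) (r : seq I) (P : pred I) (F : I -> nat -> R) t :
  (forall i, geom_bounded (F i)) ->
  expgen (fun n => \sum_(i <- r | P i) F i n) t =
  \sum_(i <- r | P i) expgen (F i) t.
Proof.
move=> hF; elim: r => [|i r ih].
  rewrite big_nil /expgen.
  rewrite (_ : (fun _ => _) = (fun=> 0)); last first.
    by apply/funext => n; rewrite big_nil mulr0.
  by apply: cvg_lim => //; apply: cvg_near_cst; apply: nearW => n;
    rewrite /series /= big1.
have -> : (fun n => \sum_(j <- i :: r | P j) F j n) =
    (fun n => (P i)%:R * F i n + \sum_(j <- r | P j) F j n).
  by apply/funext => n; rewrite big_cons; case: (P i); rewrite ?mul1r ?mul0r ?add0r.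
rewrite expgenD; [|exact: geom_boundedZ|exact: geom_bounded_sum].
rewrite expgenZ // ih big_cons.
by case: (P i); rewrite ?mul1r ?mul0r ?add0r.
Qed.

Lemma expgen_le s s' t : 0 <= t -> geom_bounded s -> geom_bounded s' ->
  (forall n, s n <= s' n) -> expgen s t <= expgen s' t.
Proof.
move=> t0 hs hs' le; apply: lim_series_le; try exact: cvg_expgen.
by move=> n; rewrite ler_wpM2l // exp_coeff_ge0.
Qed.

End ExponentialGeneratingFunctions.

(** * Exponentials of operators given by a matrix *)

Section Operators.
Variables (R : realType) (S : finType).
Implicit Types (A B : (S -> R) -> (S -> R)) (f g : S -> R) (t : R).

(** Operators are bare functions, so linearity has to be carried by an explicit matrix; finiteness
    of the matrix also yields the geometric growth of the iterates. *)
Definition has_kernel (a : S -> S -> R) A :=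
  forall f x, A f x = \sum_y a x y * f y.

Lemma geom_bounded_iter a A f x : has_kernel a A ->
  geom_bounded (fun n => iter n A f x).
Proof.
(* [c] is the sum of all absolute entries, so one application of [A] multiplies the l1 norm [F] by
   at most [c]. *)
move=> aA; pose c := \sum_x \sum_y `|a x y|.
pose F g := \sum_x `|g x|.
have c0 : 0 <= c by rewrite sumr_ge0 // => u _; rewrite sumr_ge0.
have FA g : F (A g) <= c * F g.
  rewrite /c mulr_suml; apply: ler_sum => u _; rewrite aA.
  apply: (le_trans (ler_norm_sum _ _ _)); rewrite mulr_suml.
  apply: ler_sum => v _; rewrite normrM ler_wpM2l //.
  by rewrite /F (bigD1 v) //= lerDl sumr_ge0.
exists (F f), c => n.
apply: (@le_trans _ _ (F (iter n A f))).
  by rewrite /F (bigD1 x) //= lerDl sumr_ge0.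
elim: n => [|n ih] /=; first by rewrite expr0 mulr1.
apply: (le_trans (FA _)); rewrite exprS mulrCA.
exact: ler_wpM2l.
Qed.

Lemma exp_opE A t f x : exp_op A t f x = expgen (fun n => iter n A f x) t.
Proof. by []. Qed.

Lemma exp_op0 A f x : exp_op A 0 f x = f x.
Proof. exact: expgen0. Qed.

Lemma has_kernel_exp_op a A t f x : has_kernel a A ->
  exp_op A t (A f) x = \sum_y a x y * exp_op A t f y.
Proof.
move=> aA; rewrite exp_opE.
have gb y := geom_bounded_iter f y aA.
rewrite (_ : (fun n => _) = (fun n => \sum_y a x y * iter n A f y)); last first.
  by apply/funext => n; rewrite -iterSr /= aA.
rewrite expgen_sum; last by move=> y; exact: geom_boundedZ.
by apply: eq_bigr => y _; rewrite expgenZ.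
Qed.

Lemma is_derive_exp_op a A t f x : has_kernel a A ->
  is_derive t 1 (fun t => exp_op A t f x) (exp_op A t (A f) x).
Proof.
move=> aA; apply: (is_derive_congr (is_derive_expgen t (geom_bounded_iter f x aA))) => //.
by rewrite exp_opE; congr expgen; apply/funext => n; rewrite iterSr.
Qed.

Lemma is_derive_exp_opl a A t f x : has_kernel a A ->
  is_derive t 1 (fun t => exp_op A t f x) (\sum_y a x y * exp_op A t f y).
Proof. by move=> aA; rewrite -has_kernel_exp_op //; exact: is_derive_exp_op aA. Qed.

(** Gronwall for the squared Euclidean norm of the difference: it starts at zero and its growth rate
    is at most [2 c], with [c] the sum of the absolute entries of the matrix. *)
Lemma linear_ode_uniq (a : S -> S -> R) (u v : R -> S -> R) T : 0 <= T ->
  (forall t x, is_derive t 1 (u ^~ x) (\sum_y a x y * u t y)) ->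
  (forall t x, is_derive t 1 (v ^~ x) (\sum_y a x y * v t y)) ->
  u 0 =1 v 0 -> u T =1 v T.
Proof.
move=> T0 du dv uv0.
pose w t x := u t x + (-1) * v t x.
have dw t x : is_derive t 1 (w ^~ x) (\sum_y a x y * w t y).
  apply: (is_derive_congr (is_derive_addf (du t x) (is_derive_scale (-1) (dv t x)))) => //.
  rewrite mulr_sumr -big_split /=; apply: eq_bigr => y _; rewrite /w; ring.
pose c := \sum_x \sum_y `|a x y|.
pose N t := \sum_x w t x * w t x.
have dN t : is_derive t 1 N (\sum_x 2 * (w t x * \sum_y a x y * w t y)).
  apply: is_derive_sumf => x.
  apply: (is_derive_congr (is_derive_mulf (dw t x) (dw t x))) => //.
  ring.
have N0 t : 0 <= N t by rewrite sumr_ge0 // => x _; rewrite -expr2 sqr_ge0.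
have wN t x : w t x ^+ 2 <= N t.
  rewrite /N (bigD1 x) //= expr2 lerDl sumr_ge0 // => y _; by rewrite -expr2 sqr_ge0.
have : N T <= expR ((2 * c) * (T - 0)) * N 0.
  apply: (gronwall_le T0 (fun t _ => dN t)) => t _.
  rewrite -mulr_sumr -mulrA ler_pM2l // /c mulr_suml; apply: ler_sum => x _.
  rewrite mulr_sumr mulr_suml; apply: ler_sum => y _.
  rewrite mulrCA; apply: (le_trans (ler_norm _)); rewrite normrM ler_wpM2l //.
  rewrite ler_norml; have := wN t x; have := wN t y.
  have := sqr_ge0 (w t x - w t y); have := sqr_ge0 (w t x + w t y); nra.
have -> : N 0 = 0.
  by rewrite /N big1 // => x _; rewrite /w uv0 mulN1r subrr mul0r.
rewrite mulr0 => NT x.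
have : w T x ^+ 2 <= 0 by exact: le_trans (wN _ _) NT.
rewrite le_eqVlt ltNge sqr_ge0 orbF sqrf_eq0 /w mulN1r subr_eq0.
by move/eqP.
Qed.

(** Instead of multiplying power series, both sides are recognized as solutions of one linear
    differential equation with the same initial value. This is uniformization: a generator is traded
    for an operator with nonnegative entries. *)
Lemma exp_op_shift a A B (m t : R) f x : has_kernel a A ->
  (forall f x, B f x = A f x + m * f x) -> 0 <= t ->
  exp_op A t f x = expR (- m * t) * exp_op B t f x.
Proof.
move=> aA AB t0.
have bB : has_kernel (fun x y => a x y + m * (x == y)%:R) B.
  move=> g y; rewrite AB aA.
  rewrite [RHS](eq_bigr (fun z => a y z * g z + m * (y == z)%:R * g z)); last first.
    by move=> z _; rewrite mulrDl.
  rewrite big_split /=; congr (_ + _); rewrite (bigD1 y) //= big1 => [|z zy].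
    by rewrite eqxx mulr1 addr0.
  by rewrite eq_sym (negbTE zy) mulr0 mul0r.
apply: (@linear_ode_uniq a (fun t x => exp_op A t f x)
  (fun t x => expR (- m * t) * exp_op B t f x) t t0) => [s y|s y|y].
- exact: is_derive_exp_opl.
- apply: (is_derive_congr (is_derive_mulf (is_derive_expRM s (- m))
    (is_derive_exp_opl s f y bB))) => //.
  rewrite (eq_bigr (fun z => a y z * exp_op B s f z +
    m * (y == z)%:R * exp_op B s f z)); last by move=> z _; rewrite mulrDl.
  rewrite big_split /=.
  rewrite [\sum_z m * _ * _](bigD1 y) //= [\sum_(_ | _ != y) _]big1 => [|z zy]; last first.
    by rewrite eq_sym (negbTE zy) mulr0 mul0r.
  rewrite eqxx mulr1 addr0.
  rewrite [RHS](eq_bigr (fun z => expR (- m * s) * (a y z * exp_op B s f z))); last first.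
    by move=> z _; rewrite mulrCA.
  rewrite -mulr_sumr; ring.
- by rewrite !exp_op0 mulr0 expR0 mul1r.
Qed.

End Operators.

(** * Labelled particles and the binomial splitting kernel *)

Section FiberCounts.
Variable T : finType.

Definition fiber_card (k : nat) (x : {ffun 'I_k -> T}) (y : T) : nat :=
  (\sum_i (x i == y))%N.

Lemma sum_fiber_card k (x : {ffun 'I_k -> T}) : (\sum_y fiber_card x y)%N = k.
Proof.
rewrite exchange_big /= -[RHS]card_ord -sum1_card; apply: eq_bigr => i _.
by rewrite (bigD1 (x i)) //= eqxx big1 // => y; rewrite eq_sym => /negbTE ->.
Qed.

Lemma fiber_cardE k (x : {ffun 'I_k -> T}) y :
  fiber_card x y = #|[set i | x i == y]|.
Proof. by rewrite -sum1dep_card big_mkcond; apply: eq_bigr => i _; case: eqP. Qed.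

Definition ffun_cons k (p : T * {ffun 'I_k -> T}) : {ffun 'I_k.+1 -> T} :=
  [ffun i => if unlift ord0 i is Some j then p.2 j else p.1].

Lemma ffun_cons_bij k : bijective (@ffun_cons k).
Proof.
exists (fun x : {ffun 'I_k.+1 -> T} => (x ord0, [ffun j => x (lift ord0 j)])).
  move=> [y x]; rewrite /= ffunE unlift_none; congr (_, _).
  by apply/ffunP => j; rewrite !ffunE liftK.
move=> x; apply/ffunP => i; rewrite ffunE /=.
by case: unliftP => [j|] ->; rewrite ?ffunE.
Qed.

Lemma fiber_card_cons k (p : T * {ffun 'I_k -> T}) y :
  fiber_card (ffun_cons p) y = ((p.1 == y) + fiber_card p.2 y)%N.
Proof.
rewrite /fiber_card big_ord_recl ffunE unlift_none; congr (_ + _)%N.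
by apply: eq_bigr => j _; rewrite ffunE liftK.
Qed.

(** Induction on the number of labels, splitting on the site [y0] of the first one. The others then
    have the profile [z] lowered by one at [y0], so [y0] contributes [z y0 * k!], and these
    contributions add up to [(k+1)!]. *)
Lemma card_fiber_multinomial k (z : T -> nat) : (\sum_y z y)%N = k ->
  (#|[set x : {ffun 'I_k -> T} | [forall y, fiber_card x y == z y]]|
   * \prod_y (z y)`!)%N = k`!.
Proof.
elim: k z => [|k ih] z zk.
  have z0 y : z y = 0%N.
    by apply/eqP; rewrite -leqn0 -zk (bigD1 y) //= leq_addr.
  rewrite big1 ?muln1 => [|y _]; last by rewrite z0.
  rewrite (@eq_card _ _ predT) => [|x]; first by rewrite card_ffun card_ord.
  rewrite !inE; apply/forallP => y.
  by rewrite /fiber_card big_ord0 z0.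
rewrite -sum1dep_card (reindex (@ffun_cons k)) /=; last first.
  exact: onW_bij (ffun_cons_bij k).
rewrite (eq_bigl (fun p : T * {ffun 'I_k -> T} =>
  xpredT p.1 && [forall y, ((p.1 == y) + fiber_card p.2 y)%N == z y])); last first.
  by move=> p /=; apply: eq_forallb => y; rewrite fiber_card_cons.
rewrite -(pair_big_dep xpredT (fun y0 (x : {ffun 'I_k -> T}) =>
  [forall y, ((y0 == y) + fiber_card x y)%N == z y]) (fun _ _ => 1%N)) /=.
rewrite big_distrl /= factS -zk big_distrl /=.
apply: eq_bigr => y0 _; rewrite sum1dep_card.
have [zy0|zy0] := posnP (z y0).
  rewrite zy0 mul0n eq_card0 // => x.
  rewrite !inE; apply/negbTE/forallPn; exists y0.
  by rewrite eqxx zy0.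
pose z' y := (z y - (y0 == y))%N.
have zE y : z y = ((y0 == y) + z' y)%N.
  by rewrite /z'; case: eqP => [<-|_] //=; rewrite subnKC.
have z'k : (\sum_y z' y)%N = k.
  have := zk; rewrite (eq_bigr _ (fun y _ => zE y)) big_split /=.
  rewrite (bigD1 y0) //= eqxx big1 => [|y]; last by rewrite eq_sym => /negbTE ->.
  by rewrite addn0 add1n => -[].
rewrite -(ih z' z'k) (bigD1 y0) //= [in RHS](bigD1 y0) //=.
rewrite [in LHS](zE y0) eqxx add1n factS.
rewrite (eq_bigr (fun y => (z' y)`!)); last first.
  by move=> y yy0; rewrite zE eq_sym (negbTE yy0).
rewrite (zE y0) eqxx add1n -!mulnA mulnCA; congr (_ * (_ * _))%N.
apply: eq_card => x; rewrite !inE; apply: eq_forallb => y.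
by rewrite zE eqn_add2l.
Qed.

End FiberCounts.

Section Configurations.
Variables (R : realType) (d N k : nat).
Local Notation T := (torus d N).
Implicit Types (x : {ffun 'I_k -> T}) (z : conf d N k) (a b y : T).

Lemma fiber_card_lt x y : (fiber_card x y < k.+1)%N.
Proof. by rewrite ltnS -[leqRHS](sum_fiber_card x) (bigD1 y) //= leq_addr. Qed.

Definition cnt_fun x : {ffun T -> 'I_k.+1} :=
  [ffun y => Ordinal (fiber_card_lt x y)].

Lemma cnt_subproof x : (\sum_y cnt_fun x y)%N == k.
Proof.
by rewrite -[eqbRHS](sum_fiber_card x); apply/eqP/eq_bigr => y _; rewrite ffunE.
Qed.

(** Forgetting the labels; the whole dynamics is lifted along this map. *)
Definition cnt x : conf d N k := exist _ (cnt_fun x) (cnt_subproof x).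

Lemma occ_cnt x y : occ (cnt x) y = fiber_card x y.
Proof. by rewrite /occ /= ffunE. Qed.

Lemma sum_occ z : (\sum_y occ z y)%N = k.
Proof. by apply/eqP; case: z. Qed.

Lemma cnt_eqE x z : (cnt x == z) = [forall y, fiber_card x y == occ z y].
Proof.
apply/eqP/forallP => [<- y|h]; first by rewrite occ_cnt.
apply: val_inj; apply/ffunP => y; apply: val_inj.
by rewrite /= ffunE /=; apply/eqP/h.
Qed.

Lemma card_cnt_fiber z :
  (#|[set x | cnt x == z]| * \prod_y (occ z y)`!)%N = k`!.
Proof.
rewrite -[RHS](card_fiber_multinomial (sum_occ z)); congr (_ * _)%N.
by apply: eq_card => x; rewrite !inE cnt_eqE.
Qed.

Lemma cnt_surj z : exists x, cnt x = z.
Proof.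
have /card_gt0P[x] : (0 < #|[set x | cnt x == z]|)%N.
  rewrite lt0n; apply/eqP => h; have := card_cnt_fiber z.
  by rewrite h mul0n => /esym/eqP; rewrite -leqn0 leqNgt fact_gt0.
by rewrite inE => /eqP <-; exists x.
Qed.

(* [M_{ab}] acting on functions; it is self-adjoint, so that the same formula
   moves a distribution when the clock of [{a, b}] rings. *)
Definition avg a b (f : T -> R) : T -> R :=
  fun y => if (y == a) || (y == b) then (f a + f b) / 2 else f y.

Definition avgk a b (y y' : T) : R := avg a b (fun w => (w == y')%:R) y.

Lemma avgE a b f y : avg a b f y = \sum_y' avgk a b y y' * f y'.
Proof.
have sumD w : \sum_y' (w == y')%:R * f y' = f w.
  rewrite (bigD1 w) //= eqxx mul1r big1 ?addr0 // => v.
  by rewrite eq_sym => /negbTE ->; rewrite mul0r.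
rewrite /avgk /avg; case: ifP => _; last by rewrite sumD.
under eq_bigr do rewrite mulrAC mulrDl.
by rewrite -mulr_suml big_split /= !sumD.
Qed.

Lemma avgk_sym a b y y' : avgk a b y y' = avgk a b y' y.
Proof.
rewrite /avgk /avg (eq_sym a y') (eq_sym b y') (eq_sym a y) (eq_sym b y) (eq_sym y' y).
do ![case: eqP => ? /=]; rewrite ?addr0 ?add0r ?mul0r //; congruence.
Qed.

(** Each particle has its own law because, given the rings, it carries the averaging process of its
    own starting site. *)
Definition Phi (f : conf d N k -> R) (nu : 'I_k -> T -> R) : R :=
  \sum_(x : {ffun 'I_k -> T}) (\prod_i nu i (x i)) * f (cnt x).

Definition ring_op a b (f : conf d N k -> R) : conf d N k -> R :=
  fun z => \sum_z' split_kernel R a b z z' * f z'.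

(** Binomial splitting is the image of independent fair coins when labels are forgotten. With [I]
    the set of particles on the edge, every labelled outcome reachable from [x] ([good]) has weight
    [2^-#|I|], and those lying over [z'] correspond to the subsets of [I] of size [occ z' a] that
    are sent to [a]. *)
Lemma sum_prod_avgk a b x z' : a != b ->
  \sum_(x' : {ffun 'I_k -> T} | cnt x' == z') \prod_i avgk a b (x i) (x' i)
  = split_kernel R a b (cnt x) z'.
Proof.
move=> ab; rewrite /split_kernel.
pose I := [set i | x i \in [:: a; b]].
pose good (x' : {ffun 'I_k -> T}) :=
  [forall i, if i \in I then x' i \in [:: a; b] else x' i == x i].
have prodE x' : \prod_i avgk a b (x i) (x' i) =
    if good x' then 2^-1 ^+ #|I| else 0 :> R.
  case: ifP => [/forallP gx|/negbT/forallPn[i xi]]; last first.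
    rewrite (bigD1 i) //=; suff -> : avgk a b (x i) (x' i) = 0 by rewrite mul0r.
    move: xi; rewrite /avgk /avg !inE; case: ifP => _.
      rewrite negb_or => /andP[xa xb].
      by rewrite ![_ == x' i]eq_sym (negbTE xa) (negbTE xb) addr0 mul0r.
    by rewrite eq_sym => /negbTE ->.
  rewrite (bigID (mem I)) /= [X in _ * X]big1 ?mulr1 => [|i iI]; last first.
    have := gx i; rewrite (negbTE iI) => /eqP ->.
    by move: iI; rewrite /avgk /avg !inE => /negbTE ->; rewrite eqxx.
  rewrite (eq_bigr (fun=> 2^-1)) ?prodr_const // => i iI.
  have := gx i; rewrite iI; move: iI; rewrite /avgk /avg !inE => ->.
  by case/orP => /eqP ->; rewrite eqxx ?[b == a]eq_sym (negbTE ab) ?addr0 ?add0r mul1r.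
have fcI : (fiber_card x a + fiber_card x b)%N = #|I|.
  rewrite /fiber_card -big_split /= -sum1dep_card [RHS]big_mkcond /=.
  apply: eq_bigr => i _; rewrite !inE.
  by case: eqVneq => [->|_] /=; rewrite ?(negbTE ab) //; case: eqVneq.
have good_out x' u : good x' -> u \notin [:: a; b] ->
    fiber_card x' u = fiber_card x u.
  move=> /forallP gx uab; apply: eq_bigr => i _; have := gx i.
  case: ifP => [|_ /eqP -> //]; rewrite inE => xi x'i.
  have nu (v : T) : v \in [:: a; b] -> (v == u) = false.
    by move=> vab; apply: contraNF uab => /eqP <-.
  by rewrite !nu.
have good_in x' : good x' -> (fiber_card x' a + fiber_card x' b)%N = #|I|.
  move=> /forallP gx.
  rewrite /fiber_card -big_split /= -sum1dep_card [RHS]big_mkcond /=.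
  apply: eq_bigr => i _; have := gx i; rewrite inE.
  case: ifP => [_|xi /eqP ->].
    rewrite !inE => /orP[] /eqP ->; rewrite eqxx ?[b == a]eq_sym (negbTE ab) //.
  by move: xi; rewrite !inE; case: eqVneq => //= _; case: eqVneq.
under eq_bigr do rewrite prodE.
rewrite -big_mkcondr /=.
case: ifP => [/forallP agree|/negbT/forallPn[u]]; last first.
  rewrite negb_imply => /andP[uab]; rewrite occ_cnt => ne.
  rewrite big_pred0 // => x'; apply/negbTE/negP => /andP[/eqP xz gx].
  by move: ne; rewrite -xz occ_cnt (good_out _ _ gx uab) eqxx.
rewrite !occ_cnt fcI.
(* Equal totals and agreement off the edge leave equally many particles on the edge. *)
have occI : (occ z' a + occ z' b)%N = #|I|.
  have : (\sum_y occ z' y)%N = (\sum_y fiber_card x y)%N.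
    by rewrite sum_occ sum_fiber_card.
  rewrite (bigD1 a) // (bigD1 b) /=; last by rewrite eq_sym.
  rewrite [in RHS](bigD1 a) // [in RHS](bigD1 b) /=; last by rewrite eq_sym.
  rewrite [X in (_ + (_ + X))%N = _](eq_bigr (fun y => fiber_card x y)); last first.
    move=> y /andP[ya yb]; have := agree y.
    by rewrite !inE negb_or ya yb /= => /eqP ->; rewrite occ_cnt.
  by rewrite !addnA => /eqP; rewrite eqn_add2r fcI => /eqP.
have condE x' : (cnt x' == z') && good x' = (fiber_card x' a == occ z' a) && good x'.
  apply/andP/andP => [[/eqP <- gx]|[/eqP xa gx]]; first by rewrite occ_cnt eqxx.
  split => //; rewrite cnt_eqE; apply/forallP => u.
  have [uab|uab] := boolP (u \in [:: a; b]); last first.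
    rewrite (good_out _ _ gx uab) -occ_cnt eq_sym.
    by have := agree u; rewrite uab.
  move: uab; rewrite !inE => /orP[] /eqP ->; first by rewrite xa.
  by rewrite -(eqn_add2l (occ z' a)) -{1}xa good_in // occI.
rewrite (eq_bigl _ _ condE).
(* [h B] sends the particles of [B] to [a] and the rest of [I] to [b]; [h'] recovers [B]. *)
pose h (B : {set 'I_k}) : {ffun 'I_k -> T} :=
  [ffun i => if i \in I then if i \in B then a else b else x i].
pose h' (x' : {ffun 'I_k -> T}) : {set 'I_k} := [set i in I | x' i == a].
rewrite (reindex_onto h h') /=; last first.
  move=> x' /andP[_ /forallP gx]; apply/ffunP => i; rewrite ffunE !inE.
  have := gx i; rewrite inE; case: ifP; rewrite !inE => xi.
    by rewrite xi => /orP[] /eqP ->; rewrite ?eqxx // [b == a]eq_sym (negbTE ab).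
  by rewrite xi => /eqP ->.
rewrite (eq_bigl (mem [set B : {set 'I_k} | B \subset I & #|B| == occ z' a])); last first.
  move=> B; rewrite !inE.
  have hB : (h' (h B) == B) = (B \subset I).
    apply/eqP/idP => [<-|BI]; first by apply/fintype.subsetP => i; rewrite !inE => /andP[].
    apply/setP => i; rewrite !inE ffunE inE.
    have [iB|iB] := boolP (i \in B).
      by have := fintype.subsetP BI i iB; rewrite !inE => ->; rewrite eqxx.
    case: ifP => [_|xi]; first by rewrite [b == a]eq_sym (negbTE ab) andbF.
    by move: xi; rewrite ?inE; case: (x i == a) => //= _; rewrite andbF.
  rewrite hB andbC; case: (boolP (B \subset I)) => //= BI.
  have -> : good (h B).
    apply/forallP => i; have [iI|/negbTE iI] := boolP (i \in I); rewrite ffunE iI //.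
    by case: (i \in B); rewrite !inE eqxx ?orbT.
  rewrite andbT; congr (_ == _).
  rewrite fiber_cardE; apply: eq_card => i; rewrite !inE ffunE.
  have [iB|iB] := boolP (i \in B).
    by have := fintype.subsetP BI i iB; rewrite !inE => ->; rewrite eqxx.
  by case: ifP => [_|]; [rewrite eq_sym (negbTE ab)|rewrite !inE => /negbT; rewrite negb_or => /andP[/negbTE]].
rewrite sumr_const cards_draws /binomial_pmf.
have -> : unstable.onem (2^-1 : R) = 2^-1 by rewrite /unstable.onem; lra.
have [le|lt] := leqP (occ z' a) #|I|; last by rewrite bin_small.
by rewrite -exprD subnKC.
Qed.

Lemma ring_op_cnt a b f x : a != b ->
  ring_op a b f (cnt x) =
  \sum_(x' : {ffun 'I_k -> T}) (\prod_i avgk a b (x i) (x' i)) * f (cnt x').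
Proof.
move=> ab; rewrite (partition_big cnt xpredT) //=; apply: eq_bigr => z' _.
rewrite -(sum_prod_avgk _ _ ab) mulr_suml; apply: eq_bigr => x' /eqP -> //.
Qed.

(** Duality: a ring acting on observables of unlabelled configurations is moved onto all
    one-particle laws at once, keeping the product form. This is where indistinguishable particles
    become independent ones. *)
Lemma Phi_ring_op a b f (nu : 'I_k -> T -> R) : a != b ->
  Phi (ring_op a b f) nu = Phi f (fun i => avg a b (nu i)).
Proof.
move=> ab; rewrite /Phi.
under eq_bigr do rewrite ring_op_cnt // mulr_sumr.
rewrite exchange_big /=; apply: eq_bigr => x' _.
under eq_bigr do rewrite mulrA -big_split /=.
rewrite -mulr_suml; congr (_ * _).
rewrite -(bigA_distr_bigA (fun i y => nu i y * avgk a b y (x' i))) /=.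
by apply: eq_bigr => i _; rewrite avgE; apply: eq_bigr => y _; rewrite avgk_sym mulrC.
Qed.

Definition dirac_fam x : 'I_k -> T -> R := fun i y => (x i == y)%:R.

Lemma Phi_dirac f x : Phi f (dirac_fam x) = f (cnt x).
Proof.
rewrite /Phi (bigD1 x) //= big1 => [|i _]; last by rewrite /dirac_fam eqxx.
rewrite mul1r big1 ?addr0 // => x' xx'.
suff [i ne] : exists i, x i != x' i.
  by rewrite (bigD1 i) //= /dirac_fam (negbTE ne) !mul0r.
apply/existsP; rewrite -negb_forall; apply: contra xx' => /forallP h.
by apply/eqP/ffunP => i; apply/esym/eqP.
Qed.

Lemma multinomialE z : multinomial (unif R (d:=d) (N:=N)) z =
  #|[set x | cnt x == z]|%:R * ((N%:R ^+ d)^-1) ^+ k.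
Proof.
rewrite /multinomial /unif -expr_sum sum_occ; congr (_ * _).
rewrite -(card_cnt_fiber z) natrM -natr_prod mulfK //.
by rewrite pnatr_eq0 -lt0n; apply: prodn_gt0 => y; exact: fact_gt0.
Qed.

Lemma sum_multinomial f :
  \sum_z multinomial (unif R (d:=d) (N:=N)) z * f z =
  Phi f (fun=> unif R (d:=d) (N:=N)).
Proof.
rewrite /Phi (partition_big cnt xpredT) //=; apply: eq_bigr => z _.
rewrite multinomialE -sum1dep_card natr_sum !mulr_suml; apply: eq_bigr => x /eqP ->.
by rewrite /unif prodr_const card_ord mul1r.
Qed.

End Configurations.

Section CauchySchwarz.
Variables (R : realType) (I : finType).

(** Lagrange's identity: the difference of the two sides is half the double sum of
    [(a i * b j - a j * b i) ^+ 2]. *)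
Lemma cauchy_schwarz (a b : I -> R) :
  (\sum_i a i * b i) ^+ 2 <= (\sum_i a i ^+ 2) * (\sum_i b i ^+ 2).
Proof.
have E (u v : I -> R) : (\sum_i u i) * (\sum_i v i) = \sum_i \sum_j u i * v j.
  by rewrite mulr_suml; apply: eq_bigr => i _; rewrite mulr_sumr.
have S (u : I -> I -> R) : \sum_i \sum_j u i j = \sum_i \sum_j u j i.
  by rewrite exchange_big.
have : 0 <= \sum_i \sum_j (a i * b j - a j * b i) ^+ 2.
  by apply: sumr_ge0 => i _; apply: sumr_ge0 => j _; rewrite sqr_ge0.
have -> : \sum_i \sum_j (a i * b j - a j * b i) ^+ 2 =
    (\sum_i \sum_j a i ^+ 2 * b j ^+ 2) + (\sum_i \sum_j a j ^+ 2 * b i ^+ 2)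
    - 2 * \sum_i \sum_j (a i * b i) * (a j * b j).
  rewrite mulr_sumr -sumrN -!big_split /=; apply: eq_bigr => i _.
  rewrite mulr_sumr -sumrN -!big_split /=; apply: eq_bigr => j _; ring.
rewrite -(S (fun i j => a i ^+ 2 * b j ^+ 2)) expr2 !E; lra.
Qed.

Lemma sqr_sum_le (a : I -> R) :
  (\sum_i a i) ^+ 2 <= #|I|%:R * \sum_i a i ^+ 2.
Proof.
have := cauchy_schwarz (fun=> 1) a.
under eq_bigr do rewrite mul1r.
by under [X in X * _]eq_bigr do rewrite expr1n; rewrite sumr_const.
Qed.

End CauchySchwarz.

(** * Sums over unordered edges *)

Section EdgeSums.
Variables (R : realType) (d N : nat).
Local Notation T := (torus d N).

Definition edge_sum (F : T -> T -> R) : R :=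
  \sum_(a : T) \sum_(b : T | nbr a b && (enum_rank a < enum_rank b)%N) F a b.

Definition nb_edges : R := edge_sum (fun _ _ => 1).

Lemma nbr_neq (a b : T) : nbr a b -> a != b.
Proof. by case/andP. Qed.

Lemma nbrC (a b : T) : nbr a b = nbr b a.
Proof.
rewrite /nbr eq_sym; congr (_ && _); apply: eq_existsb => i.
rewrite orbC; congr (_ && _); apply: eq_forallb => j.
by congr (_ ==> _); rewrite eq_sym.
Qed.

Lemma eq_edge_sum F G : (forall a b, nbr a b -> F a b = G a b) ->
  edge_sum F = edge_sum G.
Proof. by move=> FG; apply: eq_bigr => a _; apply: eq_bigr => b /andP[/FG]. Qed.

Lemma ler_edge_sum F G : (forall a b, nbr a b -> F a b <= G a b) ->
  edge_sum F <= edge_sum G.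
Proof. by move=> FG; apply: ler_sum => a _; apply: ler_sum => b /andP[/FG]. Qed.

Lemma edge_sum_ge0 F : (forall a b, nbr a b -> 0 <= F a b) -> 0 <= edge_sum F.
Proof. by move=> FG; apply: sumr_ge0 => a _; apply: sumr_ge0 => b /andP[/FG]. Qed.

Lemma edge_sumD F G : edge_sum (fun a b => F a b + G a b) = edge_sum F + edge_sum G.
Proof.
by rewrite /edge_sum -big_split /=; apply: eq_bigr => a _; rewrite big_split.
Qed.

Lemma edge_sumZ (c : R) F : edge_sum (fun a b => c * F a b) = c * edge_sum F.
Proof.
by rewrite /edge_sum mulr_sumr; apply: eq_bigr => a _; rewrite mulr_sumr.
Qed.

Lemma edge_sum_exchange (I : Type) (r : seq I) (P : pred I) (F : I -> T -> T -> R) :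
  \sum_(i <- r | P i) edge_sum (F i) =
  edge_sum (fun a b => \sum_(i <- r | P i) F i a b).
Proof.
by rewrite exchange_big /=; apply: eq_bigr => a _; rewrite exchange_big.
Qed.

(** The rank order merely selects one orientation of each edge. Passing to ordered pairs frees the
    sum from the enumeration of sites and makes its invariance under automorphisms accessible. *)
Lemma edge_sum_sym F : (forall a b, F a b = F b a) ->
  edge_sum F = 2^-1 * \sum_a \sum_(b | nbr a b) F a b.
Proof.
move=> FC; pose lt (a b : T) := (enum_rank a < enum_rank b)%N.
have S : \sum_a \sum_(b | nbr a b) F a b = edge_sum F +
    \sum_a \sum_(b | nbr a b && lt b a) F a b.
  rewrite -big_split /=; apply: eq_bigr => a _.
  rewrite (bigID (lt a)) /=; congr (_ + _); apply: eq_bigl => b.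
  case: (boolP (nbr a b)) => //= /nbr_neq ab.
  rewrite /lt -leqNgt [RHS]ltn_neqAle (inj_eq val_inj) (inj_eq enum_rank_inj).
  by rewrite eq_sym ab.
rewrite S (_ : \sum_a \sum_(b | nbr a b && lt b a) F a b = edge_sum F); last first.
  rewrite (exchange_big_dep xpredT) //=; apply: eq_bigr => a _.
  by apply: eq_big => [b|b _]; rewrite 1?nbrC.
lra.
Qed.

End EdgeSums.

(** * The averaging process and product laws *)

Section Averaging.
Variables (R : realType) (d N : nat).
Local Notation T := (torus d N).
Implicit Types (f g nu : T -> R) (h : T * T -> R) (a b x y : T).

Definition avg2 a b h : T * T -> R :=
  fun p => avg a b (fun u => avg a b (fun v => h (u, v)) p.2) p.1.

(** This and [avg2_gen] are generators shifted by the number of edges: their [j]-th iterates sum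
    over all sequences of [j] rings, with nonnegative weights. *)
Definition avg_gen f : T -> R := fun x => edge_sum (fun a b => avg a b f x).

Definition avg2_gen h : T * T -> R := fun p => edge_sum (fun a b => avg2 a b h p).

Definition diag_fun : T * T -> R := fun p => (p.1 == p.2)%:R.

Definition pairing nu nu' h : R := \sum_x \sum_y nu x * nu' y * h (x, y).

Lemma avg_adj a b f g : \sum_x avg a b f x * g x = \sum_x f x * avg a b g x.
Proof.
under eq_bigr do rewrite avgE mulr_suml.
rewrite exchange_big /=; apply: eq_bigr => y _.
rewrite avgE mulr_sumr; apply: eq_bigr => x _.
by rewrite avgk_sym; ring.
Qed.

(** The two particles undergo the same ring, each with its own coin; self-adjointness of [avg] is
    applied in each variable in turn. *)
Lemma pairing_avg a b nu nu' h :
  pairing (avg a b nu) (avg a b nu') h = pairing nu nu' (avg2 a b h).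
Proof.
rewrite /pairing.
transitivity (\sum_x avg a b nu x * \sum_y avg a b nu' y * h (x, y)).
  by apply: eq_bigr => x _; rewrite mulr_sumr; apply: eq_bigr => y _; rewrite mulrA.
rewrite avg_adj; apply: eq_bigr => x _.
transitivity (nu x * \sum_y nu' y * avg2 a b h (x, y)); last first.
  by rewrite mulr_sumr; apply: eq_bigr => y _; rewrite mulrA.
congr (_ * _); rewrite {1}/avg.
have E u : \sum_y avg a b nu' y * h (u, y) =
    \sum_y nu' y * avg a b (fun v => h (u, v)) y by rewrite avg_adj.
case: ifP => xab; last first.
  by rewrite E; apply: eq_bigr => y _; rewrite /avg2 /= {2}/avg xab.
rewrite !E -big_split /= mulr_suml; apply: eq_bigr => y _.
by rewrite -mulrDr -mulrA /avg2 /= [in RHS]/avg xab.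
Qed.

Lemma pairing_edge_sum nu nu' (H : T -> T -> T * T -> R) :
  pairing nu nu' (fun p => edge_sum (fun a b => H a b p)) =
  edge_sum (fun a b => pairing nu nu' (H a b)).
Proof.
rewrite /pairing -edge_sum_exchange; apply: eq_bigr => x _.
rewrite -edge_sum_exchange; apply: eq_bigr => y _.
by rewrite edge_sumZ.
Qed.

Lemma pairing_avg2_gen nu nu' h : pairing nu nu' (avg2_gen h) =
  edge_sum (fun a b => pairing (avg a b nu) (avg a b nu') h).
Proof.
by rewrite pairing_edge_sum; apply: eq_edge_sum => a b _; rewrite pairing_avg.
Qed.

Lemma pairing_diag nu nu' : pairing nu nu' diag_fun = \sum_x nu x * nu' x.
Proof.
apply: eq_bigr => x _; rewrite (bigD1 x) //= big1 ?addr0 ?/diag_fun ?eqxx ?mulr1 //.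
by move=> y; rewrite eq_sym /= => /negbTE ->; rewrite mulr0.
Qed.

Lemma pairing_dirac x y h :
  pairing (fun u => (x == u)%:R) (fun u => (y == u)%:R) h = h (x, y).
Proof.
rewrite /pairing (bigD1 x) //= (bigD1 y) //= !eqxx !mul1r.
rewrite big1 => [|v vy]; last by rewrite [y == v]eq_sym (negbTE vy) mulr0 mul0r.
rewrite big1 ?addr0 // => u ux; rewrite big1 // => v _.
by rewrite eq_sym (negbTE ux) !(mul0r, mulr0).
Qed.

Lemma avg_is_distr a b nu : a != b -> is_distr nu -> is_distr (avg a b nu).
Proof.
move=> ab [nu0 nu1]; split => [x|].
  by rewrite /avg; case: ifP => _ //; rewrite divr_ge0 // addr_ge0.
have <- : \sum_x nu x * avg a b (fun=> 1) x = 1.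
  rewrite -[RHS]nu1; apply: eq_bigr => x _; rewrite /avg; case: ifP => _; lra.
by rewrite -avg_adj; apply: eq_bigr => x _; rewrite mulr1.
Qed.

Lemma has_kernel_avg2 a b :
  has_kernel (fun p q => avgk R a b p.1 q.1 * avgk R a b p.2 q.2) (avg2 a b).
Proof.
move=> h [x y]; rewrite /avg2 /= avgE.
rewrite (eq_bigr (fun u => \sum_v avgk R a b x u * (avgk R a b y v * h (u, v)))); last first.
  by move=> u _; rewrite avgE mulr_sumr.
by rewrite pair_big /=; apply: eq_bigr => -[u v] _; rewrite mulrA.
Qed.

Lemma has_kernel_edge_sum (S : finType) (c : T -> T -> S -> S -> R)
    (A : T -> T -> (S -> R) -> S -> R) :
  (forall a b, has_kernel (c a b) (A a b)) ->
  has_kernel (fun x y : S => edge_sum (fun a b => c a b x y))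
    (fun (f : S -> R) (x : S) => edge_sum (fun a b => A a b f x)).
Proof.
move=> cA f x; rewrite (_ : edge_sum _ = edge_sum (fun a b => \sum_y c a b x y * f y)); last first.
  by apply: eq_edge_sum => a b _; rewrite cA.
rewrite -edge_sum_exchange; apply: eq_bigr => y _.
rewrite mulrC -edge_sumZ; apply: eq_edge_sum => a b _; exact: mulrC.
Qed.

Definition avg2_kernel := fun p q : T * T =>
  edge_sum (fun a b => avgk R a b p.1 q.1 * avgk R a b p.2 q.2).

Lemma has_kernel_avg2_gen : has_kernel avg2_kernel avg2_gen.
Proof. exact: (has_kernel_edge_sum has_kernel_avg2). Qed.

End Averaging.

(** * Chi-square bound for a fixed number of rings *)

Section Particles.
Variables (R : realType) (d N k : nat).
Hypothesis N_gt0 : (0 < N)%N.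
Local Notation T := (torus d N).
Local Notation n := ((N%:R : R) ^+ d).
Local Notation m := (nb_edges R d N).
Local Notation mu := (multinomial (k := k) (unif R (d:=d) (N:=N))).
Implicit Types (nu : 'I_k -> T -> R) (f : conf d N k -> R) (psi : T -> R).

Definition ring_gen f : conf d N k -> R :=
  fun z => edge_sum (fun a b => ring_op a b f z).

Lemma split_genE f z : ring_gen f z = split_gen f z + m * f z.
Proof.
rewrite /split_gen -/(edge_sum _) /ring_gen mulrC -edge_sumZ -edge_sumD.
by apply: eq_edge_sum => a b _; rewrite mulr1 subrK.
Qed.

Definition ring_kernel (z z' : conf d N k) : R :=
  edge_sum (fun a b => split_kernel R a b z z').

Lemma has_kernel_ring_gen : has_kernel ring_kernel ring_gen.
Proof. by apply: has_kernel_edge_sum => a b f z. Qed.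

Lemma has_kernel_split_gen :
  has_kernel (fun z z' => ring_kernel z z' - m * (z == z')%:R) (@split_gen R d N k).
Proof.
move=> f z; apply: (addIr (m * f z)); rewrite -split_genE has_kernel_ring_gen.
under [in RHS]eq_bigr do rewrite mulrBl.
rewrite big_split /= -addrA; set s := (X in _ + (X + _)).
suff -> : s = - (m * f z) by rewrite addNr addr0.
rewrite /s sumrN (bigD1 z) //= eqxx mulr1 big1 ?addr0 // => y.
by rewrite eq_sym => /negbTE ->; rewrite mulr0 mul0r.
Qed.

Lemma exp_split_gen t f z : 0 <= t ->
  exp_op (@split_gen R d N k) t f z = expR (- m * t) * exp_op ring_gen t f z.
Proof. exact: exp_op_shift has_kernel_split_gen split_genE. Qed.

Lemma Phi_ring_gen f nu :
  Phi (ring_gen f) nu = edge_sum (fun a b => Phi f (fun i => avg a b (nu i))).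
Proof.
rewrite /Phi; transitivity (edge_sum (fun a b => Phi (ring_op a b f) nu)).
  rewrite -edge_sum_exchange; apply: eq_bigr => x _.
  by rewrite -edge_sumZ.
by apply: eq_edge_sum => a b /nbr_neq ab; rewrite Phi_ring_op.
Qed.

Lemma card_torus : #|T|%:R = n.
Proof. by rewrite card_ffun !card_ord natrX. Qed.

Lemma n_gt0 : 0 < n.
Proof. by rewrite exprn_gt0 // ltr0n. Qed.

Lemma unif_distr : is_distr (unif R (d:=d) (N:=N)).
Proof.
split=> [x|]; first by rewrite /unif invr_ge0 ltW // n_gt0.
rewrite /unif sumr_const -[_ *+ #|_|]mulr_natl [X in X * _]card_torus mulfV //.
by rewrite gt_eqF // n_gt0.
Qed.

Lemma Phi_prod (g : 'I_k -> T -> R) nu :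
  \sum_(x : {ffun 'I_k -> T}) \prod_i (nu i (x i) * g i (x i)) =
  \prod_i \sum_y nu i y * g i y.
Proof. by rewrite -(bigA_distr_bigA (fun i y => nu i y * g i y)). Qed.

Lemma Phi_total nu : (forall i, is_distr (nu i)) ->
  \sum_(x : {ffun 'I_k -> T}) \prod_i nu i (x i) = 1.
Proof.
move=> nud; rewrite -(bigA_distr_bigA (fun i y => nu i y)) big1 // => i _.
by case: (nud i).
Qed.

Lemma Phi_le f g nu : (forall i, is_distr (nu i)) ->
  (forall z, f z <= g z) -> Phi f nu <= Phi g nu.
Proof.
move=> nud fg; apply: ler_sum => x _; apply: ler_wpM2l => //.
by apply: prodr_ge0 => i _; case: (nud i).
Qed.

Lemma Phi_cst (c : R) nu : (forall i, is_distr (nu i)) -> Phi (fun=> c) nu = c.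
Proof. by move=> nud; rewrite /Phi -mulr_suml Phi_total // mul1r. Qed.

Lemma sum_sqr_distr_ge (p : T -> R) : is_distr p -> 1 <= n * \sum_y p y * p y.
Proof.
move=> [_ p1]; have := sqr_sum_le p; rewrite p1 expr1n card_torus.
by under eq_bigr do rewrite expr2.
Qed.

Lemma expR_le_1D2 (x : R) : 0 <= x <= 2^-1 -> expR x <= 1 + 2 * x.
Proof.
move=> /andP[x0 x1]; have h := expR_ge1Dx (- x).
have : expR x * (1 - x) <= 1.
  by rewrite -[leRHS](expRxMexpNx_1 x) ler_pM2l ?expR_gt0.
have := expR_ge0 x; move: (expR x) => e; nra.
Qed.

(* [Phi] turns a family of one-particle laws into a law on configurations; the
   [L^2] distance of product measures is multiplicative. *)
Lemma Phi_tv_base (P : pred (conf d N k)) nu (e : R) : 0 < e ->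
  (forall i, is_distr (nu i)) ->
  `|Phi (fun z => (P z)%:R) nu - Phi (fun z => (P z)%:R) (fun=> unif R (d:=d) (N:=N))|
  <= e + e^-1 * \sum_i (n * (\sum_y nu i y * nu i y) - 1).
Proof.
move=> e0 nud; set q := `|_|; set X := \sum_i _.
have ud := unif_distr.
have chi0 i : 0 <= n * (\sum_y nu i y * nu i y) - 1.
  by rewrite subr_ge0 sum_sqr_distr_ge.
have X0 : 0 <= X by apply: sumr_ge0 => i _.
have q1 : q <= 1.
  have P01 (p : 'I_k -> T -> R) : (forall i, is_distr (p i)) ->
      0 <= Phi (fun z => (P z)%:R) p <= 1.
    move=> pd; apply/andP; split.
      by rewrite -[leLHS](Phi_cst 0 pd); apply: Phi_le => // z; case: (P z).
    by rewrite -[leRHS](Phi_cst 1 pd); apply: Phi_le => // z; case: (P z).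
  have := P01 _ nud; have := P01 _ (fun=> ud).
  rewrite /q ler_norml; lra.
(* Cauchy-Schwarz against counting measure leaves the chi-square distance of the product law, which
   is the product of the factors [1 + chi_i] minus 1, hence at most [exp X - 1]. *)
have q2 : q ^+ 2 <= expR X - 1.
  pose c (x : {ffun 'I_k -> T}) : R := \prod_i nu i (x i) - n^-1 ^+ k.
  have qc : q <= \sum_x `|c x|.
    rewrite /q /Phi -sumrB; apply: (le_trans (ler_norm_sum _ _ _)).
    apply: ler_sum => x _; rewrite -mulrBl normrM.
    rewrite /unif prodr_const card_ord; case: (P _); rewrite ?normr1 ?mulr1 //.
    by rewrite normr0 mulr0.
  have c2 : (\sum_x `|c x|) ^+ 2 <= n ^+ k * \sum_x (c x) ^+ 2.
    have := sqr_sum_le (fun x => `|c x|).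
    rewrite card_ffun card_ord natrX card_torus.
    by under [X in _ * X]eq_bigr do rewrite -normrX ger0_norm ?sqr_ge0 //.
  have nk : n ^+ k * n^-1 ^+ k = 1.
    by rewrite -exprMn mulfV ?expr1n // gt_eqF // n_gt0.
  have cE : n ^+ k * \sum_x (c x) ^+ 2 = \prod_i (n * \sum_y nu i y * nu i y) - 1.
    have -> : \sum_x (c x) ^+ 2 = \sum_(x : {ffun 'I_k -> T}) (\prod_i nu i (x i)) ^+ 2
        - 2 * n^-1 ^+ k * (\sum_(x : {ffun 'I_k -> T}) \prod_i nu i (x i))
        + \sum_(x : {ffun 'I_k -> T}) (n^-1 ^+ k) ^+ 2.
      by rewrite mulr_sumr -sumrB -big_split /=; apply: eq_bigr => x _; rewrite /c; ring.
    rewrite Phi_total // sumr_const card_ffun card_ord -[_ *+ (_ ^ _)]mulr_natl natrX card_torus.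
    have -> : \sum_(x : {ffun 'I_k -> T}) (\prod_i nu i (x i)) ^+ 2 =
        \prod_i \sum_y nu i y * nu i y.
      by rewrite -Phi_prod; apply: eq_bigr => x _; rewrite big_split expr2.
    rewrite [in RHS]big_split /= prodr_const card_ord.
    move: nk; set a := n ^+ k; set b := n^-1 ^+ k; set s2 := \prod_i _ => nk.
    transitivity (a * s2 - 2 * (a * b) + (a * b) ^+ 2); first by ring.
    by rewrite nk; ring.
  apply: le_trans (_ : (\sum_x `|c x|) ^+ 2 <= _).
    by rewrite lerXn2r ?nnegrE ?sumr_ge0 // normr_ge0.
  apply: (le_trans c2); rewrite cE lerD2r /X expR_sum.
  apply: ler_prod => i _; apply/andP; split.
    by apply: le_trans (sum_sqr_distr_ge (nud i)); exact: ler01.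
  by have := expR_ge1Dx (n * (\sum_y nu i y * nu i y) - 1); rewrite addrC subrK.
(* [exp X - 1 <= 2 X] when [X <= 1/2]; beyond that [q <= 1] suffices. *)
have q4 : q ^+ 2 <= 4 * X.
  have [Xs|Xl] := leP X 2^-1.
    have := @expR_le_1D2 X; rewrite X0 Xs => /(_ isT); lra.
  have q0 : 0 <= q by exact: normr_ge0.
  nra.
have e2 : e * e^-1 = 1 by rewrite mulfV // gt_eqF.
have ei : 0 < e^-1 by rewrite invr_gt0.
have q0 : 0 <= q by exact: normr_ge0.
rewrite -(@ler_pXn2r _ 2) ?nnegrE //; last by rewrite addr_ge0 ?mulr_ge0 // ltW.
(* Arithmetic-geometric mean: [4 X = 4 e (X / e) <= (e + X / e)^2]. *)
apply: (le_trans q4); have := sqr_ge0 (e - e^-1 * X).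
have : e * (e^-1 * X) = X by rewrite mulrA e2 mul1r.
move: (e^-1 * X) => r <-; nra.
Qed.

(** Induction on the number [j] of rings: the bound is affine in the pairings, so adding it up over
    all edges, for the laws [avg a b (nu i)], gives a bound of the same form. The factor [m ^+ j] is
    the total mass of the sequences of [j] rings. *)
Lemma Phi_tv (P : pred (conf d N k)) nu (e : R) j : 0 < e ->
  (forall i, is_distr (nu i)) ->
  `|Phi (iter j ring_gen (fun z => (P z)%:R)) nu
    - m ^+ j * Phi (fun z => (P z)%:R) (fun=> unif R (d:=d) (N:=N))|
  <= m ^+ j * e + e^-1 *
     \sum_i (n * pairing (nu i) (nu i) (iter j (@avg2_gen R d N) (@diag_fun R d N)) - m ^+ j).
Proof.
move=> e0; elim: j nu => [|j ih] nu nud.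
  rewrite expr0 !mul1r; under [X in _ * X]eq_bigr do rewrite pairing_diag.
  exact: Phi_tv_base.
rewrite [iter j.+1 _ _]iterS Phi_ring_gen exprS.
set pi0 := Phi _ (fun=> _).
have -> : m * m ^+ j * pi0 = edge_sum (fun _ _ : T => m ^+ j * pi0).
  rewrite (_ : edge_sum _ = edge_sum (fun a b : T => (m ^+ j * pi0) * 1)).
    by rewrite edge_sumZ -/m; ring.
  by apply: eq_edge_sum => a b _; rewrite mulr1.
rewrite -mulN1r -edge_sumZ -edge_sumD.
apply: (@le_trans _ _ (edge_sum (fun a b => m ^+ j * e + e^-1 *
   \sum_i (n * pairing (avg a b (nu i)) (avg a b (nu i)) (iter j (@avg2_gen R d N) (@diag_fun R d N)) - m ^+ j)))).
  apply: (@le_trans _ _ (edge_sum (fun a b => `|Phi (iter j ring_gen (fun z => (P z)%:R)) (fun i => avg a b (nu i)) + -1 * (m ^+ j * pi0)|))).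
    rewrite /edge_sum; apply: (le_trans (ler_norm_sum _ _ _)).
    by apply: ler_sum => a _; exact: ler_norm_sum.
  apply: ler_edge_sum => a b /nbr_neq ab; rewrite mulN1r; apply: ih => i.
  exact: avg_is_distr.
rewrite edge_sumD [X in _ + X]edge_sumZ -edge_sum_exchange.
have cst c : edge_sum (fun _ _ : T => c) = m * c :> R.
  rewrite (_ : edge_sum _ = edge_sum (fun a b : T => c * 1)).
    by rewrite edge_sumZ mulrC.
  by apply: eq_edge_sum => a b _; rewrite mulr1.
rewrite cst mulrA lerD2l ler_pM2l ?invr_gt0 //; apply: ler_sum => i _.
by rewrite edge_sumD edge_sumZ pairing_avg2_gen cst mulrN.
Qed.

End Particles.

(** * First and second moments of linear observables *)

Section Moments.
Variables (R : realType) (d N k : nat).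
Hypothesis N_gt0 : (0 < N)%N.
Local Notation T := (torus d N).
Local Notation n := ((N%:R : R) ^+ d).
Local Notation m := (nb_edges R d N).
Implicit Types (nu : 'I_k -> T -> R) (f : conf d N k -> R) (psi : T -> R).

Definition lin_obs psi : conf d N k -> R := fun z => \sum_y (occ z y)%:R * psi y.

Lemma lin_obs_cnt psi (x : {ffun 'I_k -> T}) : lin_obs psi (cnt x) = \sum_i psi (x i).
Proof.
rewrite /lin_obs; under eq_bigr do rewrite occ_cnt natr_sum mulr_suml.
rewrite exchange_big /=; apply: eq_bigr => i _.
rewrite (bigD1 (x i)) //= eqxx mul1r big1 ?addr0 // => y.
by rewrite eq_sym => /negbTE ->; rewrite mul0r.
Qed.

Lemma Phi_obs1 nu psi i : (forall i, is_distr (nu i)) ->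
  \sum_(x : {ffun 'I_k -> T}) (\prod_j nu j (x j)) * psi (x i) =
  \sum_y nu i y * psi y.
Proof.
move=> nud.
transitivity (\sum_(x : {ffun 'I_k -> T}) \prod_j
    (nu j (x j) * (if j == i then psi (x j) else 1))).
  apply: eq_bigr => x _; rewrite big_split /=; congr (_ * _).
  by rewrite -big_mkcond big_pred1_eq.
rewrite (Phi_prod (fun j y => if j == i then psi y else 1)).
rewrite (bigD1 i) //= eqxx [X in _ * X]big1 ?mulr1 // => j /negbTE ji.
by rewrite ji; under eq_bigr do rewrite mulr1; case: (nud j).
Qed.

Lemma Phi_obs2 nu psi i l : (forall i, is_distr (nu i)) -> i != l ->
  \sum_(x : {ffun 'I_k -> T}) (\prod_j nu j (x j)) * (psi (x i) * psi (x l)) =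
  (\sum_y nu i y * psi y) * (\sum_y nu l y * psi y).
Proof.
move=> nud il.
transitivity (\sum_(x : {ffun 'I_k -> T}) \prod_j
    (nu j (x j) * ((if j == i then psi (x j) else 1) *
                   (if j == l then psi (x j) else 1)))).
  apply: eq_bigr => x _; rewrite !big_split /=; congr (_ * (_ * _)).
    by rewrite -big_mkcond big_pred1_eq.
  by rewrite -big_mkcond big_pred1_eq.
rewrite (Phi_prod (fun j y => (if j == i then psi y else 1) * (if j == l then psi y else 1))).
rewrite (bigD1 i) //= eqxx (negbTE il); congr (_ * _).
  by apply: eq_bigr => y _; rewrite mulr1.
rewrite (bigD1 l) /=; last by rewrite eq_sym.
rewrite eq_sym (negbTE il) eqxx [X in _ * X]big1 ?mulr1.
  by apply: eq_bigr => y _; rewrite mul1r.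
move=> j /andP[/negbTE ji /negbTE jl]; rewrite ji jl.
by under eq_bigr do rewrite !mulr1; case: (nud j).
Qed.

Lemma Phi_lin_obs nu psi : (forall i, is_distr (nu i)) ->
  Phi (lin_obs psi) nu = \sum_i \sum_y nu i y * psi y.
Proof.
move=> nud; rewrite /Phi; under eq_bigr do rewrite lin_obs_cnt mulr_sumr.
by rewrite exchange_big /=; apply: eq_bigr => i _; rewrite Phi_obs1.
Qed.

Definition tensor psi : T * T -> R := fun p => psi p.1 * psi p.2.

Lemma pairing_tensor (p q : T -> R) psi :
  pairing p q (tensor psi) = (\sum_y p y * psi y) * (\sum_y q y * psi y).
Proof.
rewrite mulr_suml; apply: eq_bigr => x _; rewrite mulr_sumr.
by apply: eq_bigr => y _; rewrite /tensor /=; ring.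
Qed.

(** Distinct particles are independent and give products of means. The [k] diagonal terms are at
    most 1 each, and adding the squared means, to complete the double sum, only weakens the
    bound. *)
Lemma Phi_lin_obs_sqr nu psi : (forall i, is_distr (nu i)) ->
  (forall y, `|psi y| <= 1) ->
  Phi (fun z => lin_obs psi z ^+ 2) nu <=
  \sum_i \sum_l pairing (nu i) (nu l) (tensor psi) + k%:R.
Proof.
move=> nud psi1.
have -> : Phi (fun z => lin_obs psi z ^+ 2) nu = \sum_i \sum_l
    \sum_(x : {ffun 'I_k -> T}) (\prod_j nu j (x j)) * (psi (x i) * psi (x l)).
  rewrite /Phi exchange_big /=; under [RHS]eq_bigr do rewrite exchange_big /=.
  rewrite exchange_big /=; apply: eq_bigr => x _; rewrite lin_obs_cnt.
  under [RHS]eq_bigr do rewrite -mulr_sumr.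
  rewrite -mulr_sumr; congr (_ * _); rewrite expr2 mulr_suml exchange_big /=.
  by apply: eq_bigr => i _; rewrite mulr_sumr.
have -> : k%:R = \sum_(i < k) 1 :> R by rewrite sumr_const card_ord.
rewrite -big_split /=; apply: ler_sum => i _.
rewrite (bigD1 i) //= [X in _ <= X + _](bigD1 i) //=.
rewrite [X in X <= _]addrC -[X in _ <= X]addrA [X in _ <= X]addrCA.
apply: lerD.
  by apply: ler_sum => l li; rewrite Phi_obs2 1?eq_sym // pairing_tensor.
rewrite pairing_tensor -expr2 (Phi_obs1 (fun y => psi y * psi y)) //.
rewrite -[leLHS]add0r; apply: lerD; first exact: sqr_ge0.
case: (nud i) => n0 n1; rewrite -[leRHS]n1; apply: ler_sum => y _.
rewrite -[leRHS]mulr1; apply: ler_wpM2l => //.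
have := psi1 y; rewrite ler_norml => /andP[a b].
have : psi y ^+ 2 <= 1 by nra.
by rewrite expr2.
Qed.

Lemma Phi_lin_obs_iter nu psi (g : R) j : (forall i, is_distr (nu i)) ->
  (forall x, avg_gen psi x = g * psi x) ->
  Phi (iter j (@ring_gen R d N k) (lin_obs psi)) nu =
  g ^+ j * \sum_i \sum_y nu i y * psi y.
Proof.
move=> + eig; elim: j nu => [|j ih] nu nud; first by rewrite mul1r Phi_lin_obs.
rewrite [iter j.+1 _ _]iterS Phi_ring_gen exprS.
rewrite (eq_edge_sum (G := fun a b => g ^+ j * \sum_i \sum_y avg a b (nu i) y * psi y)); last first.
  by move=> a b /nbr_neq ab; rewrite ih // => i; exact: avg_is_distr.
rewrite edge_sumZ -edge_sum_exchange -mulrA mulrCA; congr (_ * _).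
rewrite mulr_sumr; apply: eq_bigr => i _.
rewrite (eq_edge_sum (G := fun a b => \sum_y nu i y * avg a b psi y)); last first.
  by move=> a b _; rewrite avg_adj.
rewrite -edge_sum_exchange mulr_sumr; apply: eq_bigr => y _.
by rewrite edge_sumZ -/(avg_gen psi y) eig; ring.
Qed.

(** Averaging over the rings correlates the particles, and the iterates of [avg2_gen] record this.
    The diagonal correction is at most [k] for each of the [m ^+ j] ring sequences. *)
Lemma Phi_lin_obs_sqr_iter nu psi j : (forall i, is_distr (nu i)) ->
  (forall y, `|psi y| <= 1) ->
  Phi (iter j (@ring_gen R d N k) (fun z => lin_obs psi z ^+ 2)) nu <=
  \sum_i \sum_l pairing (nu i) (nu l) (iter j (@avg2_gen R d N) (tensor psi))
  + k%:R * m ^+ j.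
Proof.
move=> + psi1; elim: j nu => [|j ih] nu nud; first by rewrite mulr1 Phi_lin_obs_sqr.
rewrite [iter j.+1 _ _]iterS Phi_ring_gen exprS.
apply: (@le_trans _ _ (edge_sum (fun a b => \sum_i \sum_l pairing (avg a b (nu i))
    (avg a b (nu l)) (iter j (@avg2_gen R d N) (tensor psi)) + (k%:R * m ^+ j) * 1))).
  apply: ler_edge_sum => a b /nbr_neq ab; rewrite mulr1; apply: ih => i.
  exact: avg_is_distr.
rewrite edge_sumD [X in _ + X]edge_sumZ -/m.
rewrite [X in _ + X](_ : _ = k%:R * (m * m ^+ j)); last by ring.
rewrite lerD2r.
rewrite -edge_sum_exchange; apply: ler_sum => i _.
rewrite -edge_sum_exchange; apply: ler_sum => l _.
by rewrite [iter j.+1 _ _]iterS pairing_avg2_gen.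
Qed.

Lemma ring_gen_pos f j z : (forall z, 0 <= f z) ->
  0 <= iter j (@ring_gen R d N k) f z.
Proof.
move=> f0; elim: j z => [|j ih] z //; rewrite iterS.
apply: edge_sum_ge0 => a b _; apply: sumr_ge0 => z' _; apply: mulr_ge0 => //.
rewrite /split_kernel; case: ifP => // _; apply: binomial_pmf_ge0.
by rewrite invr_ge0 ler0n invf_le1 ?ler1n.
Qed.

(** Conservation of mass is read off the labelled picture, so no binomial sum has to be
    evaluated. *)
Lemma ring_gen_cst (c : R) j z : iter j (@ring_gen R d N k) (fun=> c) z = m ^+ j * c.
Proof.
have [x xz] := cnt_surj z; rewrite -xz -(Phi_dirac _ x).
have : forall i, is_distr (dirac_fam R x i).
  move=> i; split=> [y|]; first by rewrite ler0n.
  rewrite (bigD1 (x i)) //= /dirac_fam eqxx big1 ?addr0 // => y.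
  by rewrite eq_sym => /negbTE ->.
elim: j (dirac_fam _ _) => [|j ih] nu nud; first by rewrite /= Phi_cst // mul1r.
rewrite [iter j.+1 _ _]iterS Phi_ring_gen exprS.
rewrite (eq_edge_sum (G := fun a b => m ^+ j * c * 1)); last first.
  by move=> a b /nbr_neq ab; rewrite mulr1 ih // => i; exact: avg_is_distr.
by rewrite edge_sumZ -/m; ring.
Qed.

End Moments.

(** * Summation over the number of rings *)

Section Distance.
Variables (R : realType) (d N k : nat).
Hypothesis N_gt0 : (0 < N)%N.
Local Notation T := (torus d N).
Local Notation n := ((N%:R : R) ^+ d).
Local Notation m := (nb_edges R d N).
Local Notation A := (@split_gen R d N k).
Local Notation B := (@ring_gen R d N k).
Local Notation mu := (multinomial (k := k) (unif R (d:=d) (N:=N))).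
Local Notation ind P := (fun z => (P z)%:R : R).
Implicit Types (f : conf d N k -> R) (psi : T -> R) (P : pred (conf d N k)).

(* The semigroup of two labelled particles, in uniformized form. *)
Definition two_pt (h : T * T -> R) (t : R) : T * T -> R :=
  fun p => expR (- m * t) * exp_op (@avg2_gen R d N) t h p.

Lemma geom_bounded_ring f z : geom_bounded (fun j => iter j B f z).
Proof. exact: geom_bounded_iter (@has_kernel_ring_gen R d N k). Qed.

Lemma geom_bounded_avg2 (h : T * T -> R) p :
  geom_bounded (fun j => iter j (@avg2_gen R d N) h p).
Proof. exact: geom_bounded_iter (@has_kernel_avg2_gen R d N). Qed.

Lemma exp_split_expgen t f z : 0 <= t ->
  exp_op A t f z = expR (- m * t) * expgen (fun j => iter j B f z) t.
Proof. by move=> t0; rewrite exp_split_gen. Qed.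

Lemma expR_shift (t : R) : expR (- m * t) * expR (t * m) = 1.
Proof. by rewrite -expRD mulNr mulrC addNr expR0. Qed.

Lemma exp_split_le t f g z : 0 <= t -> (forall z, f z <= g z) ->
  exp_op A t f z <= exp_op A t g z.
Proof.
move=> t0 fg; rewrite !exp_split_expgen // ler_pM2l ?expR_gt0 //.
apply: expgen_le => //; try exact: geom_bounded_ring.
move=> j; rewrite -subr_ge0.
have -> : iter j B g z - iter j B f z = iter j B (fun z => g z - f z) z.
  elim: j z => [|j ih] z //; rewrite !iterS !has_kernel_ring_gen -sumrB.
  by apply: eq_bigr => z' _; rewrite -ih mulrBr.
by apply: ring_gen_pos => z'; rewrite subr_ge0.
Qed.

Lemma exp_split_cst t (c : R) z : 0 <= t -> exp_op A t (fun=> c) z = c.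
Proof.
move=> t0; rewrite exp_split_expgen //.
rewrite (_ : (fun j => _) = (fun j => c * m ^+ j)); last first.
  by apply/funext => j; rewrite ring_gen_cst // mulrC.
rewrite expgenZ ?expgen_pow; last exact: geom_bounded_pow.
by rewrite mulrCA expR_shift mulr1.
Qed.

Lemma iter_kernel_sum (I : finType) (S : finType) a (C : (S -> R) -> S -> R)
    (c : I -> R) (F : I -> S -> R) j z : has_kernel a C ->
  iter j C (fun z => \sum_i c i * F i z) z = \sum_i c i * iter j C (F i) z.
Proof.
move=> aC; elim: j z => [|j ih] z //; rewrite iterS aC.
under eq_bigr do rewrite ih mulr_sumr.
rewrite exchange_big; apply: eq_bigr => i _ /=.
by rewrite aC mulr_sumr; apply: eq_bigr => y _; rewrite mulrCA.
Qed.

Lemma exp_split_sum (I : finType) t (c : I -> R) (F : I -> conf d N k -> R) z :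
  exp_op A t (fun z => \sum_i c i * F i z) z = \sum_i c i * exp_op A t (F i) z.
Proof.
have gb i := geom_bounded_iter (F i) z (@has_kernel_split_gen R d N k).
rewrite exp_opE (_ : (fun j => _) = (fun j => \sum_i c i * iter j A (F i) z)); last first.
  by apply/funext => j; rewrite (iter_kernel_sum _ _ _ _ (@has_kernel_split_gen R d N k)).
rewrite expgen_sum => [|i]; last exact: geom_boundedZ.
by apply: eq_bigr => i _; rewrite expgenZ.
Qed.

Lemma ind_sum P : ind P = (fun z => \sum_z' (P z')%:R * (z == z')%:R).
Proof.
apply/funext => z; rewrite (bigD1 z) //= eqxx mulr1 big1 ?addr0 // => y.
by rewrite eq_sym => /negbTE ->; rewrite mulr0.
Qed.

Lemma law_at_sum t (nu : conf d N k -> R) P :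
  \sum_(z | P z) law_at A nu t z = \sum_z nu z * exp_op A t (ind P) z.
Proof.
rewrite exchange_big /=; apply: eq_bigr => z _; rewrite -mulr_sumr; congr (_ * _).
rewrite ind_sum exp_split_sum big_mkcond; apply: eq_bigr => z' _.
by case: (P z'); rewrite ?mul1r ?mul0r.
Qed.

Lemma multinomial_sum P : \sum_(z | P z) mu z = Phi (ind P) (fun=> unif R (d:=d) (N:=N)).
Proof.
rewrite -sum_multinomial big_mkcond; apply: eq_bigr => z _.
by case: (P z); rewrite ?mulr1 ?mulr0.
Qed.

Lemma dirac_fam_distr (x : {ffun 'I_k -> T}) i : is_distr (dirac_fam R x i).
Proof.
split=> [y|]; first by rewrite ler0n.
rewrite (bigD1 (x i)) //= /dirac_fam eqxx big1 ?addr0 // => y.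
by rewrite eq_sym => /negbTE ->.
Qed.

(** [Phi_tv] is weighted by [t^j / j!] and summed over [j]; the factor [expR (- m * t)] then turns
    [m ^+ j] into Poisson probabilities and the two-particle iterates into [two_pt]. *)
Lemma exp_split_tv P t (e p : R) z : 0 <= t -> 0 < e ->
  (forall x : T, two_pt (@diag_fun R d N) t (x, x) <= p) ->
  `|exp_op A t (ind P) z - Phi (ind P) (fun=> unif R (d:=d) (N:=N))|
  <= e + e^-1 * (k%:R * (n * p - 1)).
Proof.
move=> t0 e0 hp; have [x <-] := cnt_surj z.
set c := Phi _ (fun=> _).
pose D i j := iter j (@avg2_gen R d N) (@diag_fun R d N) (x i, x i).
have gD i : geom_bounded (D i) by exact: geom_bounded_avg2.
pose s j := iter j B (ind P) (cnt x).
have sB j : `|s j - m ^+ j * c| <= m ^+ j * e + e^-1 * \sum_i (n * D i j - m ^+ j).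
  have := Phi_tv N_gt0 P j e0 (dirac_fam_distr x).
  rewrite Phi_dirac (eq_bigr (fun i => n * D i j - m ^+ j)) // => i _.
  by congr (_ * _ - _); exact: pairing_dirac.
have gp := geom_bounded_pow m.
pose U j := e * m ^+ j + e^-1 * \sum_i (n * D i j + (-1) * m ^+ j).
have gU1 i : geom_bounded (fun j => n * D i j + (-1) * m ^+ j).
  by apply: geom_boundedD; exact: geom_boundedZ.
have gU2 : geom_bounded (fun j => \sum_i (n * D i j + (-1) * m ^+ j)).
  exact: geom_bounded_sum.
have gU : geom_bounded U by apply: geom_boundedD; exact: geom_boundedZ.
have EU : expgen U t = e * expR (t * m) +
    e^-1 * \sum_i (n * expgen (D i) t - expR (t * m)).
  rewrite expgenD; try exact: geom_boundedZ.
  rewrite !expgenZ // expgen_pow expgen_sum //; congr (_ + _ * _).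
  apply: eq_bigr => i _; rewrite expgenD; try exact: geom_boundedZ.
  by rewrite !expgenZ // expgen_pow mulN1r.
have EUle : expR (- m * t) * expgen U t <= e + e^-1 * (k%:R * (n * p - 1)).
  rewrite EU mulrDr mulrCA expR_shift mulr1 lerD2l mulrCA ler_pM2l ?invr_gt0 //.
  have -> : k%:R * (n * p - 1) = \sum_(i < k) (n * p - 1).
    by rewrite sumr_const card_ord mulr_natl.
  rewrite mulr_sumr; apply: ler_sum => i _; rewrite mulrBr expR_shift lerD2r mulrCA.
  by apply: ler_wpM2l; [rewrite ltW // n_gt0|exact: hp].
have gs : geom_bounded s by exact: geom_bounded_ring.
rewrite exp_split_expgen // -/s.
(* The constant is expanded into a series too, so that both one-sided comparisons can be made
   termwise. *)
have cE : c = expR (- m * t) * expgen (fun j => c * m ^+ j) t.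
  by rewrite expgenZ // expgen_pow mulrCA expR_shift mulr1.
have UE j : U j = m ^+ j * e + e^-1 * \sum_i (n * D i j - m ^+ j).
  by rewrite /U mulrC; congr (_ + _ * _); apply: eq_bigr => i _; rewrite mulN1r.
have gc : geom_bounded (fun j => c * m ^+ j) by exact: geom_boundedZ.
have up : expgen s t <= expgen (fun j => c * m ^+ j + U j) t.
  apply: expgen_le => //; first exact: geom_boundedD.
  by move=> j; have := sB j; rewrite UE ler_norml => /andP[_]; lra.
have lo : expgen (fun j => c * m ^+ j) t <= expgen (fun j => s j + U j) t.
  apply: expgen_le => //; first exact: geom_boundedD.
  by move=> j; have := sB j; rewrite UE ler_norml => /andP[+ _]; lra.
rewrite expgenD // in up; rewrite expgenD // in lo.
have := ler_wpM2l (expR_ge0 (- m * t)) up; have := ler_wpM2l (expR_ge0 (- m * t)) lo.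
rewrite !mulrDr -cE => {}lo {}up.
rewrite ler_norml; lra.
Qed.

End Distance.

(** * Bounds on the worst-case distance *)

Section DistanceBounds.
Variables (R : realType) (d N k : nat).
Hypothesis N_gt0 : (0 < N)%N.
Local Notation T := (torus d N).
Local Notation n := ((N%:R : R) ^+ d).
Local Notation m := (nb_edges R d N).
Local Notation A := (@split_gen R d N k).
Local Notation B := (@ring_gen R d N k).
Local Notation mu := (multinomial (k := k) (unif R (d:=d) (N:=N))).
Local Notation ind P := (fun z => (P z)%:R : R).
Implicit Types (t : R) (f : conf d N k -> R) (psi : T -> R) (P : pred (conf d N k)).

Lemma tv_dist_le (S : finType) (p q : S -> R) (c : R) : 0 <= c ->
  (forall P : pred S, `|\sum_(z | P z) p z - \sum_(z | P z) q z| <= c) ->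
  tv_dist p q <= c.
Proof. by move=> c0 h; rewrite /tv_dist; apply: bigmax_le => // E _; exact: h. Qed.

Lemma tv_dist_ge (S : finType) (p q : S -> R) (P : pred S) :
  `|\sum_(z | P z) p z - \sum_(z | P z) q z| <= tv_dist p q.
Proof.
rewrite /tv_dist.
have := le_bigmax 0 (fun E : {set S} => `|\sum_(z in E) p z - \sum_(z in E) q z|)
  [set z | P z]%SET.
apply: le_trans; rewrite le_eqVlt; apply/orP; left; apply/eqP.
by congr (`|_ - _|); apply: eq_bigl => z; rewrite inE.
Qed.

Lemma law_mu_01 P t (nu : conf d N k -> R) : 0 <= t -> is_distr nu ->
  0 <= \sum_(z | P z) law_at A nu t z <= 1 /\ 0 <= \sum_(z | P z) mu z <= 1.
Proof.
move=> t0 [nu0 nu1]; split.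
  rewrite law_at_sum; apply/andP; split.
    apply: sumr_ge0 => z _; apply: mulr_ge0 => //.
    rewrite -[leLHS](exp_split_cst (d := d) (N := N) (k := k) 0 z t0).
    by apply: exp_split_le => // z'; rewrite ler0n.
  rewrite -[leRHS]nu1; apply: ler_sum => z _; rewrite -[leRHS]mulr1 ler_wpM2l //.
  rewrite -[leRHS](exp_split_cst (d := d) (N := N) (k := k) 1 z t0).
  by apply: exp_split_le => // z'; rewrite lern1; case: (P z').
rewrite multinomial_sum.
have ud i : is_distr ((fun _ : 'I_k => unif R (d:=d) (N:=N)) i) by exact: unif_distr.
apply/andP; split.
  rewrite -[leLHS](Phi_cst 0 ud); apply: Phi_le => // z.
rewrite -[leRHS](Phi_cst 1 ud); apply: Phi_le => // z.
by rewrite lern1; case: (P z).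
Qed.

Definition dist_set (t : R) := [set r : R | exists nu : conf d N k -> R, is_distr nu /\
  r = tv_dist (law_at A nu t) mu]%classic.

Lemma pt_distr z0 : is_distr (fun z : conf d N k => (z == z0)%:R : R).
Proof.
split=> [z|]; first by rewrite ler0n.
rewrite (bigD1 z0) //= eqxx big1 ?addr0 // => z /negbTE -> //.
Qed.

Lemma conf_inhab : conf d N k.
Proof. exact: cnt [ffun=> [ffun=> Ordinal N_gt0]]. Qed.

Lemma dist_set_nonempty t : (dist_set t !=set0)%classic.
Proof.
exists (tv_dist (law_at A (fun z => (z == conf_inhab)%:R) t) mu).
by exists (fun z => (z == conf_inhab)%:R); split => //; exact: pt_distr.
Qed.

Lemma dist_set_le1 t : 0 <= t -> ubound (dist_set t) 1.
Proof.
move=> t0 _ [nu [nud ->]]; apply: tv_dist_le => // P.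
have [/andP[a b] /andP[a' b']] := law_mu_01 P t0 nud.
rewrite ler_norml; lra.
Qed.

Lemma dist_le1 t : 0 <= t -> dist d N k t <= 1.
Proof. by move=> t0; apply: ge_sup; [exact: dist_set_nonempty|exact: dist_set_le1]. Qed.

Lemma dist_ge t (nu : conf d N k -> R) : 0 <= t -> is_distr nu ->
  tv_dist (law_at A nu t) mu <= dist d N k t.
Proof.
move=> t0 nud; apply: ub_le_sup; last by exists nu.
by exists 1; exact: dist_set_le1.
Qed.

Lemma tv_dist_ge0 (S : finType) (p q : S -> R) : 0 <= tv_dist p q.
Proof. by have := tv_dist_ge p q pred0; rewrite !big_pred0_eq subrr normr0. Qed.

Lemma dist_ge0 t : 0 <= t -> 0 <= dist d N k t.
Proof.
move=> t0; apply: le_trans (dist_ge t0 (pt_distr conf_inhab)).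
exact: tv_dist_ge0.
Qed.

Lemma dist_upper t (e p : R) : 0 <= t -> 0 < e ->
  (forall x : T, two_pt (@diag_fun R d N) t (x, x) <= p) ->
  dist d N k t <= e + e^-1 * (k%:R * (n * p - 1)).
Proof.
move=> t0 e0 hp; apply: ge_sup; first exact: dist_set_nonempty.
have b := fun P z => exp_split_tv N_gt0 P z t0 e0 hp.
move=> _ [nu [[nu0 nu1] ->]]; apply: tv_dist_le => [|P].
  exact: le_trans (b pred0 conf_inhab).
rewrite law_at_sum multinomial_sum.
set c := Phi _ _; have sumE (y : R) : y = \sum_z nu z * y.
  by rewrite -mulr_suml nu1 mul1r.
rewrite (sumE c) -sumrB [leRHS]sumE.
apply: (le_trans (ler_norm_sum _ _ _)); apply: ler_sum => z _.
rewrite -mulrBr normrM ger0_norm // ler_wpM2l //.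
Qed.

Lemma exp_split_lin t (a b : R) f g z :
  exp_op A t (fun z => a * f z + b * g z) z = a * exp_op A t f z + b * exp_op A t g z.
Proof.
have := exp_split_sum t (fun i : bool => if i then a else b)
  (fun i : bool => if i then f else g) z.
rewrite big_bool /= => <-; congr (exp_op A t _ z).
by apply/funext => z'; rewrite big_bool.
Qed.

(** All particles start at [x0], and the threshold is half the mean [a = k exp(- g t)] of the
    observable. Chebyshev costs [4 / a^2] times a variance under either law, the [k] terms add up to
    the factor 8, and [k^2 / a^2 = exp(2 g t)]. *)
Lemma dist_lower t (g v : R) psi (x0 : T) : 0 <= t -> (0 < k)%N ->
  (forall y, `|psi y| <= 1) -> psi x0 = 1 -> \sum_y psi y = 0 ->
  (forall x, avg_gen psi x = (m - g) * psi x) ->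
  two_pt (tensor psi) t (x0, x0) <= v ->
  1 - 8 * (expR (2 * g * t) / k%:R) - 4 * (v * expR (2 * g * t) - 1) <= dist d N k t.
Proof.
move=> t0 k0 psi1 psix0 psi0 eig hv.
pose x : {ffun 'I_k -> T} := [ffun=> x0].
have xE i : x i = x0 by rewrite ffunE.
pose z0 := cnt x.
have kp : 0 < k%:R :> R by rewrite ltr0n.
pose F := lin_obs (k := k) psi.
have EF : exp_op A t F z0 = k%:R * expR (- g * t).
  rewrite exp_split_expgen //.
  rewrite (_ : (fun j => _) = (fun j => k%:R * (m - g) ^+ j)); last first.
    apply/funext => j; rewrite -Phi_dirac (Phi_lin_obs_iter _ (dirac_fam_distr R x) eig).
    rewrite mulrC; congr (_ * _).
    rewrite (eq_bigr (fun=> 1)) ?sumr_const ?card_ord // => i _.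
    rewrite (bigD1 x0) //= /dirac_fam xE eqxx psix0 mul1r big1 ?addr0 // => y.
    by rewrite eq_sym => /negbTE ->; rewrite mul0r.
  rewrite expgenZ ?expgen_pow; last exact: geom_bounded_pow.
  by rewrite mulrCA -expRD; congr (_ * expR _); ring.
have EF2 : exp_op A t (fun z => F z ^+ 2) z0 <= k%:R ^+ 2 * v + k%:R.
  rewrite exp_split_expgen //.
  have gD := geom_bounded_avg2 (tensor psi) (x0, x0).
  have gp := geom_bounded_pow m.
  apply: (@le_trans _ _ (expR (- m * t) * expgen (fun j => k%:R ^+ 2 *
      iter j (@avg2_gen R d N) (tensor psi) (x0, x0) + k%:R * m ^+ j) t)).
    rewrite ler_pM2l ?expR_gt0 //; apply: expgen_le => //.
    - exact: geom_bounded_ring.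
    - by apply: geom_boundedD; exact: geom_boundedZ.
    move=> j; rewrite -Phi_dirac.
    apply: (le_trans (Phi_lin_obs_sqr_iter j (dirac_fam_distr R x) psi1)).
    rewrite lerD2r (eq_bigr (fun=> \sum_(l < k) iter j (@avg2_gen R d N) (tensor psi) (x0, x0))).
      by rewrite !sumr_const card_ord -mulrnA -[_ *+ (k * k)]mulr_natl natrM expr2.
    move=> i _; apply: eq_bigr => l _.
    rewrite -[RHS]pairing_dirac; congr (pairing _ _ _); apply/funext => y;
      by rewrite /dirac_fam xE.
  rewrite expgenD; try exact: geom_boundedZ.
  rewrite !expgenZ // expgen_pow mulrDr [_ * (k%:R * _)]mulrCA expR_shift mulr1.
  rewrite lerD2r mulrCA ler_wpM2l ?sqr_ge0 //.
set a := k%:R * expR (- g * t) in EF.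
have a0 : 0 < a by rewrite mulr_gt0 ?expR_gt0.
have a2 : 0 < a ^+ 2 by rewrite exprn_gt0.
pose P := [pred z | F z < a / 2].
(* Chebyshev as a pointwise bound: the indicator of [F < a / 2] is at most [(2 (1 - F / a))^2]. *)
have low : exp_op A t (ind P) z0 <= 4 / a ^+ 2 * (k%:R ^+ 2 * v + k%:R - a ^+ 2).
  apply: (@le_trans _ _ (exp_op A t (fun z => (4 / a ^+ 2) * (F z ^+ 2) +
      1 * ((- (8 / a)) * F z + 4 * 1)) z0)).
    apply: exp_split_le => // z.
    have -> : 4 / a ^+ 2 * F z ^+ 2 + 1 * (- (8 / a) * F z + 4 * 1) = (2 * (1 - F z / a)) ^+ 2.
      by field; rewrite gt_eqF.
    rewrite inE; case: ltP => [h|_]; last exact: sqr_ge0.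
    have : F z / a < 2^-1 by rewrite ltr_pdivrMr // mulrC.
    by move=> hu; apply: exprn_ege1; lra.
  rewrite (exp_split_lin t (4 / a ^+ 2) 1 (fun z => F z ^+ 2) (fun z => - (8 / a) * F z + 4 * 1)).
  rewrite (exp_split_lin t (- (8 / a)) 4 F (fun=> 1)) exp_split_cst // EF.
  rewrite [leRHS]mulrBr.
  have -> : 4 / a ^+ 2 * a ^+ 2 = 4 by rewrite divfK // gt_eqF.
  have -> : - (8 / a) * a = - 8 by rewrite mulNr divfK // gt_eqF.
  have : 4 / a ^+ 2 * exp_op A t (fun z => F z ^+ 2) z0 <= 4 / a ^+ 2 * (k%:R ^+ 2 * v + k%:R).
    by rewrite ler_wpM2l // divr_ge0 // ltW.
  lra.
have ud i : is_distr ((fun _ : 'I_k => unif R (d:=d) (N:=N)) i) by exact: unif_distr.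
(* At equilibrium [psi] has mean zero, so only the [k] diagonal terms survive; the indicator of
   [F < a / 2] is at least [1 - (2 F / a)^2]. *)
have upr : 1 - 4 / a ^+ 2 * k%:R <= Phi (ind P) (fun=> unif R (d:=d) (N:=N)).
  have F2 : Phi (fun z => F z ^+ 2) (fun=> unif R (d:=d) (N:=N)) <= k%:R.
    apply: (le_trans (Phi_lin_obs_sqr ud psi1)).
    rewrite big1 ?add0r // => i _; rewrite big1 // => l _.
    by rewrite pairing_tensor -mulr_sumr psi0 mulr0 mul0r.
  have : Phi (fun z => 1 - 4 / a ^+ 2 * F z ^+ 2) (fun=> unif R (d:=d) (N:=N)) <=
      Phi (ind P) (fun=> unif R (d:=d) (N:=N)).
    apply: Phi_le => // z; rewrite inE.
    have -> : 4 / a ^+ 2 * F z ^+ 2 = (2 * (F z / a)) ^+ 2 by field; rewrite gt_eqF.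
    case: ltP => [_|h]; first by rewrite gerBl sqr_ge0.
    have : 2^-1 <= F z / a by rewrite ler_pdivlMr // mulrC.
    move=> hu; rewrite subr_le0; apply: exprn_ege1; lra.
  apply: le_trans.
  have -> : Phi (fun z => 1 - 4 / a ^+ 2 * F z ^+ 2) (fun=> unif R (d:=d) (N:=N)) =
      1 - 4 / a ^+ 2 * Phi (fun z => F z ^+ 2) (fun=> unif R (d:=d) (N:=N)).
    rewrite -[X in _ = X - _](Phi_cst 1 ud) /Phi mulr_sumr -sumrB.
    by apply: eq_bigr => y _; ring.
  by rewrite lerD2l lerN2 ler_wpM2l // divr_ge0 // ltW.
apply: le_trans (dist_ge t0 (pt_distr z0)).
apply: le_trans (tv_dist_ge _ _ P).
rewrite law_at_sum multinomial_sum (bigD1 z0) //= eqxx mul1r.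
rewrite [\sum_(_ | _ != z0) _]big1 ?addr0 => [|z /negbTE ->]; last by rewrite mul0r.
rewrite distrC; apply: le_trans (ler_norm _).
have aE : a ^+ 2 * expR (2 * g * t) = k%:R ^+ 2.
  have E : expR (- g * t) * expR (- g * t) * expR (2 * g * t) = 1.
    by rewrite -!expRD -[RHS]expR0; congr expR; ring.
  rewrite /a -[RHS]mulr1 -[X in _ = _ * X]E; ring.
have h1 : 4 / a ^+ 2 * k%:R = 4 * (expR (2 * g * t) / k%:R).
  have -> : expR (2 * g * t) = k%:R ^+ 2 / a ^+ 2 by rewrite -aE [RHS]mulrAC mulfV ?mul1r // gt_eqF.
  by field; rewrite !gt_eqF.
have h2 : 4 / a ^+ 2 * (k%:R ^+ 2 * v) = 4 * (v * expR (2 * g * t)).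
  by rewrite -aE; field; rewrite gt_eqF.
have h3 : 4 / a ^+ 2 * a ^+ 2 = 4 by rewrite divfK // gt_eqF.
move: low upr; rewrite mulrBr mulrDr h1 h2 h3; lra.
Qed.

End DistanceBounds.

(** * The two-particle semigroup *)

Section TwoPoint.
Variables (R : realType) (d N : nat).
Local Notation T := (torus d N).
Local Notation m := (nb_edges R d N).
Local Notation L := (@rw_gen R d N).
Implicit Types (f g : T -> R) (h : T * T -> R) (a b x y : T) (t s : R).

Definition one_at x : T -> R := fun y => (y == x)%:R.

Definition dirichlet f : R := 4^-1 * \sum_x \sum_(y | nbr x y) (f y - f x) ^+ 2.

Lemma dirichlet_ge0 f : 0 <= dirichlet f.
Proof.
apply: mulr_ge0; first by rewrite invr_ge0.
by apply: sumr_ge0 => x _; apply: sumr_ge0 => y _; exact: sqr_ge0.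
Qed.

Lemma sum_nbr_sym (F : T -> T -> R) :
  \sum_x \sum_(y | nbr x y) F x y = \sum_x \sum_(y | nbr x y) F y x.
Proof.
rewrite (exchange_big_dep xpredT) //=; apply: eq_bigr => x _.
by apply: eq_bigl => y; rewrite nbrC.
Qed.

Lemma sum_rw_gen f g : \sum_x f x * L g x =
  - (4^-1 * \sum_x \sum_(y | nbr x y) (f y - f x) * (g y - g x)).
Proof.
have E : \sum_x f x * L g x = 2^-1 * \sum_x \sum_(y | nbr x y) f x * (g y - g x).
  rewrite mulr_sumr; apply: eq_bigr => x _; rewrite /rw_gen mulrCA; congr (_ * _).
  by rewrite mulr_sumr.
have E2 : \sum_x \sum_(y | nbr x y) (f y - f x) * (g y - g x) =
   - (\sum_x \sum_(y | nbr x y) f x * (g y - g x)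
      + \sum_x \sum_(y | nbr x y) f x * (g y - g x)).
  rewrite [X in _ = - (X + _)]sum_nbr_sym -big_split -sumrN /=; apply: eq_bigr => x _.
  by rewrite -big_split -sumrN /=; apply: eq_bigr => y _; ring.
rewrite E E2; lra.
Qed.

Lemma rw_gen_energy f : \sum_x f x * L f x = - dirichlet f.
Proof. by rewrite sum_rw_gen /dirichlet; under eq_bigr do under eq_bigr do rewrite -expr2. Qed.

Lemma rw_gen_adj f g : \sum_x f x * L g x = \sum_x g x * L f x.
Proof.
rewrite !sum_rw_gen; congr (- (_ * _)); apply: eq_bigr => x _.
by apply: eq_bigr => y _; rewrite mulrC.
Qed.

Lemma rw_genD f g (c : R) x : L (fun y => f y + c * g y) x = L f x + c * L g x.
Proof.
rewrite /rw_gen mulrCA -mulrDr; congr (_ * _); rewrite mulr_sumr -big_split /=.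
by apply: eq_bigr => y _; ring.
Qed.

Lemma sum_rw_gen0 f : \sum_x L f x = 0.
Proof.
have := sum_rw_gen (fun=> 1) f; under eq_bigr do rewrite mul1r.
move=> ->; rewrite big1 ?mulr0 ?oppr0 // => x _; rewrite big1 // => y _.
by rewrite subrr mul0r.
Qed.

Lemma sum_one_at x f : \sum_y one_at x y * f y = f x.
Proof.
rewrite (bigD1 x) //= /one_at eqxx mul1r big1 ?addr0 // => y /negbTE ->.
by rewrite mul0r.
Qed.

(** With [s = edge_sgn a b], averaging over the edge is the projection [1 - s s^T / 2], and the
    matrices [s s^T] add up over the edges to [- 2 L]. *)
Definition edge_sgn a b x : R := one_at a x - one_at b x.

Lemma avg_edge_sgn a b f x : a != b ->
  avg a b f x = f x - 2^-1 * (edge_sgn a b x * (f a - f b)).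
Proof.
move=> ab; rewrite /avg /edge_sgn /one_at.
have [->|xa] := eqVneq x a; first by rewrite (negbTE ab) /=; lra.
by have [->|xb] := eqVneq x b => /=; lra.
Qed.

Lemma edge_sum_grad f x :
  edge_sum (fun a b => edge_sgn a b x * (f a - f b)) = - 2 * L f x.
Proof.
rewrite edge_sum_sym => [|a b]; last by rewrite /edge_sgn; ring.
rewrite (eq_bigr (fun a => \sum_(b | nbr a b) (one_at a x * (f a - f b))
  + \sum_(b | nbr a b) (one_at b x * (f b - f a)))); last first.
  by move=> a _; rewrite -big_split; apply: eq_bigr => b _; rewrite /edge_sgn /=; ring.
rewrite big_split /=.
rewrite [X in _ * (_ + X)]sum_nbr_sym.
have -> : \sum_a \sum_(b | nbr a b) one_at a x * (f a - f b) = - 2 * L f x.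
  rewrite (bigD1 x) //= [X in _ + X]big1 ?addr0 => [|a ax]; last first.
    by rewrite big1 // => b _; rewrite /one_at eq_sym (negbTE ax) mul0r.
  rewrite /rw_gen mulNr mulrA mulfV // mul1r -sumrN; apply: eq_bigr => b _.
  by rewrite /one_at eqxx mul1r opprB.
lra.
Qed.

Lemma edge_sum_sgn x y :
  edge_sum (fun a b => edge_sgn a b x * edge_sgn a b y) = - 2 * L (one_at x) y.
Proof.
rewrite -edge_sum_grad; apply: eq_edge_sum => a b _.
by rewrite mulrC; congr (_ * _); rewrite /edge_sgn /one_at ![x == _]eq_sym.
Qed.

Lemma avg_genE f x : avg_gen f x = m * f x + L f x.
Proof.
rewrite /avg_gen (eq_edge_sum (G := fun a b => f x * 1 +
  (- 2^-1) * (edge_sgn a b x * (f a - f b)))); last first.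
  by move=> a b /nbr_neq ab; rewrite avg_edge_sgn //; ring.
by rewrite edge_sumD !edge_sumZ edge_sum_grad; rewrite -/m; lra.
Qed.

Definition two_gen h : T * T -> R := fun p => avg2_gen h p - m * h p.

(** Expansion of the tensor square of [1 - s s^T / 2]: the linear terms give two independent walks,
    and the quadratic term acts only when both particles sit on a common edge. *)
Lemma two_genE h x y : two_gen h (x, y) =
  L (fun u => h (u, y)) x + L (fun v => h (x, v)) y +
  4^-1 * edge_sum (fun a b => edge_sgn a b x * edge_sgn a b y *
     (h (a, a) - h (a, b) - h (b, a) + h (b, b))).
Proof.
rewrite /two_gen /avg2_gen (eq_edge_sum (G := fun a b => h (x, y) * 1 + (
  (- 2^-1) * (edge_sgn a b x * (h (a, y) - h (b, y))) + (
  (- 2^-1) * (edge_sgn a b y * (h (x, a) - h (x, b))) +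
  4^-1 * (edge_sgn a b x * edge_sgn a b y * (h (a, a) - h (a, b) - h (b, a) + h (b, b))))))).
  rewrite !edge_sumD !edge_sumZ (edge_sum_grad (fun u => h (u, y))).
  by rewrite (edge_sum_grad (fun v => h (x, v))) -/m; lra.
by move=> a b /nbr_neq ab; rewrite /avg2 avg_edge_sgn //= !avg_edge_sgn //; field.
Qed.

Lemma is_derive_two_pt h t p :
  is_derive t 1 (fun t => two_pt h t p) (two_gen (two_pt h t) p).
Proof.
have aG := @has_kernel_avg2_gen R d N.
apply: (is_derive_congr (is_derive_mulf (is_derive_expRM t (- m))
   (is_derive_exp_opl t h p aG))) => //.
rewrite /two_gen aG /two_pt -[RHS]addrC mulNr mulNr mulrA; congr (_ + _).
by rewrite mulr_sumr; apply: eq_bigr => q _; rewrite mulrCA.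
Qed.

Lemma two_pt_sum (I : finType) t (c : I -> R) (F : I -> T * T -> R) p :
  two_pt (fun q => \sum_i c i * F i q) t p = \sum_i c i * two_pt (F i) t p.
Proof.
have gb i := geom_bounded_avg2 (F i) p.
rewrite /two_pt exp_opE (_ : (fun j => _) =
  (fun j => \sum_i c i * iter j (@avg2_gen R d N) (F i) p)); last first.
  by apply/funext => j; rewrite (iter_kernel_sum _ _ _ _ (@has_kernel_avg2_gen R d N)).
rewrite expgen_sum => [|i]; last exact: geom_boundedZ.
rewrite mulr_sumr; apply: eq_bigr => i _; rewrite expgenZ //.
by rewrite mulrCA.
Qed.

Lemma two_pt_lin t (c c' : R) h h' p :
  two_pt (fun q => c * h q + c' * h' q) t p = c * two_pt h t p + c' * two_pt h' t p.
Proof.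
have := two_pt_sum t (fun i : bool => if i then c else c')
  (fun i : bool => if i then h else h') p.
rewrite big_bool /= => <-; congr (two_pt _ t p).
by apply/funext => q; rewrite big_bool.
Qed.

(** Here the generator acts on the initial function, unlike in [is_derive_two_pt]; comparing the two
    forms evaluates the semigroup on [two_gen h]. *)
Lemma is_derive_two_ptr h t p :
  is_derive t 1 (fun t => two_pt h t p) (two_pt (two_gen h) t p).
Proof.
have aG := @has_kernel_avg2_gen R d N.
apply: (is_derive_congr (is_derive_mulf (is_derive_expRM t (- m))
   (is_derive_exp_op t h p aG))) => //.
rewrite (_ : two_gen h = fun q => 1 * avg2_gen h q + (- m) * h q).
  by rewrite two_pt_lin /two_pt; ring.
by apply/funext => q; rewrite /two_gen; ring.
Qed.

Lemma two_pt0 h p : two_pt h 0 p = h p.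
Proof. by rewrite /two_pt exp_op0 mulr0 expR0 mul1r. Qed.

Lemma avg2_gen_pos h j p : (forall q, 0 <= h q) ->
  0 <= iter j (@avg2_gen R d N) h p.
Proof.
move=> h0; elim: j p => [|j ih] p //; rewrite iterS.
apply: edge_sum_ge0 => a b _.
have av (F : T -> R) z : (forall z, 0 <= F z) -> 0 <= avg a b F z.
  by move=> F0; rewrite /avg; case: ifP => _ //; rewrite divr_ge0 // addr_ge0.
by apply: (av) => u; apply: (av) => v.
Qed.

Lemma expgen_ge0 (s : nat -> R) t : 0 <= t -> geom_bounded s ->
  (forall j, 0 <= s j) -> 0 <= expgen s t.
Proof.
move=> t0 gs s0.
have -> : 0 = expgen (fun j => 0 * s j) t by rewrite expgenZ // mul0r.
apply: expgen_le => //; first exact: geom_boundedZ.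
by move=> j; rewrite mul0r.
Qed.

Lemma two_pt_ge0 h t p : 0 <= t -> (forall q, 0 <= h q) -> 0 <= two_pt h t p.
Proof.
move=> t0 h0; apply: mulr_ge0; first exact: expR_ge0.
apply: expgen_ge0 => //; first exact: geom_bounded_avg2.
by move=> j; exact: avg2_gen_pos.
Qed.

(* [avg2 a b h] is [M h M] for the symmetric matrix [M] of [avg a b], so that
   positive semidefiniteness is preserved. *)
Definition psd h := forall c : T -> R, 0 <= pairing c c h.

Lemma avg2_gen_psd h j : psd h -> psd (iter j (@avg2_gen R d N) h).
Proof.
move=> h0; elim: j => [|j ih] c //; rewrite iterS pairing_avg2_gen.
by apply: edge_sum_ge0 => a b _; exact: ih.
Qed.

Lemma two_pt_psd h t x : 0 <= t -> psd h -> 0 <= two_pt h t (x, x).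
Proof.
move=> t0 h0; apply: mulr_ge0; first exact: expR_ge0.
apply: expgen_ge0 => //; first exact: geom_bounded_avg2.
by move=> j; rewrite -pairing_dirac; exact: avg2_gen_psd.
Qed.

Definition swapT (p : T * T) := (p.2, p.1).

Lemma avg2_swap a b h p : avg2 a b (fun q => h (swapT q)) p = avg2 a b h (swapT p).
Proof.
rewrite /avg2 /swapT /=; have [->|ab] := eqVneq a b; last first.
  by rewrite avg_edge_sgn // !avg_edge_sgn //= ; ring.
rewrite /avg; case: p => x y /=; case: (x == b); case: (y == b) => //=; lra.
Qed.

Lemma two_pt_swap h t p : (forall q, h (swapT q) = h q) ->
  two_pt h t (swapT p) = two_pt h t p.
Proof.
move=> hs; rewrite /two_pt; congr (_ * _); rewrite !exp_opE; congr expgen.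
apply/funext => j; elim: j p => [|j ih] p //; rewrite !iterS.
apply: eq_edge_sum => a b _; rewrite -avg2_swap; congr (avg2 a b _ p).
by apply/funext => q; rewrite ih.
Qed.

Definition automorphism (sg : T -> T) :=
  injective sg /\ forall x y, nbr (sg x) (sg y) = nbr x y.

Lemma avg_auto sg a b f x : automorphism sg ->
  avg (sg a) (sg b) f (sg x) = avg a b (fun y => f (sg y)) x.
Proof. by case=> inj _; rewrite /avg !(inj_eq inj). Qed.

Lemma avgC a b f x : avg a b f x = avg b a f x.
Proof. by rewrite /avg orbC addrC. Qed.

Lemma avg2C a b h p : avg2 a b h p = avg2 b a h p.
Proof.
rewrite /avg2 avgC; congr (avg _ _ _ _); apply/funext => u; exact: avgC.
Qed.

(** An automorphism need not respect the rank order, so the edge sum is first symmetrized, which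
    [avg2C] permits. *)
Lemma avg2_gen_auto sg h p : automorphism sg ->
  avg2_gen h (sg p.1, sg p.2) = avg2_gen (fun q => h (sg q.1, sg q.2)) p.
Proof.
move=> sgA; rewrite /avg2_gen !edge_sum_sym; try by move=> a b; exact: avg2C.
congr (_ * _); case: (sgA) => inj nb.
rewrite (reindex_inj inj) /=; apply: eq_bigr => a _.
rewrite (reindex_inj inj) /=; apply: eq_big => [b|b _]; first by rewrite nb.
rewrite /avg2 /= avg_auto //; congr (avg _ _ _ _); apply/funext => u.
by rewrite avg_auto.
Qed.

Lemma two_pt_auto sg h t x y : automorphism sg ->
  (forall u v, h (sg u, sg v) = h (u, v)) ->
  two_pt h t (sg x, sg y) = two_pt h t (x, y).
Proof.
move=> sgA hs; rewrite /two_pt; congr (_ * _); rewrite !exp_opE; congr expgen.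
apply/funext => j; elim: j x y => [|j ih] x y //; rewrite !iterS.
rewrite (avg2_gen_auto _ (x, y) sgA); congr avg2_gen.
by apply/funext => -[u v]; exact: ih.
Qed.

Lemma rw_gen_auto sg f x : automorphism sg -> L f (sg x) = L (fun y => f (sg y)) x.
Proof.
case=> inj nb; rewrite /rw_gen; congr (_ * _).
by rewrite (reindex_inj inj) /=; apply: eq_bigl => y; rewrite nb.
Qed.

Lemma avg2_kernel_sym (p q : T * T) : avg2_kernel R p q = avg2_kernel R q p.
Proof.
by apply: eq_edge_sum => a b _; rewrite avgk_sym [X in _ * X]avgk_sym.
Qed.

Lemma two_gen_adj h h' : \sum_p two_gen h p * h' p = \sum_p h p * two_gen h' p.
Proof.
have aG := @has_kernel_avg2_gen R d N.
rewrite (eq_bigr (fun p => \sum_q avg2_kernel R p q * h q * h' p + - m * (h p * h' p))).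
  rewrite big_split /= exchange_big /= -big_split; apply: eq_bigr => p _ /=.
  rewrite /two_gen aG mulrBr mulr_sumr; congr (_ + _); last by ring.
  by apply: eq_bigr => q _; rewrite avg2_kernel_sym; ring.
by move=> p _; rewrite /two_gen aG -mulr_suml; ring.
Qed.

(** Reversibility and the semigroup property in one step: [K] has zero derivative because [two_gen]
    is self-adjoint, and its values at [r] and [0] are the two sides. *)
Lemma two_pt_conv h h' (s r : R) :
  \sum_p two_pt h s p * two_pt h' r p = \sum_p two_pt h (s + r) p * h' p.
Proof.
pose K (u : R) := \sum_p two_pt h (s + r + -1 * u) p * two_pt h' (1 * u + 0) p.
have dK (x : R) : is_derive x 1 K 0.
  have e : \sum_p ((-1 * two_gen (two_pt h (s + r + -1 * x)) p) * two_pt h' (1 * x + 0) p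
     + two_pt h (s + r + -1 * x) p * (1 * two_gen (two_pt h' (1 * x + 0)) p)) = 0.
    rewrite big_split /=; under eq_bigr do rewrite mulN1r mulNr.
    rewrite sumrN two_gen_adj; under [X in _ + X]eq_bigr do rewrite mul1r.
    by rewrite addNr.
  rewrite -e; apply: is_derive_sumf => p; apply: is_derive_mulf.
    apply: (is_derive_congr (is_derive_affine (c := -1) (e := s + r) (f := fun t => two_pt h t p)
      (is_derive_two_pt h _ p))) => [y|]; by rewrite addrC.
  exact: (is_derive_affine (c := 1) (e := 0) (f := fun t => two_pt h' t p)
      (is_derive_two_pt h' _ p)).
have [r0|r0] := leP 0 r.
  have := derive0_eq r0 (fun v _ => dK v).
  rewrite /K !mulr0 !addr0 !mul1r mulN1r addrK.
  by under [X in _ = X -> _]eq_bigr do rewrite two_pt0.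
have := derive0_eq (ltW r0) (fun v _ => dK v).
rewrite /K !mulr0 !addr0 !mul1r mulN1r addrK.
by under [X in X = _ -> _]eq_bigr do rewrite two_pt0.
Qed.

End TwoPoint.

(** * Two particles on a graph with enough symmetry: reduction to one variable *)

Section Diagonal.
Variables (R : realType) (d N : nat).
Local Notation T := (torus d N).
Local Notation m := (nb_edges R d N).
Local Notation n := ((N%:R : R) ^+ d).
Local Notation L := (@rw_gen R d N).
Local Notation dR := (d%:R : R).
Implicit Types (f g : T -> R) (h : T * T -> R) (a b x y : T) (t s r : R).

Hypothesis d_gt0 : (0 < d)%N.
Hypothesis N_gt0 : (0 < N)%N.
Hypothesis swap_auto : forall x y : T,
  exists2 sg, automorphism sg & sg x = y /\ sg y = x.
Hypothesis edge_trans : forall h : T * T -> R,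
  (forall sg, automorphism sg -> forall u v, h (sg u, sg v) = h (u, v)) ->
  (forall q, h (swapT q) = h q) ->
  forall a b a' b', nbr a b -> nbr a' b' -> h (a, b) = h (a', b').
Hypothesis degree : forall x : T, \sum_(y | nbr x y) 1 = 2 * dR.
Variable x0 : T.

Let ht t := two_pt (@diag_fun R d N) t.
(* [ret t] is the probability that two particles started together at [x0] share
   a site at time [t]; [spread t y] is, by reversibility, the probability that
   two particles started at [x0] and [y] do, and [gap0] is its drop across an
   edge at [x0]. *)
Definition ret t := two_pt (@diag_fun R d N) t (x0, x0).
Definition spread t y := two_pt (@diag_fun R d N) t (x0, y).
Definition gap0 t := ret t - (2 * dR)^-1 * \sum_(y | nbr x0 y) spread t y.
Definition flat t y := spread t y + (- 2^-1 * gap0 t) * one_at R x0 y.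

Let dR_gt0 : 0 < dR. Proof. by rewrite ltr0n. Qed.

Lemma ht_auto sg t x y : automorphism sg -> ht t (sg x, sg y) = ht t (x, y).
Proof.
by move=> sgA; apply: two_pt_auto => // u v; rewrite /diag_fun /= (inj_eq (proj1 sgA)).
Qed.

Lemma ht_swap t x y : ht t (y, x) = ht t (x, y).
Proof.
rewrite -[(y, x)]/(swapT (x, y)) /ht two_pt_swap //.
by move=> [u v]; rewrite /diag_fun /= eq_sym.
Qed.

Lemma ht_diag t x : ht t (x, x) = ret t.
Proof.
by have [sg sgA [<- _]] := swap_auto x0 x; rewrite ht_auto.
Qed.

(** By [edge_trans] the average defining [gap0] runs over equal terms, so the drop is the same
    across every edge of the graph. *)
Lemma ht_edge t a b : nbr a b -> ret t - ht t (a, b) = gap0 t.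
Proof.
move=> ab; rewrite /gap0; congr (_ - _).
rewrite (eq_bigr (fun=> ht t (a, b) * 1)) => [|y x0y]; last first.
  rewrite mulr1; apply: (edge_trans (h := ht t)) => //.
    by move=> sg sgA u v; exact: ht_auto.
  by move=> [u v]; exact: ht_swap.
by rewrite -mulr_sumr degree mulrC mulfK // mulf_neq0 ?gt_eqF.
Qed.

(** The second difference of [ht] is [2 * gap0 t] on every edge, so the correlation term is
    [- gap0 t] times the Laplacian of a point mass. An automorphism exchanging [x] and [y]
    identifies the two walk terms, and everything fits inside one Laplacian. *)
Lemma ht_gen t x y : two_gen (ht t) (x, y) =
  2 * L (fun v => ht t (x, v) + (- 2^-1 * gap0 t) * one_at R x v) y.
Proof.
rewrite two_genE.
rewrite (eq_edge_sum (G := fun a b => 2 * gap0 t * (edge_sgn R a b x * edge_sgn R a b y))); last first.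
  move=> a b ab; rewrite !ht_diag [ht t (b, a)]ht_swap.
  have := ht_edge t ab; move: (ht t (a, b)) => q; move: (gap0 t) => de.
  by move=> <-; ring.
rewrite edge_sumZ edge_sum_sgn rw_genD.
have -> : L (fun u => ht t (u, y)) x = L (fun v => ht t (x, v)) y.
  have [sg sgA [sx sy]] := swap_auto x y.
  rewrite -[in RHS]sx (rw_gen_auto _ _ sgA); congr rw_gen; apply/funext => u.
  by rewrite -sy ht_auto // ht_swap.
lra.
Qed.

Lemma is_derive_spread t y :
  is_derive t 1 (fun t => spread t y) (2 * L (flat t) y).
Proof. by rewrite -ht_gen; exact: is_derive_two_pt. Qed.

Lemma rw_gen_one_at x : L (one_at R x) x = - dR.
Proof.
rewrite /rw_gen (eq_bigr (fun=> (-1) * 1)) => [|y xy].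
  by rewrite -mulr_sumr degree; lra.
by rewrite /one_at eqxx eq_sym (negbTE (nbr_neq xy)) /=; lra.
Qed.

Lemma rw_gen_spread t : L (spread t) x0 = - dR * gap0 t.
Proof.
rewrite /rw_gen (eq_bigr (fun=> (- gap0 t) * 1)) => [|y xy].
  by rewrite -mulr_sumr degree; lra.
by rewrite /spread -(ht_edge t xy) /ret /ht; lra.
Qed.

Lemma is_derive_ret t : is_derive t 1 ret (- dR * gap0 t).
Proof.
apply: (is_derive_congr (is_derive_spread t x0)) => //.
by rewrite /flat rw_genD rw_gen_spread rw_gen_one_at; lra.
Qed.

Lemma ret0 : ret 0 = 1.
Proof. by rewrite /ret two_pt0 /diag_fun eqxx. Qed.

Lemma spread_ge0 t y : 0 <= t -> 0 <= spread t y.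
Proof. by move=> t0; apply: two_pt_ge0 => // q; rewrite /diag_fun. Qed.

Lemma spread_sum t : 0 <= t -> \sum_y spread t y = 1.
Proof.
move=> t0.
have := @derive0_eq R (fun t => \sum_y spread t y) 0 t t0.
have D (v : R) : is_derive v 1 (fun t => \sum_y spread t y) 0.
  apply: (is_derive_congr (is_derive_sumf _ _ (fun y => is_derive_spread v y))) => //.
  by rewrite -mulr_sumr sum_rw_gen0 mulr0.
move=> /(_ (fun v _ => D v)) ->.
rewrite (eq_bigr (fun y => one_at R x0 y * 1)) ?sum_one_at // => y _.
by rewrite mulr1 /spread two_pt0 /diag_fun /one_at /= eq_sym.
Qed.

Let n_neq0 : n != 0. Proof. by rewrite gt_eqF // n_gt0. Qed.

(** [two_pt_conv] for the diagonal sums this identity over all starting sites; the terms agree by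
    transitivity, and the number of sites cancels. *)
Lemma spread_conv s r : \sum_y spread s y * spread r y = ret (s + r).
Proof.
have := two_pt_conv (@diag_fun R d N) (@diag_fun R d N) s r.
pose F x := \sum_y ht s (x, y) * ht r (x, y).
have -> : \sum_p two_pt (@diag_fun R d N) s p * two_pt (@diag_fun R d N) r p = \sum_x F x.
  by rewrite pair_big /=; apply: eq_bigr => -[x y].
have -> : \sum_p two_pt (@diag_fun R d N) (s + r) p * diag_fun R p = \sum_(x : T) ret (s + r).
  rewrite (eq_bigr (fun p : T * T => ht (s + r) (p.1, p.2) * (p.1 == p.2)%:R)); last by case.
  rewrite -(pair_big xpredT xpredT (fun x y => ht (s + r) (x, y) * (x == y)%:R)) /=.
  apply: eq_bigr => x _; rewrite (bigD1 x) //= eqxx mulr1 big1 ?addr0 ?ht_diag //.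
  by move=> y; rewrite eq_sym => /negbTE ->; rewrite mulr0.
have Fx x : F x = F x0.
  have [sg sgA [sx _]] := swap_auto x0 x.
  rewrite /F (reindex_inj (proj1 sgA)) /= -sx.
  by apply: eq_bigr => y _; rewrite !ht_auto.
rewrite (eq_bigr _ (fun x _ => Fx x)) !sumr_const => /eqP.
rewrite -[X in X == _]mulr_natl -[X in _ == X]mulr_natl.
have cT : #|{: T}|%:R = n := card_torus R d N.
by rewrite (inj_eq (mulfI _)) => [/eqP|]; rewrite ?[X in X != 0]cT.
Qed.

Lemma spread_sqr s : \sum_y spread s y ^+ 2 = ret (2 * s).
Proof.
under eq_bigr do rewrite expr2.
by rewrite spread_conv; congr ret; lra.
Qed.

Lemma is_derive_sqr s : is_derive s 1 (fun s => ret (2 * s))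
  (- 4 * dirichlet (spread s) + 2 * dR * gap0 s ^+ 2).
Proof.
apply: (is_derive_congr (f := fun s => \sum_y spread s y * spread s y)
  (a := \sum_y (4 * (spread s y * L (flat s) y)))).
- apply: is_derive_sumf => y.
  apply: (is_derive_congr (is_derive_mulf (is_derive_spread s y) (is_derive_spread s y))) => //.
  by ring.
- by move=> v; rewrite spread_conv; congr ret; lra.
- rewrite -mulr_sumr (eq_bigr (fun y => spread s y * L (spread s) y +
    (- 2^-1 * gap0 s) * (spread s y * L (one_at R x0) y))); last first.
    by move=> y _; rewrite /flat rw_genD; ring.
  rewrite big_split /= rw_gen_energy -mulr_sumr rw_gen_adj sum_one_at rw_gen_spread.
  by lra.
Qed.

(** Nonnegativity of the left side is [gap0_energy]: the positive term [2 d gap0^2] in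
    [is_derive_sqr] is at most two thirds of the dissipation, so [ret] decreases. *)
Lemma dirichlet_flat s :
  dirichlet (flat s) = dirichlet (spread s) - 3 / 4 * (dR * gap0 s ^+ 2).
Proof.
apply: oppr_inj; rewrite -rw_gen_energy.
rewrite (eq_bigr (fun y => (spread s y * L (spread s) y +
    (- 2^-1 * gap0 s) * (spread s y * L (one_at R x0) y)) +
    (- 2^-1 * gap0 s) * (one_at R x0 y * (L (spread s) y + (- 2^-1 * gap0 s) * L (one_at R x0) y)))).
  rewrite !big_split /= -!mulr_sumr sum_one_at (rw_gen_adj (spread s) (one_at R x0)) sum_one_at rw_gen_energy.
  by rewrite rw_gen_spread rw_gen_one_at; lra.
by move=> y _; rewrite rw_genD /flat; ring.
Qed.

Lemma gap0_energy s : 3 / 4 * (dR * gap0 s ^+ 2) <= dirichlet (spread s).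
Proof. by rewrite -subr_ge0 -dirichlet_flat dirichlet_ge0. Qed.

Lemma flat_sum s : 0 <= s -> \sum_y flat s y = 1 - gap0 s / 2.
Proof.
move=> s0; rewrite big_split /= spread_sum // -mulr_sumr.
rewrite (eq_bigr (fun y => one_at R x0 y * 1)) ?sum_one_at; last by move=> y _; rewrite mulr1.
lra.
Qed.

Lemma flat_sqr s : \sum_y flat s y ^+ 2 =
  ret (2 * s) - gap0 s * ret s + gap0 s ^+ 2 / 4.
Proof.
rewrite -spread_sqr [LHS](eq_bigr (fun y => spread s y ^+ 2 +
  (one_at R x0 y * (- gap0 s * spread s y) +
   one_at R x0 y * (gap0 s ^+ 2 / 4)))); last first.
  by move=> y _; rewrite /flat /one_at; case: (y == x0) => /=; field.
rewrite !big_split /= !sum_one_at /spread -/(ret s); lra.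
Qed.

(** By [spread_conv], the centred functions [spread s - 1/n] and [spread r - 1/n] have inner product
    [ret (s + r) - 1/n]. *)
Lemma ret_cauchy s r : 0 <= s -> 0 <= r ->
  (ret (s + r) - n^-1) ^+ 2 <= (ret (2 * s) - n^-1) * (ret (2 * r) - n^-1).
Proof.
have E u v : 0 <= u -> 0 <= v ->
    \sum_y (spread u y - n^-1) * (spread v y - n^-1) = ret (u + v) - n^-1.
  move=> u0 v0; rewrite -spread_conv.
  rewrite [LHS](eq_bigr (fun y => spread u y * spread v y + (- n^-1 * spread u y +
    (- n^-1 * spread v y + n^-1 * n^-1)))); last by move=> y _; ring.
  rewrite !big_split /= -[X in _ + (X + _)]mulr_sumr -[X in _ + (_ + (X + _))]mulr_sumr.
  rewrite (spread_sum u0) (spread_sum v0) sumr_const.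
  rewrite -[_ *+ #|_|]mulr_natl [#|_|%:R](card_torus R d N) mulrA mulfV //; lra.
move=> s0 r0; have := cauchy_schwarz (fun y => spread s y - n^-1) (fun y => spread r y - n^-1).
rewrite E //; under [X in _ <= X * _]eq_bigr do rewrite expr2.
under [X in _ <= _ * X]eq_bigr do rewrite expr2.
by rewrite !E //; congr (_ <= (ret _ - _) * (ret _ - _)); lra.
Qed.

Lemma ret_ge s : 0 <= s -> n^-1 <= ret s.
Proof.
move=> s0; have s2 : 0 <= s / 2 by lra.
have := sqr_sum_le (spread (s / 2)).
rewrite spread_sum // expr1n card_torus spread_sqr (_ : 2 * (s / 2) = s) => [h|]; last by lra.
by rewrite -[leLHS]mul1r ler_pdivrMr ?n_gt0 // mulrC.
Qed.

End Diagonal.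

(** * Decay of the meeting probability *)

Section Decay.
Variables (R : realType) (d N : nat) (ga : R) (p del en : R -> R).
Local Notation n := ((N%:R : R) ^+ d).
Local Notation dR := (d%:R : R).
Implicit Types (s t r : R).

Hypothesis d_gt0 : (0 < d)%N.
Hypothesis N_gt0 : (0 < N)%N.
Hypothesis ga_ge0 : 0 <= ga.
Hypothesis p0 : p 0 = 1.
Hypothesis p_ge : forall s, 0 <= s -> n^-1 <= p s.
Hypothesis dp : forall s, is_derive s 1 p (- dR * del s).
Hypothesis dp2 : forall s,
  is_derive s 1 (fun s => p (2 * s)) (- 4 * en s + 2 * dR * del s ^+ 2).
Hypothesis en_ge : forall s, 3 / 4 * (dR * del s ^+ 2) <= en s.
Hypothesis nash : forall (Rn : nat) s, (0 < Rn <= N)%N -> 0 <= s ->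
  p (2 * s) <= (Rn%:R ^+ d)^-1 + dR * Rn%:R ^+ 2 * en s.
Hypothesis poincare : forall s, 0 <= s ->
  ga * (p (2 * s) - n^-1 - del s * (p s - n^-1)) <= en s - 3 / 4 * (dR * del s ^+ 2).
Hypothesis cauchy : forall s r, 0 <= s -> 0 <= r ->
  (p (s + r) - n^-1) ^+ 2 <= (p (2 * s) - n^-1) * (p (2 * r) - n^-1).

Let dR_gt0 : 0 < dR. Proof. by rewrite ltr0n. Qed.
Let n_gt0 : 0 < n. Proof. by rewrite exprn_gt0 // ltr0n. Qed.
Let en_ge0 s : 0 <= en s.
Proof.
apply: le_trans (en_ge s); have := mulr_ge0 (ltW dR_gt0) (sqr_ge0 (del s)); lra.
Qed.
Let dp2_le s : - 4 * en s + 2 * dR * del s ^+ 2 <= - (4 / 3) * en s.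
Proof. have := en_ge s; lra. Qed.

Lemma p_antitone s t : s <= t -> p (2 * t) <= p (2 * s).
Proof.
move=> st; apply: (derive_le0_le st (fun u _ => dp2 u)) => u _.
by apply: (le_trans (dp2_le u)); have := en_ge0 u; lra.
Qed.

(** With the constant [2 d^2], the step from scale [2^j] to [2^(j+1)] in [nash_dyadic] lasts
    [6 d^2 4^j] and produces the factor [exp(- d)], which is at most the required [2^-d]. *)
Definition nash_time : R := 2 * dR ^+ 2 * N%:R ^+ 2.

Lemma expRN_nat_le (k : nat) : expR (- k%:R) <= (2 ^+ k)^-1 :> R.
Proof.
rewrite expRN lef_pV2 ?posrE ?exprn_gt0 ?expR_gt0 //.
rewrite -[k%:R]mulr1 expRM_natl lerXn2r ?nnegrE ?expR_ge0 //.
by have := expR_ge1Dx (1 : R); lra.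
Qed.

(* At dyadic scale [2^j+1] the Nash inequality forces decay at rate of order
   [4^-j] as long as [p] exceeds twice its target. *)
Lemma nash_dyadic j : (2 ^ j <= N)%N ->
  p (2 * (2 * dR ^+ 2 * 4 ^+ j)) <= 2 * ((2 ^+ j) ^+ d)^-1.
Proof.
elim: j => [_|j ih jN].
  rewrite expr0 !expr1n invr1 mulr1; apply: (@le_trans _ _ 1); last by lra.
  have s0 : 0 <= 2 * dR ^+ 2 by rewrite mulr_ge0 // sqr_ge0.
  by have := p_antitone s0; rewrite mulr0 p0.
have {}ih := ih (leq_trans (leq_pexp2l (isT : (0 < 2)%N) (leqnSn j)) jN).
set s0 := 2 * dR ^+ 2 * 4 ^+ j in ih; set s1 := 2 * dR ^+ 2 * 4 ^+ j.+1.
set b := ((2 ^+ j.+1) ^+ d)^-1.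
rewrite leNgt; apply/negP => lt; suff : p (2 * s1) <= 2 * b by rewrite leNgt lt.
(* Failure at [s1] forces [p >= 2 b] on all of [[s0, s1]]; Nash then gives
   [en >= p / (2 d 4^(j+1))], and the derivative bound [- (4/3) en] gives the rate [c]. *)
pose c : R := - (2 / 3) / (dR * 4 ^+ j.+1).
have s00 : 0 <= s0 by rewrite mulr_ge0 ?exprn_ge0 // mulr_ge0 // sqr_ge0.
have s01 : s0 <= s1.
  by rewrite ler_wpM2l ?mulr_ge0 ?sqr_ge0 // exprS ler_peMl ?exprn_ge0 //; lra.
have q4 : 0 < dR * 4 ^+ j.+1 by rewrite mulr_gt0 // exprn_gt0.
have step : p (2 * s1) <= expR (c * (s1 - s0)) * p (2 * s0).
  apply: (@gronwall_le R (fun s => p (2 * s)) _ s0 s1 c s01 (fun u _ => dp2 u)).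
  move=> u /andP[u0 u1]; apply: (le_trans (dp2_le u)).
  have uge0 : 0 <= u by exact: le_trans u0.
  have Xu : 2 * b <= p (2 * u) by apply: (le_trans (ltW lt)); exact: p_antitone.
  have Rn : (0 < 2 ^ j.+1 <= N)%N by rewrite expn_gt0.
  have := nash Rn uge0; rewrite natrX -/b.
  have -> : dR * (2 ^+ j.+1) ^+ 2 = dR * 4 ^+ j.+1.
    by rewrite -exprM mulnC exprM; congr (_ * _ ^+ _); lra.
  move: q4; rewrite /c; set w := dR * 4 ^+ j.+1 => w0 h.
  rewrite -(ler_pM2l w0).
  have -> : w * (- (2 / 3) / w * p (2 * u)) = - (2 / 3) * p (2 * u).
    by field; rewrite gt_eqF.
  lra.
apply: (le_trans step).
have -> : c * (s1 - s0) = - dR.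
  rewrite /c /s1 /s0 exprS; field; rewrite !gt_eqF //= exprn_gt0 //.
apply: (@le_trans _ _ ((2 ^+ d)^-1 * (2 * ((2 ^+ j) ^+ d)^-1))).
  apply: ler_pM => //; try exact: expR_ge0; last exact: expRN_nat_le.
  by apply: le_trans (p_ge _); rewrite ?invr_ge0 ?mulr_ge0 // ltW.
by rewrite /b exprS exprMn invfM mulrCA.
Qed.

Lemma p_nash_time : p (2 * nash_time) <= 2 ^+ d.+1 / n.
Proof.
pose j := trunc_log 2 N.
have /andP[j1 j2] : (2 ^ j <= N < 2 ^ j.+1)%N by exact: trunc_log_bounds.
apply: (@le_trans _ _ (p (2 * (2 * dR ^+ 2 * 4 ^+ j)))).
  apply: p_antitone; rewrite /nash_time ler_wpM2l ?mulr_ge0 ?sqr_ge0 //.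
  have -> : 4 ^+ j = (2 ^+ j) ^+ 2 :> R by rewrite -exprM mulnC exprM; congr (_ ^+ _); lra.
  by rewrite lerXn2r ?nnegrE ?exprn_ge0 // -natrX ler_nat.
apply: (le_trans (nash_dyadic j1)).
rewrite exprS -mulrA ler_pM2l // ler_pdivlMr // mulrC ler_pdivrMr ?exprn_gt0 //.
rewrite -exprMn lerXn2r ?nnegrE ?mulr_ge0 ?exprn_ge0 //.
by rewrite -exprS -natrX ler_nat ltnW.
Qed.

Local Notation r0 := nash_time.
Definition decay_c : R := 2 ^+ d.+1 / n.
Definition decay_beta : R := 2 * ga / dR.
(** The relative loss of rate due to the delayed term; its exponential is the price of comparing
    times [s - r0] and [s]. [decay_K] bounds the weighted functional on the initial interval from
    [2 r0] to [3 r0]. *)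
Definition decay_eps : R := decay_beta * decay_c * expR (4 * ga * r0).
Definition decay_K : R :=
  expR (12 * ga * r0) * (decay_c + decay_beta * decay_c ^+ 2).

Let c_ge0 : 0 <= decay_c.
Proof. by rewrite /decay_c divr_ge0 ?exprn_ge0 // ltW. Qed.
Let beta_ge0 : 0 <= decay_beta.
Proof. by rewrite /decay_beta divr_ge0 ?mulr_ge0 // ltW. Qed.
Let r0_ge0 : 0 <= r0.
Proof. by rewrite /nash_time !mulr_ge0 ?sqr_ge0. Qed.
Let r0_gt0 : 0 < r0.
Proof. by rewrite /nash_time !mulr_gt0 ?exprn_gt0 // ltr0n. Qed.
Let eps_ge0 : 0 <= decay_eps.
Proof. by rewrite /decay_eps !mulr_ge0 ?expR_ge0. Qed.

Let th s := p s - n^-1.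
Let Z s := p (2 * s) - n^-1 + decay_beta * th s ^+ 2.

Let th_ge0 s : 0 <= s -> 0 <= th s.
Proof. by move=> s0; rewrite subr_ge0 p_ge. Qed.

(* [del * (p - n^-1)] is, up to a constant, the derivative of [th^2]: adding
   [decay_beta * th^2] turns the Poincare defect into a lower-order term, which
   [cauchy] bounds by [Z] at the earlier time [s - r0]. *)
Let dZ s : is_derive s 1 Z
  (- 4 * en s + 2 * dR * del s ^+ 2 + decay_beta * (2 * (- dR * del s * th s))).
Proof.
have dth : is_derive s 1 th (- dR * del s).
  apply: (is_derive_congr (is_derive_addf (dp s) (is_derive_cst (- n^-1) s 1))) => //.
  by rewrite addr0.
apply: is_derive_addf.
  apply: (is_derive_congr (is_derive_addf (dp2 s) (is_derive_cst (- n^-1) s 1))) => //.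
  by rewrite addr0.
apply: is_derive_scale.
apply: (is_derive_congr (is_derive_mulf dth dth)) => //.
ring.
Qed.

Let Z_ge0 s : 0 <= s -> 0 <= Z s.
Proof.
move=> s0; apply: addr_ge0; first by rewrite subr_ge0 p_ge // mulr_ge0.
by rewrite mulr_ge0 // sqr_ge0.
Qed.

Let p_after s : r0 <= s -> p (2 * s) - n^-1 <= decay_c.
Proof.
move=> rs; rewrite lerBlDr; apply: (le_trans (p_antitone rs)).
apply: (le_trans p_nash_time); rewrite lerDl invr_ge0; exact: ltW.
Qed.

Let dZ_le s : r0 <= s ->
  - 4 * en s + 2 * dR * del s ^+ 2 + decay_beta * (2 * (- dR * del s * th s))
  <= - (4 * ga) * Z s + 4 * ga * decay_beta * decay_c * Z (s - r0).
Proof.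
move=> rs; have s0 : 0 <= s by exact: le_trans rs.
have h1 : th s ^+ 2 <= decay_c * Z (s - r0).
  have sr : 0 <= s - r0 by rewrite subr_ge0.
  have e : r0 + (s - r0) = s by lra.
  have := cauchy r0_ge0 sr; rewrite e -/(th s) => /le_trans; apply.
  apply: ler_pM; rewrite ?subr_ge0 ?p_ge ?mulr_ge0 //; first exact: p_after.
  by rewrite lerDl mulr_ge0 // sqr_ge0.
have h2 : 4 * ga * decay_beta * th s ^+ 2 <= 4 * ga * decay_beta * (decay_c * Z (s - r0)).
  by apply: ler_wpM2l => //; rewrite mulr_ge0 // mulr_ge0.
have bd : decay_beta * dR = 2 * ga by rewrite /decay_beta divfK // gt_eqF.
have h3 := poincare s0; rewrite -/(th s) in h3.
have h4 : decay_beta * (2 * (- dR * del s * th s)) = - 4 * ga * (del s * th s).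
  transitivity (- 2 * (decay_beta * dR) * (del s * th s)); first by ring.
  by rewrite bd; ring.
rewrite h4 /Z; have := mulr_ge0 (ltW dR_gt0) (sqr_ge0 (del s)).
move: h2; rewrite mulrA /Z; lra.
Qed.

Let M s := expR (4 * ga * (1 - decay_eps) * s) * Z s.
Let kap := 4 * ga * (1 - decay_eps).

(** After multiplication by the integrating factor, [M] can increase only while it lies below its
    own value one delay [r0] earlier. *)
Let dM_le s : r0 <= s ->
  (kap * expR (kap * s)) * Z s + expR (kap * s) *
   (- 4 * en s + 2 * dR * del s ^+ 2 + decay_beta * (2 * (- dR * del s * th s)))
  <= 4 * ga * decay_eps * (M (s - r0) - M s).
Proof.
move=> rs; have ek := expR_gt0 (kap * s).
have sr : 0 <= s - r0 by rewrite subr_ge0.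
apply: (@le_trans _ _ (kap * expR (kap * s) * Z s + expR (kap * s) *
   (- (4 * ga) * Z s + 4 * ga * decay_beta * decay_c * Z (s - r0)))).
  by rewrite lerD2l ler_pM2l //; exact: dZ_le.
have e1 : expR (kap * s) <= expR (4 * ga * r0) * expR (kap * (s - r0)).
  rewrite -expRD ler_expR mulrBr addrCA lerDl subr_ge0 ler_wpM2r //.
  by rewrite /kap -[leRHS]mulr1 ler_wpM2l ?mulr_ge0 // lerBlDr lerDl.
have e2 : expR (kap * s) * Z (s - r0) * decay_beta * decay_c <=
    decay_eps * M (s - r0).
  rewrite /M -/kap /decay_eps.
  have := ler_wpM2r (mulr_ge0 (mulr_ge0 (Z_ge0 sr) beta_ge0) c_ge0) e1.
  move: (expR (kap * s)) (expR (4 * ga * r0)) (expR (kap * (s - r0))) => E1 E2 E3.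
  by move: (Z _) decay_beta decay_c => z b c h; lra.
have e3 := ler_wpM2l (mulr_ge0 (ler0n R 4) ga_ge0) e2.
rewrite [X in _ <= X](_ : _ = 4 * ga * (decay_eps * M (s - r0)) - 4 * ga * decay_eps * M s); last by ring.
rewrite {2}/M -/kap; move: e3.
have -> : kap * expR (kap * s) * Z s =
   4 * ga * expR (kap * s) * Z s - 4 * ga * decay_eps * (expR (kap * s) * Z s).
  by rewrite {1}/kap; ring.
lra.
Qed.

Let M_base s : 2 * r0 <= s <= 3 * r0 -> M s <= decay_K.
Proof.
move=> /andP[s2 s3].
have s0 : 0 <= s by apply: le_trans s2; rewrite mulr_ge0.
have rs : r0 <= s by apply: le_trans s2; lra.
apply: ler_pM; [exact: expR_ge0|exact: Z_ge0| |].
  rewrite ler_expR (_ : 12 * ga * r0 = 4 * ga * (3 * r0)); last by ring.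
  rewrite -[4 * ga * (1 - _) * s]mulrA; apply: ler_wpM2l; first by rewrite mulr_ge0.
  apply: le_trans s3; rewrite mulrBl mul1r gerBl mulr_ge0 //.
apply: lerD; first exact: p_after.
apply: ler_wpM2l => //; rewrite lerXn2r ?nnegrE ?th_ge0 //.
have := @p_after (s / 2); rewrite (_ : 2 * (s / 2) = s); last by lra.
by apply; rewrite ler_pdivlMr // mulrC.
Qed.

(** A maximum principle with delay, advanced by one interval of length [r0] at a time: while
    [M (u - r0) <= decay_K], the excess [M - decay_K] obeys a linear inequality with nonpositive
    rate and cannot become positive. The start is [2 r0] because [p s], as opposed to [p (2 * s)],
    is controlled only from there. *)
Let M_le j s : 2 * r0 <= s <= 3 * r0 + j%:R * r0 -> M s <= decay_K.
Proof.
elim: j s => [|j ih] s; first by rewrite mul0r addr0; exact: M_base.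
move=> /andP[s2 s3].
have [le|lt] := leP s (3 * r0 + j%:R * r0); first by apply: ih; rewrite s2 le.
have jr : 0 <= j%:R * r0 by rewrite mulr_ge0.
set s1 := 3 * r0 + j%:R * r0 in lt.
have h : M s - decay_K <= expR (- (4 * ga * decay_eps) * (s - s1)) * (M s1 - decay_K).
  apply: (@gronwall_le R (fun s => M s - decay_K) (fun s =>
   (kap * expR (kap * s)) * Z s + expR (kap * s) *
   (- 4 * en s + 2 * dR * del s ^+ 2 + decay_beta * (2 * (- dR * del s * th s)))) s1 s) => //.
  - exact: ltW.
  - move=> u _.
    apply: (is_derive_congr (is_derive_addf (is_derive_mulf (is_derive_expRM u kap)
      (dZ u)) (is_derive_cst (- decay_K) u 1))) => //.
    by rewrite addr0.
  move=> u /andP[u1 u2]; have ru : r0 <= u by apply: le_trans u1; rewrite /s1; lra.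
  apply: (le_trans (dM_le ru)).
  have : M (u - r0) <= decay_K.
    apply: ih; rewrite -/s1; move: u1 u2 s3; rewrite /s1 -natr1 mulrDl mul1r; lra.
  have : 0 <= 4 * ga * decay_eps by rewrite !mulr_ge0.
  move: (4 * ga * decay_eps) (M (u - r0)) (M u) => a b e; nra.
rewrite -subr_le0; apply: (le_trans h); apply: mulr_ge0_le0; first exact: expR_ge0.
rewrite subr_le0; apply: ih; rewrite /s1 lexx andbT; lra.
Qed.

Lemma p_decay s : 2 * r0 <= s ->
  p (2 * s) - n^-1 <= decay_K * expR (- (4 * ga * (1 - decay_eps)) * s).
Proof.
move=> s2.
have : M s <= decay_K.
  apply: (@M_le (Num.bound (s / r0))); rewrite s2 /=.
  have : s / r0 <= (Num.bound (s / r0))%:R.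
    by apply/ltW/archi_boundP; rewrite divr_ge0 // (le_trans _ s2) // mulr_ge0.
  by rewrite ler_pdivrMr // => h; apply: (le_trans h); rewrite lerDr mulr_ge0.
rewrite /M -/kap => h.
apply: (@le_trans _ _ (Z s)); first by rewrite lerDl mulr_ge0 // sqr_ge0.
by rewrite mulNr expRN -/kap ler_pdivlMr ?expR_gt0 // mulrC.
Qed.

End Decay.

(** * Fourier analysis on the torus *)

Section RootsOfUnity.
Variables (R : realType) (N : nat).
Hypothesis N_gt0 : (0 < N)%N.
Implicit Types k l : nat.

Definition ang k : R := 2 * pi / N%:R * k%:R.
Definition cosn k : R := cos (ang k).
Definition sinn k : R := sin (ang k).

Lemma angD k l : ang (k + l) = ang k + ang l.
Proof. by rewrite /ang natrD mulrDr. Qed.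

Lemma cosnD k l : cosn (k + l) = cosn k * cosn l - sinn k * sinn l.
Proof. by rewrite /cosn angD cosD. Qed.

Lemma sinnD k l : sinn (k + l) = sinn k * cosn l + cosn k * sinn l.
Proof. by rewrite /sinn angD sinD. Qed.

Let angN : ang N = pi *+ 2.
Proof. by rewrite /ang divfK ?pnatr_eq0 -?lt0n // mulr_natl. Qed.

Lemma cosn_addMn k q : cosn (q * N + k) = cosn k /\ sinn (q * N + k) = sinn k.
Proof.
elim: q => [|q [ihc ihs]]; first by rewrite mul0n add0n.
rewrite mulSn -addnA (cosnD N) (sinnD N) ihc ihs.
by rewrite /cosn /sinn angN cos2pi sin2pi !mul1r !mul0r subr0 add0r.
Qed.

Lemma cosn_mod k l : k = l %[mod N] -> cosn k = cosn l.
Proof.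
move=> kl; rewrite (divn_eq k N) (divn_eq l N) kl.
by rewrite !(cosn_addMn _ _).1.
Qed.

Lemma sinn_mod k l : k = l %[mod N] -> sinn k = sinn l.
Proof.
move=> kl; rewrite (divn_eq k N) (divn_eq l N) kl.
by rewrite !(cosn_addMn _ _).2.
Qed.

Lemma cosn0 : cosn 0 = 1.
Proof. by rewrite /cosn /ang mulr0 cos0. Qed.

Lemma sinn0 : sinn 0 = 0.
Proof. by rewrite /sinn /ang mulr0 sin0. Qed.

Lemma cosn_sinn k : cosn k ^+ 2 + sinn k ^+ 2 = 1.
Proof. exact: cos2Dsin2. Qed.

Lemma cosn_compl k : (k <= N)%N -> cosn (N - k) = cosn k.
Proof.
move=> kN; rewrite /cosn; have -> : ang (N - k) = pi *+ 2 + - ang k.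
  by rewrite -angN /ang natrB //; ring.
by rewrite addrC cosD2pi cosN.
Qed.

Lemma cosn_half_decr k l : (k <= l)%N -> (2 * l <= N)%N -> cosn l <= cosn k.
Proof.
move=> kl lN.
have NR : 0 < N%:R :> R by rewrite ltr0n.
have in_range i : (2 * i <= N)%N -> ang i \in `[0, pi].
  move=> iN; rewrite in_itv /= /ang; apply/andP; split.
    by rewrite mulr_ge0 // divr_ge0 // mulr_ge0 // pi_ge0.
  rewrite mulrAC ler_pdivrMr // mulrAC mulrC; apply: ler_wpM2l; first exact: pi_ge0.
  by rewrite -natrM ler_nat.
rewrite leNgt ltr_cos ?in_range //; last exact: leq_trans (leq_mul (leqnn 2) kl) lN.
rewrite -leNgt /ang ler_wpM2l ?ler_nat //.
by rewrite divr_ge0 // mulr_ge0 // pi_ge0.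
Qed.

(** Reflecting [k] to [N - k] reduces to the half period where the cosine decreases. *)
Lemma cosn_le1 k : (0 < k < N)%N -> cosn k <= cosn 1.
Proof.
move=> /andP[k0 kN]; have [h|h] := leqP (2 * k) N.
  exact: cosn_half_decr.
rewrite -(cosn_compl (ltnW kN)); apply: cosn_half_decr; lia.
Qed.

Lemma cosn1_lt1 : (1 < N)%N -> cosn 1 < 1.
Proof.
move=> N1; have NR : 0 < N%:R :> R by rewrite ltr0n.
have h0 : (0 : R) \in `[0, pi] by rewrite in_itv /= lexx pi_ge0.
have h1 : ang 1 \in `[0, pi].
  rewrite in_itv /= /ang mulr1; apply/andP; split.
    by rewrite divr_ge0 // mulr_ge0 // pi_ge0.
  by rewrite ler_pdivrMr // mulrC ler_wpM2l ?pi_ge0 // ler_nat.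
rewrite -cos0 /cosn ltr_cos // /ang mulr1 divr_gt0 // mulr_gt0 //; exact: pi_gt0.
Qed.

Lemma sin_le_id (y : R) : 0 <= y -> sin y <= y.
Proof.
move=> y0; rewrite -subr_le0.
have -> : 0 = sin 0 - 1 * 0 :> R by rewrite sin0 mulr0 subrr.
rewrite -[X in _ - X]mul1r -!mulNr.
apply: (@derive_le0_le R (fun x => sin x + (- 1) * x) (fun x => cos x - 1) 0 y y0).
  move=> x _; apply: (is_derive_congr (is_derive_addf (is_derive_sin x)
    (is_derive_scale (-1) (is_derive_id x 1)))) => //.
  by rewrite mulr1.
by move=> x _; rewrite subr_le0 cos_le1.
Qed.

(** [1 - cos (2 y) = 2 sin^2 y] with [y = pi / N], [sin y <= y] and [pi < 4]. *)
Lemma gap_upper : 1 - cosn 1 <= 32 / N%:R ^+ 2.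
Proof.
have NR : 0 < N%:R :> R by rewrite ltr0n.
have E : ang 1 = (pi / N%:R) *+ 2 by rewrite /ang mulr1 -mulrnAl mulr_natl.
rewrite /cosn E cos_mulr2n cos2sin2.
have : sin (pi / N%:R) ^+ 2 <= (4 / N%:R) ^+ 2 :> R.
  have s0 : 0 <= sin (pi / N%:R) :> R.
    apply: sin_ge0_pi; rewrite divr_ge0 ?pi_ge0 //= ler_pdivrMr // ler_peMr ?pi_ge0 //.
    by rewrite ler1n.
  have q0 : 0 <= 4 / N%:R :> R by rewrite divr_ge0.
  rewrite lerXn2r ?nnegrE //.
  apply: (le_trans (sin_le_id _)); first by rewrite divr_ge0 // pi_ge0.
  by rewrite ler_pM2r ?invr_gt0 //; have := pihalf_lt2 R; lra.
rewrite expr_div_n (_ : 32 / N%:R ^+ 2 = 2 * (4 ^+ 2 / N%:R ^+ 2)) => [|]; last by lra.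
lra.
Qed.

End RootsOfUnity.

(** * The torus of side at least 3 as a group, and its symmetries *)

Section TorusGroup.
Variables (R : realType) (d N : nat).
Local Notation M := N.+3.
Local Notation V := {ffun 'I_d -> 'I_M}.
Local Notation T := (torus d M).
Implicit Types (x y z c : V) (i j : 'I_d).

Definition unitv i : V := [ffun j => if j == i then 1 else 0].

Lemma ordS_add1 (u : 'I_M) : ordS u = u + 1.
Proof. by apply: val_inj => /=; rewrite addn1. Qed.

(** This is where side at least 3 enters: [unitv i] and its opposite differ, so that every site has
    [2 d] distinct neighbours. *)
Lemma two_neq0 : (1 + 1 : 'I_M) != 0.
Proof. by []. Qed.

Lemma nbrP x y :
  reflect (exists i, y = x + unitv i \/ x = y + unitv i) (nbr (x : T) (y : T)).
Proof.
have step (u v : V) i : (v i == ordS (u i)) && [forall j, (j != i) ==> (v j == u j)]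
    = (v == u + unitv i).
  apply/andP/eqP => [[/eqP vi /forallP h]|->].
    apply/ffunP => j; rewrite !ffunE; have := h j.
    by case: eqP => [-> _|_ /= /eqP ->]; rewrite ?addr0 // vi ordS_add1.
  split; first by rewrite !ffunE eqxx ordS_add1.
  by apply/forallP => j; rewrite !ffunE; apply/implyP => /negbTE ->; rewrite addr0.
have sym (u v : V) i : [forall j, (j != i) ==> (v j == u j)] =
    [forall j, (j != i) ==> (u j == v j)].
  by apply: eq_forallb => j; rewrite [v j == _]eq_sym.
apply: (iffP idP) => [/andP[_ /existsP[i]]|[i h]].
  rewrite andb_orl step sym step => /orP[] /eqP ->; exists i; by [left|right].
have ne (u : V) : (u == u + unitv i) = false.
  apply/negP => /eqP /ffunP /(_ i); rewrite !ffunE eqxx => /eqP.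
  by rewrite eq_sym -subr_eq0 addrAC subrr add0r.
apply/andP; split; last first.
  apply/existsP; exists i; rewrite andb_orl step sym step.
  by case: h => ->; rewrite eqxx ?orbT.
by case: h => ->; rewrite ?ne // eq_sym ne.
Qed.

Lemma unitv_opp_neq i j : unitv i != - unitv j.
Proof.
apply/negP => /eqP/ffunP/(_ i); rewrite !ffunE eqxx; case: eqP => _ /eqP.
  by rewrite -subr_eq0 opprK (negbTE two_neq0).
by rewrite oppr0.
Qed.

Lemma unitv_inj : injective unitv.
Proof.
move=> i j /ffunP/(_ i); rewrite !ffunE eqxx; by case: eqP => // _ /eqP.
Qed.

Lemma sum_nbr x (F : T -> R) :
  \sum_(y : T | nbr (x : T) y) F y = \sum_i (F (x + unitv i) + F (x - unitv i)).
Proof.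
pose h (p : 'I_d * bool) : V := x + (if p.2 then unitv p.1 else - unitv p.1).
have inj : injective h.
  move=> [i a] [j b] /addrI /=; case: a; case: b => /eqP.
  - by move/eqP/unitv_inj ->.
  - by rewrite (negbTE (unitv_opp_neq _ _)).
  - by rewrite eq_sym (negbTE (unitv_opp_neq _ _)).
  - by rewrite eqr_opp => /eqP/unitv_inj ->.
transitivity (\sum_(y in [set h p | p in [set: 'I_d * bool]%SET]%SET) F y).
  apply: eq_bigl => y; apply/nbrP/imsetP => [[i [e|e]]|[[i b] _ ->]].
  - by exists (i, true).
  - by exists (i, false); rewrite // /h /= e addrK.
  by exists i; rewrite /h /=; case: b; [left|right; rewrite subrK].
rewrite big_imset /=; last by move=> p q _ _; exact: inj.
rewrite (eq_bigl xpredT) => [|p]; last by rewrite inE.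
rewrite -(pair_big xpredT xpredT (fun i b => F (h (i, b)))) /=.
by apply: eq_bigr => i _; rewrite big_bool.
Qed.

Lemma torus_degree (x : T) : \sum_(y : T | nbr x y) 1 = 2 * d%:R :> R.
Proof.
rewrite (sum_nbr x (fun=> 1)) (eq_bigr (fun=> 2)); last by move=> i _; lra.
by rewrite sumr_const card_ord mulr_natr.
Qed.

Lemma reflect_auto c : automorphism (fun x : T => c - (x : V) : T).
Proof.
split=> [x y /addrI/oppr_inj //|x y].
have E (u v e : V) : c - u = c - v + e -> v = u + e.
  rewrite -addrA => /addrI h.
  by rewrite -(addNKr v e) -h addrC subrK.
apply/nbrP/nbrP => -[i h]; exists i; case: h => h.
- by right; exact: E.
- by left; exact: E.
- by right; rewrite h opprD addrA subrK.
- by left; rewrite h opprD addrA subrK.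
Qed.

Lemma torus_swap_auto (x y : T) :
  exists2 sg, automorphism sg & sg x = y /\ sg y = x.
Proof.
exists (fun z : T => ((x : V) + (y : V)) - (z : V)); first exact: reflect_auto.
by split; rewrite ?addrK // addrC addKr.
Qed.

Lemma coord_auto (s : 'I_d -> 'I_d) : involutive s ->
  automorphism (fun x : T => [ffun i => x (s i)] : T).
Proof.
move=> sK; split=> [x y /ffunP h|x y].
  by apply/ffunP => i; have := h (s i); rewrite !ffunE sK.
have E (u v : V) i : (v == u + unitv i) =
   ([ffun l => v (s l)] == [ffun l => u (s l)] + unitv (s i)).
  apply/eqP/eqP => [->|/ffunP h]; apply/ffunP => l.
    by rewrite !ffunE (can2_eq sK sK).
  by have := h (s l); rewrite !ffunE sK (inj_eq (inv_inj sK)).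
apply/nbrP/nbrP => -[i]; last first.
  by move=> -[/eqP|/eqP]; rewrite E => /eqP h; exists (s i); tauto.
by rewrite -[i]sK => -[/eqP|/eqP]; rewrite -E => /eqP h; exists (s i); tauto.
Qed.

(** Translations are products of two reflections, transposing coordinates carries one axis to
    another, and [swapT] reverses the orientation of an edge. *)
Lemma torus_edge_trans (h : T * T -> R) :
  (forall sg, automorphism sg -> forall u v, h (sg u, sg v) = h (u, v)) ->
  (forall q, h (swapT q) = h q) ->
  forall a b a' b' : T, nbr a b -> nbr a' b' -> h (a, b) = h (a', b').
Proof.
move=> ha hs.
have transl (c x y : V) : h (c + x : T, c + y : T) = h (x : T, y : T).
  rewrite -[RHS](ha _ (reflect_auto 0)) -[RHS](ha _ (reflect_auto c)).
  by rewrite !sub0r !opprK.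
have base i (x : V) : h (x : T, x + unitv i : T) = h (0 : V, unitv i).
  by rewrite -{1}[x]addr0 transl.
have edge (a b : V) : nbr (a : T) (b : T) -> exists i, h (a, b) = h (0 : V, unitv i).
  case/nbrP => i [->|->]; exists i; first exact: base.
  by rewrite -(base i b) -[LHS]hs.
have ij i j : h (0 : V, unitv i) = h (0 : V, unitv j).
  pose s l := if l == i then j else if l == j then i else l.
  have sK : involutive s.
    by move=> l; rewrite /s; do ![case: eqP => //=]; congruence.
  rewrite -(ha _ (coord_auto sK)); congr (h (_, _)).
    by apply/ffunP => l; rewrite !ffunE.
  apply/ffunP => l; rewrite !ffunE; congr (if _ then _ else _).
  by rewrite (can2_eq sK sK) /s eqxx.
move=> a b a' b' ab a'b'.
have [i ->] := edge a b ab; have [j ->] := edge a' b' a'b'; exact: ij.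
Qed.

Lemma torus_dirichlet (f : T -> R) :
  dirichlet f = 2^-1 * \sum_i \sum_(x : V) (f (x + unitv i) - f x) ^+ 2.
Proof.
rewrite /dirichlet (eq_bigr (fun x : V => \sum_i ((f (x + unitv i) - f x) ^+ 2 +
  (f (x - unitv i) - f x) ^+ 2))); last by move=> x _; rewrite sum_nbr.
rewrite exchange_big /=.
rewrite (eq_bigr (fun i => 2 * \sum_(x : V) (f (x + unitv i) - f x) ^+ 2)).
  by rewrite -mulr_sumr; lra.
move=> i _; rewrite big_split /= mulr_natl mulr2n; congr (_ + _).
rewrite (reindex_inj (addIr (unitv i))) /=; apply: eq_bigr => x _.
by rewrite addrK -sqrrN opprB.
Qed.

End TorusGroup.

(** * Real Fourier analysis and the Poincare inequality *)

Section TorusFourier.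
Variables (R : realType) (d N : nat).
Local Notation M := N.+3.
Local Notation V := {ffun 'I_d -> 'I_M}.
Local Notation T := (torus d M).
Local Notation n := ((M%:R : R) ^+ d).
Local Notation C := (cosn R M).
Local Notation S := (sinn R M).
Local Notation e_ := (@unitv d N).
Local Notation ga := (1 - C 1).
Implicit Types (x y z : V) (i : 'I_d) (f : T -> R).

(** An unreduced natural number; only its class modulo [M] matters, by periodicity of [cosn] and
    [sinn]. *)
Definition dot (x y : V) : nat := (\sum_l x l * y l)%N.

Lemma dotC x y : dot x y = dot y x.
Proof. by apply: eq_bigr => l _; rewrite mulnC. Qed.

Lemma dot_unitv x y i : dot (x + e_ i) y = (dot x y + y i)%N %[mod M].
Proof.
rewrite /dot (bigD1 i) //= [in RHS](bigD1 i) //= !ffunE eqxx /=.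
rewrite (eq_bigr (fun l => (x l * y l)%N)) => [|l /negbTE li]; last first.
  by rewrite !ffunE li addr0.
rewrite addnAC -modnDml modnMml modnDml.
by rewrite (modn_small (isT : 1 < M)%N) mulnDl mul1n.
Qed.


Definition wcos x y : R := C (dot x y).
Definition wsin x y : R := S (dot x y).

Lemma wcos_shift x y i :
  wcos (x + e_ i) y = wcos x y * C (y i) - wsin x y * S (y i).
Proof. by rewrite /wcos (@cosn_mod R M _ _ _ (dot_unitv x y i)) // cosnD. Qed.

Lemma wsin_shift x y i :
  wsin (x + e_ i) y = wsin x y * C (y i) + wcos x y * S (y i).
Proof. by rewrite /wsin (@sinn_mod R M _ _ _ (dot_unitv x y i)) // sinnD. Qed.

Lemma wcos_wsin x y : wcos x y ^+ 2 + wsin x y ^+ 2 = 1.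
Proof. exact: cosn_sinn. Qed.

Lemma cosn_diff_neq1 (a b : 'I_M) : a != b -> C a * C b + S a * S b != 1.
Proof.
wlog ab : a b / (b < a)%N.
  move=> W ab; have [h|h|h] := ltngtP b a; first exact: W.
    by rewrite [C a * _]mulrC [S a * _]mulrC; apply: W; rewrite // eq_sym.
  by move: ab; rewrite (val_inj h) eqxx.
move=> _; have -> : C a * C b + S a * S b = C (a - b).
  rewrite -[in LHS](subnK (ltnW ab)) cosnD sinnD.
  have := cosn_sinn R M b; set cb := C b; set sb := S b => h.
  by rewrite -[RHS]mulr1 -h; ring.
have : C (a - b) <= C 1.
  by apply: cosn_le1 => //; rewrite subn_gt0 ab /= (leq_ltn_trans (leq_subr _ _)).
have := @cosn1_lt1 R M isT isT; move=> h1 h2.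
by rewrite lt_eqF // (le_lt_trans h2).
Qed.

Lemma card_V : #|{: V}|%:R = n.
Proof. exact: card_torus. Qed.

(** [A] and [B] are the real and imaginary parts of a character sum. Translating by [e_ i] rotates
    it by an angle that is nontrivial when [x i != y i], so it vanishes. *)
Lemma orthogonality x y :
  \sum_(z : V) (wcos z x * wcos z y + wsin z x * wsin z y) = n * (x == y)%:R.
Proof.
have [->|xy] := eqVneq x y.
  rewrite (eq_bigr (fun=> 1)) => [|z _]; last by rewrite -!expr2 wcos_wsin.
  by rewrite sumr_const mulr1; exact: card_V.
have [i xyi] : exists i, x i != y i.
  apply/existsP; rewrite -negb_forall; apply: contra xy => /forallP h.
  by apply/eqP/ffunP => i; apply/eqP.
rewrite mulr0; set A := \sum_z _.
pose B := \sum_(z : V) (wsin z x * wcos z y - wcos z x * wsin z y).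
pose ca := C (x i) * C (y i) + S (x i) * S (y i).
pose sa := S (x i) * C (y i) - C (x i) * S (y i).
have hA : A = A * ca - B * sa.
  rewrite {1}/A (reindex_inj (addIr (e_ i))) /= !mulr_suml -sumrB.
  by apply: eq_bigr => z _; rewrite !wcos_shift !wsin_shift /ca /sa; ring.
have hB : B = B * ca + A * sa.
  rewrite {1}/B (reindex_inj (addIr (e_ i))) /= !mulr_suml -big_split /=.
  by apply: eq_bigr => z _; rewrite !wcos_shift !wsin_shift /ca /sa; ring.
have h1 : ca ^+ 2 + sa ^+ 2 = 1.
  have := cosn_sinn R M (x i); have := cosn_sinn R M (y i).
  rewrite /ca /sa; set a := C _; set b := S _; set c := C _; set e := S _ => p q.
  by rewrite -[RHS]mulr1 -{1}p -q; ring.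
have hc : ca != 1 by exact: cosn_diff_neq1.
have : A * (2 * (1 - ca)) = 0.
  have e1 : A * (1 - ca) = - B * sa by lra.
  have e2 : B * (1 - ca) = A * sa by lra.
  have e3 : A * (1 - ca) ^+ 2 = - A * sa ^+ 2.
    rewrite expr2 mulrA e1 -mulrA [sa * _]mulrC mulrA mulNr e2; ring.
  transitivity (A * (1 - ca) ^+ 2 + A * sa ^+ 2 + A * (1 - (ca ^+ 2 + sa ^+ 2))); first by ring.
  by rewrite e3 h1 subrr mulr0; ring.
move/eqP; rewrite mulf_eq0 => /orP[/eqP //|].
by rewrite mulf_eq0 pnatr_eq0 /= subr_eq0 eq_sym (negbTE hc).
Qed.

Definition fcos f z : R := \sum_(x : V) f x * wcos z x.
Definition fsin f z : R := \sum_(x : V) f x * wsin z x.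

Lemma parseval f :
  \sum_(z : V) (fcos f z ^+ 2 + fsin f z ^+ 2) = n * \sum_(x : V) f x ^+ 2.
Proof.
rewrite (eq_bigr (fun z => \sum_(x : V) \sum_(y : V) f x * f y *
   (wcos z x * wcos z y + wsin z x * wsin z y))); last first.
  move=> z _; rewrite /fcos /fsin !expr2 !mulr_suml -big_split /=; apply: eq_bigr => x _.
  rewrite !mulr_sumr -big_split /=; apply: eq_bigr => y _.
  by rewrite mulrDr; congr (_ + _); rewrite mulrACA.
rewrite exchange_big /= mulr_sumr; apply: eq_bigr => x _.
rewrite exchange_big /= (bigD1 x) //= -mulr_sumr orthogonality eqxx.
rewrite big1 => [|y yx]; first by rewrite addr0 mulr1 mulrC expr2.
by rewrite -mulr_sumr orthogonality eq_sym (negbTE yx) !mulr0.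
Qed.

(** A translation multiplies the transform by a unit complex number [w], and
    [|w - 1|^2 = 2 - 2 Re w]. *)
Lemma fourier_grad f z i :
  let g : T -> R := fun x : V => f (x + e_ i) - f x in
  fcos g z ^+ 2 + fsin g z ^+ 2 = (2 - 2 * C (z i)) * (fcos f z ^+ 2 + fsin f z ^+ 2).
Proof.
move=> g.
have wc x : wcos z x = wcos z (x + e_ i) * C (z i) + wsin z (x + e_ i) * S (z i).
  have := cosn_sinn R M (z i) => h.
  rewrite /wcos /wsin ![dot z _]dotC -!/(wcos _ _) -!/(wsin _ _) wcos_shift wsin_shift.
  by rewrite -[LHS]mulr1 -h; ring.
have ws x : wsin z x = wsin z (x + e_ i) * C (z i) - wcos z (x + e_ i) * S (z i).
  have := cosn_sinn R M (z i) => h.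
  rewrite /wcos /wsin ![dot z _]dotC -!/(wcos _ _) -!/(wsin _ _) wcos_shift wsin_shift.
  by rewrite -[LHS]mulr1 -h; ring.
have ec : fcos g z = fcos f z * C (z i) + fsin f z * S (z i) - fcos f z.
  rewrite /fcos /fsin /g; under eq_bigr do rewrite mulrBl.
  rewrite sumrB; congr (_ - _); rewrite !mulr_suml.
  rewrite [X in _ = X + _](reindex_inj (addIr (e_ i))) [X in _ = _ + X](reindex_inj (addIr (e_ i))).
  by rewrite -big_split; apply: eq_bigr => x _; rewrite {1}wc /=; ring.
have es : fsin g z = fsin f z * C (z i) - fcos f z * S (z i) - fsin f z.
  rewrite /fcos /fsin /g; under eq_bigr do rewrite mulrBl.
  rewrite sumrB; congr (_ - _); rewrite !mulr_suml.
  rewrite [X in _ = X - _](reindex_inj (addIr (e_ i))) [X in _ = _ - X](reindex_inj (addIr (e_ i))).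
  by rewrite -sumrB; apply: eq_bigr => x _; rewrite {1}ws /=; ring.
rewrite ec es; have := cosn_sinn R M (z i).
move: (fcos f z) (fsin f z) (C (z i)) (S (z i)) => a b c s h.
transitivity ((a ^+ 2 + b ^+ 2) * ((c ^+ 2 + s ^+ 2) + 1 - 2 * c)); first by ring.
by rewrite h; ring.
Qed.

(** Parseval diagonalizes both sides. Frequency 0 is what the squared sum removes, and any other
    frequency has a nonzero coordinate, which alone contributes at least the gap by [cosn_le1]. *)
Lemma torus_poincare f :
  ga * (\sum_x f x ^+ 2 - n^-1 * (\sum_x f x) ^+ 2) <= dirichlet f.
Proof.
have n0 : 0 < n by rewrite exprn_gt0.
rewrite -(ler_pM2l n0) torus_dirichlet.
have -> : n * (2^-1 * \sum_i \sum_(x : V) (f (x + e_ i) - f x) ^+ 2) =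
   \sum_(z : V) (\sum_i (1 - C (z i))) * (fcos f z ^+ 2 + fsin f z ^+ 2).
  rewrite mulrCA mulr_sumr.
  rewrite (eq_bigr (fun i => \sum_(z : V) (2 - 2 * C (z i)) * (fcos f z ^+ 2 + fsin f z ^+ 2))).
    rewrite exchange_big mulr_sumr /=; apply: eq_bigr => z _.
    rewrite -mulr_suml mulrA mulr_sumr; congr (_ * _).
    by apply: eq_bigr => i _; lra.
  move=> i _; rewrite -parseval; apply: eq_bigr => z _; exact: fourier_grad.
have -> : n * (ga * (\sum_x f x ^+ 2 - n^-1 * (\sum_x f x) ^+ 2)) =
   \sum_(z : V | z != 0) ga * (fcos f z ^+ 2 + fsin f z ^+ 2).
  rewrite -mulr_sumr mulrCA mulrBr mulrA mulfV ?gt_eqF // mul1r -parseval.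
  rewrite [in LHS](bigD1 (0 : V)) //=; congr (_ * _).
  have d0 x : dot 0 x = 0%N by rewrite /dot big1 // => l _; rewrite ffunE.
  have -> : fcos f 0 = \sum_x f x.
    by apply: eq_bigr => x _; rewrite /wcos d0 cosn0 mulr1.
  have -> : fsin f 0 = 0.
    by rewrite /fsin big1 // => x _; rewrite /wsin d0 sinn0 mulr0.
  by rewrite expr0n addr0 addrC addrK.
have c1 (a : 'I_M) : 0 <= 1 - C a by rewrite subr_ge0 cos_le1.
rewrite [leRHS](bigD1 (0 : V)) //= -[leLHS]add0r; apply: lerD.
  by rewrite mulr_ge0 ?addr_ge0 ?sqr_ge0 ?sumr_ge0.
apply: ler_sum => z z0; apply: ler_wpM2r; first by rewrite addr_ge0 ?sqr_ge0.
have [i zi] : exists i, z i != 0.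
  apply/existsP; rewrite -negb_forall; apply: contra z0 => /forallP h.
  by apply/eqP/ffunP => i; rewrite ffunE; apply/eqP.
rewrite (bigD1 i) //= -[leLHS]addr0; apply: lerD; last by rewrite sumr_ge0.
rewrite lerD2l lerN2; apply: cosn_le1 => //.
by rewrite lt0n ltn_ord andbT.
Qed.

Lemma gap_gt0 : 0 < ga.
Proof. by rewrite subr_gt0 cosn1_lt1. Qed.

End TorusFourier.

(** * The Nash inequality by comparison with translates *)

Section TorusNash.
Variables (R : realType) (d N : nat).
Local Notation M := N.+3.
Local Notation V := {ffun 'I_d -> 'I_M}.
Local Notation T := (torus d M).
Local Notation e_ := (@unitv d N).
Variable f : T -> R.

Definition shift_sqr (z : V) : R := \sum_(x : V) (f (x + z) - f x) ^+ 2.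

Lemma shift_sqr_ge0 z : 0 <= shift_sqr z.
Proof. by apply: sumr_ge0 => x _; exact: sqr_ge0. Qed.

(* Minkowski's inequality for translations, in a form without square roots. *)
Lemma shift_sqrD (z z' : V) (m m' q q' : R) :
  0 <= m -> 0 <= m' -> 0 <= q -> 0 <= q' ->
  shift_sqr z <= m * q -> shift_sqr z' <= m' * q' ->
  shift_sqr (z + z') <= (m + m') * (q + q').
Proof.
move=> m0 m'0 q0 q'0 hz hz'.
pose a (x : V) : R := f (x + z + z') - f (x + z).
pose b (x : V) : R := f (x + z) - f x.
have aE : \sum_x a x ^+ 2 = shift_sqr z'.
  by rewrite /shift_sqr [RHS](reindex_inj (addIr z)).
have E : shift_sqr (z + z') = shift_sqr z' + shift_sqr z + 2 * \sum_x a x * b x.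
  rewrite -aE /shift_sqr mulr_sumr -!big_split /=; apply: eq_bigr => x _.
  by rewrite addrA /a /b; ring.
have := cauchy_schwarz a b; rewrite aE -/(shift_sqr z) E.
have z0 := shift_sqr_ge0 z; have z'0 := shift_sqr_ge0 z'.
move: (\sum_x a x * b x) (shift_sqr z) (shift_sqr z') z0 z'0 hz hz' => c A B A0 B0 hA hB hc.
suff : 2 * c <= m * q' + m' * q by lra.
have p0 : 0 <= m * q' + m' * q by rewrite addr_ge0 // mulr_ge0.
have [c0|c0] := leP c 0; first by lra.
rewrite -(@ler_pXn2r _ 2) ?nnegrE //; last by rewrite mulr_ge0 // ltW.
have h : B * A <= (m' * q') * (m * q) by apply: ler_pM.
have := sqr_ge0 (m * q' - m' * q); nra.
Qed.

Lemma shift_sqrMn (z : V) k : shift_sqr (z *+ k) <= k%:R * (k%:R * shift_sqr z).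
Proof.
elim: k => [|k ih].
  by rewrite mul0r mulr0n /shift_sqr big1 // => x _; rewrite addr0 subrr expr0n.
rewrite mulrSr -natr1 [(_ + 1) * shift_sqr z]mulrDl mul1r.
apply: shift_sqrD => //; rewrite ?mul1r ?shift_sqr_ge0 //.
by rewrite mulr_ge0 ?shift_sqr_ge0.
Qed.

Lemma torus_decomp (z : V) : z = \sum_i e_ i *+ z i.
Proof.
apply/ffunP => j; rewrite sum_ffunE (bigD1 j) //= ffunMnE ffunE eqxx big1 ?addr0.
  by rewrite natr_Zp.
by move=> i ij; rewrite ffunMnE ffunE eq_sym (negbTE ij) mul0rn.
Qed.

(** The shift is split into unit steps. The bound travels as a product [a * b], the form stable
    under [shift_sqrD]: [a] is the sum of the [z i], at most [d k], and [b] the sum of the unit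
    energies weighted by [z i]. *)
Lemma shift_sqr_box (z : V) (k : nat) : (forall i, (z i <= k)%N) ->
  shift_sqr z <= d%:R * k%:R ^+ 2 * \sum_i shift_sqr (e_ i).
Proof.
move=> zk; pose K (u : V) (a b : R) := [/\ 0 <= a, 0 <= b & shift_sqr u <= a * b].
have : K (\sum_i e_ i *+ z i) (\sum_i (z i)%:R) (\sum_i (z i)%:R * shift_sqr (e_ i)).
  apply: (big_ind3 K).
  - by split=> //; rewrite mul0r /shift_sqr big1 // => x _; rewrite addr0 subrr expr0n.
  - move=> u a b u' a' b' [a0 b0 h] [a'0 b'0 h']; split; rewrite ?addr_ge0 //.
    exact: shift_sqrD.
  by move=> i _; split; rewrite ?mulr_ge0 ?shift_sqr_ge0 //; exact: shift_sqrMn.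
rewrite -torus_decomp => -[a0 b0 h]; apply: (le_trans h).
rewrite expr2 mulrA -mulrA; apply: ler_pM => //.
  have -> : d%:R * k%:R = \sum_(i < d) k%:R :> R by rewrite sumr_const card_ord mulr_natl.
  by apply: ler_sum => i _; rewrite ler_nat.
rewrite mulr_sumr; apply: ler_sum => i _; rewrite ler_wpM2r ?shift_sqr_ge0 //.
by rewrite ler_nat.
Qed.

Lemma card_box (k : nat) : (k <= M)%N -> #|[set z : V | [forall i, z i < k]%N]%SET| = (k ^ d)%N.
Proof.
move=> kM; rewrite (@eq_card _ _ (ffun_on (fun u : 'I_M => u < k)%N)) => [|z]; last first.
  by rewrite inE; apply/forallP/ffun_onP.
rewrite card_ffun_on card_ord; congr (_ ^ _)%N.
rewrite -sum1_card -[RHS]card_ord -[RHS]sum1_card.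
by rewrite (big_ord_widen M (fun=> 1%N) kM).
Qed.

(** For each shift [z], the squared norm is the correlation of [f] with its translate plus half of
    [shift_sqr z]. Over the [k^d] shifts of a box the correlations total at most 1, as [f] has mass
    1, whence the term [k^-d]; [shift_sqr_box] bounds the rest. *)
Lemma torus_nash (k : nat) : (0 < k <= M)%N -> (forall x, 0 <= f x) -> \sum_x f x = 1 ->
  \sum_x f x ^+ 2 <= (k%:R ^+ d)^-1 + d%:R * k%:R ^+ 2 * dirichlet f.
Proof.
move=> /andP[k0 kM] f0 f1.
pose Bx := [set z : V | [forall i, z i < k]%N]%SET.
have kd : 0 < k%:R ^+ d :> R by rewrite exprn_gt0 // ltr0n.
have cB : #|Bx|%:R = k%:R ^+ d :> R by rewrite card_box // natrX.
set X := \sum_x _; set En := dirichlet f.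
have E2 : \sum_i shift_sqr (e_ i) = 2 * En.
  by rewrite /En torus_dirichlet mulrA mulfV ?mul1r.
have XE (z : V) : X = \sum_(x : V) f x * f (x + z) + 2^-1 * shift_sqr z.
  have h : \sum_(x : V) f (x + z) ^+ 2 = X by rewrite /X [RHS](reindex_inj (addIr z)).
  have -> : X = 2^-1 * (X + \sum_(x : V) f (x + z) ^+ 2) by rewrite h; lra.
  rewrite /X mulrDr !mulr_sumr -!big_split /=; apply: eq_bigr => x _.
  by field.
have box z : z \in Bx -> 2^-1 * shift_sqr z <= d%:R * k%:R ^+ 2 * En.
  rewrite inE => /forallP zk.
  have := @shift_sqr_box z k (fun i => ltnW (zk i)); rewrite E2; lra.
rewrite -(ler_pM2l kd) mulrDr mulfV ?gt_eqF //.
have -> : k%:R ^+ d * X = \sum_(z in Bx) X by rewrite sumr_const -cB -[RHS]mulr_natl.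
rewrite (eq_bigr _ (fun z _ => XE z)) big_split /=; apply: lerD; last first.
  have -> : k%:R ^+ d * (d%:R * k%:R ^+ 2 * En) = \sum_(z in Bx) d%:R * k%:R ^+ 2 * En.
    by rewrite sumr_const -cB -[RHS]mulr_natl.
  by apply: ler_sum => z zB; exact: box.
rewrite exchange_big /= -[leRHS]f1; apply: ler_sum => x _.
rewrite -mulr_sumr -[leRHS]mulr1 ler_wpM2l //.
rewrite -[leRHS]f1 [leRHS](reindex_inj (addrI (x : V))) /= [leRHS](bigID (mem Bx)) /=.
by rewrite lerDl sumr_ge0.
Qed.

End TorusNash.

(** * The first eigenfunction and the relaxation time *)

Section TorusSpectrum.
Variables (R : realType) (d N : nat).
Local Notation M := N.+3.
Local Notation V := {ffun 'I_d -> 'I_M}.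
Local Notation T := (torus d M).
Local Notation e_ := (@unitv d N).
Local Notation C := (cosn R M).
Local Notation ga := (1 - C 1).
Variable i0 : 'I_d.

Definition psi (x : T) : R := wcos R (x : V) (e_ i0).

Let ci (i : 'I_d) : e_ i0 i = (i == i0) :> nat.
Proof. by rewrite ffunE; case: (i == i0). Qed.

Lemma psi_eig x : rw_gen psi x = - ga * psi x.
Proof.
rewrite /rw_gen sum_nbr (eq_bigr (fun i : 'I_d => (i == i0)%:R * (- 2 * ga * psi x))).
  rewrite -mulr_suml (bigD1 i0) //= eqxx big1 ?addr0 => [|i /negbTE -> //].
  by rewrite mul1r; lra.
move=> i _; rewrite /psi.
have := wcos_shift R (x : V) (e_ i0) i.
have := wcos_shift R ((x : V) - e_ i) (e_ i0) i; have := wsin_shift R ((x : V) - e_ i) (e_ i0) i.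
rewrite subrK ci; have := cosn_sinn R M (i == i0).
set c := C _; set s := sinn _ _ _.
move=> cs ea eb ew.
have em : wcos R ((x : V) - e_ i) (e_ i0) = wcos R x (e_ i0) * c + wsin R x (e_ i0) * s.
  by rewrite ea eb -[LHS]mulr1 -cs; ring.
rewrite ew em /c; case: (i == i0) => /=; first by ring.
by rewrite cosn0; ring.
Qed.

Lemma psi_le1 x : `|psi x| <= 1.
Proof. exact: cos_max. Qed.

Lemma psi_origin : psi (0 : V) = 1.
Proof. by rewrite /psi /wcos /dot big1 ?cosn0 // => l _; rewrite ffunE. Qed.

Lemma sum_psi : \sum_x psi x = 0.
Proof.
have := orthogonality R (e_ i0) (0 : V).
rewrite (eq_bigr psi) => [->|x _].
  rewrite (_ : (_ == _) = false) ?mulr0 //; apply/eqP => /ffunP/(_ i0).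
  by rewrite !ffunE eqxx.
have d0 : dot x 0 = 0%N by rewrite /dot big1 // => l _; rewrite ffunE muln0.
by rewrite /wcos /wsin d0 cosn0 sinn0 mulr1 mulr0 addr0.
Qed.

Lemma gap_ge0 : 0 <= ga.
Proof. by rewrite ltW // gap_gt0. Qed.

(** The increment of the full character has squared modulus [2 (1 - c)], of which the cosine part is
    only one summand. *)
Lemma psi_grad (a b : T) : nbr a b -> (psi a - psi b) ^+ 2 <= 2 * ga.
Proof.
have step (x : V) i : (psi (x + e_ i) - psi x) ^+ 2 <= 2 * ga.
  rewrite /psi wcos_shift ci.
  have := wcos_wsin R x (e_ i0); set a' := wcos _ _ _; set b' := wsin _ _ _.
  have := cosn_sinn R M (i == i0); set c := C _; set s := sinn _ _ _ => cs ab.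
  have h : (a' * c - b' * s - a') ^+ 2 + (b' * c + a' * s - b') ^+ 2 = 2 * (1 - c).
    transitivity ((a' ^+ 2 + b' ^+ 2) * ((c ^+ 2 + s ^+ 2) + 1 - 2 * c)); first by ring.
    by rewrite ab cs; ring.
  have := sqr_ge0 (b' * c + a' * s - b').
  suff : 2 * (1 - c) <= 2 * ga by rewrite -h; lra.
  rewrite /c; case: (i == i0) => //=; rewrite cosn0 subrr mulr0.
  by rewrite mulr_ge0 // gap_ge0.
case/nbrP => i [->|->]; last exact: step.
by rewrite -sqrrN opprB; exact: step.
Qed.

(** [psi] attains the value. Conversely an eigenfunction with nonzero eigenvalue has zero sum, so
    Poincare bounds its eigenvalue from below. *)
Lemma torus_spectral_gap : spectral_gap (@rw_gen R d M) = ga.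
Proof.
apply/eqP; rewrite eq_le; apply/andP; split.
  apply: ge_inf.
    by exists 0 => l [/ltW].
  split; first exact: gap_gt0.
  exists psi; split; first by exists (0 : V); rewrite psi_origin oner_neq0.
  by move=> x; rewrite psi_eig mulNr opprK.
apply: lb_le_inf.
  exists ga; split; first exact: gap_gt0.
  exists psi; split; first by exists (0 : V); rewrite psi_origin oner_neq0.
  by move=> x; rewrite psi_eig mulNr opprK.
move=> l [l0 [g [[x gx] eig]]].
have e y : rw_gen g y = - l * g y by rewrite mulNr -eig opprK.
have sg : \sum_y g y = 0.
  have := sum_rw_gen0 g; rewrite (eq_bigr _ (fun y _ => e y)) -mulr_sumr => /eqP.
  by rewrite mulf_eq0 oppr_eq0 gt_eqF //= => /eqP.
have := torus_poincare g; rewrite sg expr0n mulr0 subr0.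
have -> : dirichlet g = l * \sum_y g y ^+ 2.
  apply: oppr_inj; rewrite -rw_gen_energy mulr_sumr -sumrN; apply: eq_bigr => y _.
  by rewrite e; ring.
rewrite ler_pM2r // lt_neqAle eq_sym sumr_ge0 ?andbT => [|y _]; last exact: sqr_ge0.
rewrite gt_eqF // (bigD1 x) //= ltr_wpDr ?sumr_ge0 // => [y _|]; first exact: sqr_ge0.
by rewrite lt_neqAle sqr_ge0 andbT eq_sym sqrf_eq0.
Qed.

Lemma torus_trel : trel R d M = (1 - cos (2 * pi / M%:R))^-1.
Proof.
by rewrite /trel torus_spectral_gap /cosn /ang mulr1.
Qed.

End TorusSpectrum.

(** * Quantitative bounds on the torus *)

Section TorusBounds.
Variables (R : realType) (d N : nat).
Local Notation M := N.+3.
Local Notation V := {ffun 'I_d -> 'I_M}.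
Local Notation T := (torus d M).
Local Notation n := ((M%:R : R) ^+ d).
Local Notation dR := (d%:R : R).
Local Notation ga := (1 - cosn R M 1).
Local Notation r0 := (nash_time R d M).
Hypothesis d_gt0 : (0 < d)%N.
Implicit Types s t r : R.

Let o : T := (0 : V).
Let i0 : 'I_d := Ordinal d_gt0.
Local Notation p := (@ret R d M o).
Local Notation del := (@gap0 R d M o).
Local Notation en := (fun s => dirichlet (@spread R d M o s)).

Let N_gt0 : (0 < M)%N. Proof. by []. Qed.
Let swapA := @torus_swap_auto d N.
Let edgeA := @torus_edge_trans R d N.
Let degA := @torus_degree R d N.

Let p0 : p 0 = 1. Proof. exact: ret0. Qed.
Let p_ge s : 0 <= s -> n^-1 <= p s.
Proof. exact: (ret_ge d_gt0 N_gt0 swapA edgeA degA). Qed.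
Let dp s : is_derive s 1 p (- dR * del s).
Proof. exact: (is_derive_ret d_gt0 swapA edgeA degA). Qed.
Let dp2 s : is_derive s 1 (fun s => p (2 * s)) (- 4 * en s + 2 * dR * del s ^+ 2).
Proof. exact: (is_derive_sqr d_gt0 N_gt0 swapA edgeA degA). Qed.
Let en_ge s : 3 / 4 * (dR * del s ^+ 2) <= en s.
Proof. exact: (gap0_energy d_gt0 edgeA degA). Qed.
Let nash (k : nat) s : (0 < k <= M)%N -> 0 <= s ->
  p (2 * s) <= (k%:R ^+ d)^-1 + dR * k%:R ^+ 2 * en s.
Proof.
move=> kM s0; rewrite -(spread_sqr N_gt0 swapA).
apply: torus_nash => //; first by move=> x; exact: spread_ge0.
exact: (spread_sum d_gt0 swapA edgeA degA).
Qed.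
Let poincare s : 0 <= s ->
  ga * (p (2 * s) - n^-1 - del s * (p s - n^-1)) <= en s - 3 / 4 * (dR * del s ^+ 2).
Proof.
move=> s0; rewrite -(dirichlet_flat d_gt0 edgeA degA).
apply: le_trans (torus_poincare _); apply: ler_wpM2l; first exact: gap_ge0.
rewrite (flat_sum d_gt0 swapA edgeA degA) // (flat_sqr N_gt0 swapA).
have n1 : n^-1 <= 1 by rewrite invf_le1 ?exprn_gt0 // exprn_ege1 // ler1n.
have := mulr_ge0 (sqr_ge0 (del s)) (_ : 0 <= 1 - n^-1).
rewrite subr_ge0 n1 => /(_ isT); lra.
Qed.
Let cauchy s r : 0 <= s -> 0 <= r ->
  (p (s + r) - n^-1) ^+ 2 <= (p (2 * s) - n^-1) * (p (2 * r) - n^-1).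
Proof. exact: (ret_cauchy d_gt0 N_gt0 swapA edgeA degA). Qed.

Lemma two_pt_diag_ret t x : two_pt (@diag_fun R d M) t (x, x) = p t.
Proof. exact: ht_diag. Qed.

Lemma ret_decay t : 4 * r0 <= t ->
  p t - n^-1 <= decay_K d M ga * expR (- (2 * ga * (1 - decay_eps d M ga)) * t).
Proof.
move=> ht; have h : 2 * r0 <= t / 2 by lra.
have := p_decay d_gt0 N_gt0 (gap_ge0 R N) p0 p_ge dp dp2 en_ge nash poincare cauchy h.
rewrite (_ : 2 * (t / 2) = t); last by lra.
move/le_trans; apply; rewrite le_eqVlt; apply/orP; left; apply/eqP.
by congr (_ * expR _); field.
Qed.

Lemma ret_le1 t : 0 <= t -> p t <= 1.
Proof.
move=> t0; rewrite (_ : t = 2 * (t / 2)); last by lra.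
rewrite -[leRHS]p0 -[X in _ <= p X](mulr0 2).
by apply: (p_antitone d_gt0 dp2 en_ge); lra.
Qed.

Let ps := @psi R d N i0.
Let v t := two_pt (tensor ps) t (o, o).

Lemma two_gen_diag (x y : T) :
  two_gen (@diag_fun R d M) (x, y) =
  - 2^-1 * edge_sum (fun a b => edge_sgn R a b x * edge_sgn R a b y).
Proof.
rewrite two_genE.
rewrite (eq_edge_sum (F := fun a b : T => edge_sgn R a b x * edge_sgn R a b y *
   (diag_fun R (a, a) - diag_fun R (a, b) - diag_fun R (b, a) + diag_fun R (b, b)))
   (G := fun a b => 2 * (edge_sgn R a b x * edge_sgn R a b y))).
  rewrite edge_sumZ.
  have -> : rw_gen (fun u => diag_fun R (u, y)) x = - 2^-1 *
     edge_sum (fun a b => edge_sgn R a b x * edge_sgn R a b y).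
    rewrite (eq_edge_sum (G := fun a b => edge_sgn R a b y * edge_sgn R a b x)).
      by rewrite edge_sum_sgn /diag_fun /one_at /=; lra.
    by move=> a b _; rewrite mulrC.
  have -> : rw_gen (fun v => diag_fun R (x, v)) y = - 2^-1 *
     edge_sum (fun a b => edge_sgn R a b x * edge_sgn R a b y).
    rewrite edge_sum_sgn.
    rewrite (_ : (fun v => diag_fun R (x, v)) = one_at R x); first by lra.
    by apply/funext => z; rewrite /diag_fun /one_at eq_sym.
  lra.
move=> a b /nbr_neq ab; rewrite /diag_fun /= !eqxx [b == a]eq_sym (negbTE ab) /=; ring.
Qed.

Lemma two_gen_tensor (x y : T) :
  two_gen (tensor ps) (x, y) = - 2 * ga * tensor ps (x, y) +
  4^-1 * edge_sum (fun a b => edge_sgn R a b x * edge_sgn R a b y * (ps a - ps b) ^+ 2).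
Proof.
rewrite two_genE; congr (_ + _ * _); last first.
  by apply: eq_edge_sum => a b _; rewrite /tensor /=; ring.
have e z (c : R) : rw_gen (fun u : T => c * ps u) z = c * rw_gen ps z.
  rewrite /rw_gen [RHS]mulrCA; congr (_ * _); rewrite mulr_sumr.
  by apply: eq_bigr => w _; rewrite mulrBr.
rewrite /tensor /= e -[rw_gen (fun u => _) x]/(rw_gen (fun u => ps u * ps y) x).
have -> : (fun u => ps u * ps y) = (fun u => ps y * ps u).
  by apply/funext => u; rewrite mulrC.
by rewrite e /ps !psi_eig; ring.
Qed.

(** The edge terms of [two_gen (tensor ps) + 2 ga tensor ps] have coefficients
    [(ps a - ps b)^2 / 4 <= ga / 2], so as quadratic forms they are dominated by those of [- ga]
    times the generator of the diagonal. The semigroup preserves this order, and it maps that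
    generator to [p' = - d del]. *)
Lemma tensor_generator_le t : 0 <= t ->
  two_pt (two_gen (tensor ps)) t (o, o) + 2 * ga * v t - ga * (dR * del t) <= 0.
Proof.
move=> t0.
pose D := two_gen (@diag_fun R d M).
have dD : two_pt D t (o, o) = - dR * del t.
  have h1 := is_derive_two_ptr (@diag_fun R d M) t (o, o).
  have h2 := dp t; rewrite /ret in h2.
  by have := @derive_val _ _ _ _ _ _ _ h1; rewrite (@derive_val _ _ _ _ _ _ _ h2) => <-.
pose H q := 1 * (- 1 * two_gen (tensor ps) q + (- (2 * ga)) * tensor ps q) + (- ga) * D q.
have psdH : psd H.
  have HE : H = fun q => edge_sum (fun a b =>
      (2^-1 * ga - 4^-1 * (ps a - ps b) ^+ 2) * (edge_sgn R a b q.1 * edge_sgn R a b q.2)).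
    apply/funext => -[x y]; rewrite /H /D two_gen_tensor two_gen_diag /=.
    rewrite [RHS](eq_edge_sum (G := fun a b => 2^-1 * ga * (edge_sgn R a b x * edge_sgn R a b y)
       + - 4^-1 * (edge_sgn R a b x * edge_sgn R a b y * (ps a - ps b) ^+ 2))).
      by rewrite edge_sumD !edge_sumZ; ring.
    by move=> a b _; ring.
  move=> c; rewrite HE pairing_edge_sum; apply: edge_sum_ge0 => a b ab.
  have -> : pairing c c (fun q => (2^-1 * ga - 4^-1 * (ps a - ps b) ^+ 2) *
      (edge_sgn R a b q.1 * edge_sgn R a b q.2)) =
      (2^-1 * ga - 4^-1 * (ps a - ps b) ^+ 2) * (\sum_x c x * edge_sgn R a b x) ^+ 2.
    move: (2^-1 * ga - _) => w.
    rewrite /pairing expr2 mulr_suml mulr_sumr; apply: eq_bigr => x _.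
    rewrite !mulr_sumr; apply: eq_bigr => y _ /=; ring.
  apply: mulr_ge0; last exact: sqr_ge0.
  by have := psi_grad R i0 ab; rewrite -/ps; lra.
have := two_pt_psd (o : T) t0 psdH; rewrite /H.
rewrite (two_pt_lin t 1 (- ga) (fun q => - 1 * two_gen (tensor ps) q + (- (2 * ga)) * tensor ps q) D).
rewrite (two_pt_lin t (-1) (- (2 * ga)) (two_gen (tensor ps)) (tensor ps)) dD -/(v t).
lra.
Qed.

(** Adding [ga * th] to [v] absorbs the source [ga d del], since [th' = - d del]; only
    [2 ga^2 exp(2 ga s) th] remains to be integrated. Up to [4 r0] the bound [th <= 1] is used,
    afterwards [ret_decay], whose exponential cancels the weight up to the factor involving
    [decay_eps]. *)
Lemma tensor_moment_bound t : 0 <= t ->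
  v t * expR (2 * ga * t) <= 1 + ga + 8 * ga * (ga * r0) * expR (8 * ga * r0)
    + 2 * ga ^+ 2 * decay_K d M ga * expR (2 * ga * decay_eps d M ga * t) * t.
Proof.
move=> t0; have g0 := gap_ge0 R N.
pose th s := p s - n^-1.
have th0 s : 0 <= s -> 0 <= th s by move=> s0; rewrite subr_ge0 p_ge.
have r00 : 0 <= r0 by rewrite /nash_time !mulr_ge0 ?sqr_ge0.
pose W s := expR (2 * ga * s) * (v s + ga * th s).
pose W' s := 2 * ga * expR (2 * ga * s) * (v s + ga * th s) +
  expR (2 * ga * s) * (two_pt (two_gen (tensor ps)) s (o, o) + ga * (- dR * del s)).
have dW s : is_derive s 1 W (W' s).
  apply: is_derive_mulf; first exact: is_derive_expRM.
  apply: is_derive_addf; first exact: is_derive_two_ptr.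
  apply: is_derive_scale.
  apply: (is_derive_congr (is_derive_addf (dp s) (is_derive_cst (- n^-1) s 1))) => //.
  by rewrite addr0.
have W'le s : 0 <= s -> W' s <= 2 * ga ^+ 2 * (expR (2 * ga * s) * th s).
  move=> s0; have := tensor_generator_le s0; have e0 := expR_gt0 (2 * ga * s).
  rewrite /W' => h; have := mulr_ge0_le0 (ltW e0) h; lra.
have WV s : 0 <= s -> v s * expR (2 * ga * s) <= W s.
  move=> s0; rewrite /W [leRHS]mulrDr [leLHS]mulrC lerDl mulr_ge0 ?expR_ge0 // mulr_ge0 //.
  exact: th0.
have n0 : 0 <= n^-1 by rewrite invr_ge0 exprn_ge0.
have W0 : W 0 <= 1 + ga.
  rewrite /W mulr0 expR0 mul1r /v two_pt0 /tensor /= /ps psi_origin mulr1 lerD2l.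
  by rewrite /th p0 -[leRHS]mulr1 ler_wpM2l // gerBl.
have K0 : 0 <= decay_K d M ga.
  rewrite /decay_K /decay_c /decay_beta.
  by rewrite mulr_ge0 ?expR_ge0 // addr_ge0 ?mulr_ge0 ?divr_ge0 ?exprn_ge0 ?sqr_ge0 ?mulr_ge0.
have eps0 : 0 <= decay_eps d M ga.
  rewrite /decay_eps /decay_c /decay_beta.
  by rewrite mulr_ge0 ?expR_ge0 // ?mulr_ge0 ?divr_ge0 ?exprn_ge0 ?mulr_ge0.
have dec := ret_decay.
set K := decay_K d M ga in K0 dec *; set ep := decay_eps d M ga in eps0 dec *.
clearbody K ep.
have seg1 s : 0 <= s <= 4 * r0 -> W s <= 1 + ga + 8 * ga * (ga * r0) * expR (8 * ga * r0).
  move=> /andP[s0 s4].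
  have := @derive_le_bound R W W' 0 s (2 * ga ^+ 2 * expR (8 * ga * r0)) s0 (fun u _ => dW u).
  have hb u : 0 <= u <= s -> W' u <= 2 * ga ^+ 2 * expR (8 * ga * r0).
    move=> /andP[u0 us]; apply: (le_trans (W'le u u0)).
    apply: ler_wpM2l; first by rewrite mulr_ge0 ?sqr_ge0.
    rewrite -[leRHS]mulr1; apply: ler_pM; rewrite ?expR_ge0 ?th0 //.
      rewrite ler_expR (_ : 8 * ga * r0 = 2 * ga * (4 * r0)); last by ring.
      by rewrite ler_wpM2l ?mulr_ge0 // (le_trans us).
    by have := ret_le1 u0; rewrite /th; lra.
  move=> /(_ hb) h; apply: (le_trans h); apply: lerD => //; rewrite subr0.
  rewrite [leRHS](_ : _ = 2 * ga ^+ 2 * expR (8 * ga * r0) * (4 * r0)); last by ring.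
  by rewrite ler_wpM2l // !mulr_ge0 ?sqr_ge0 ?expR_ge0.
set Q := 2 * ga ^+ 2 * _ * _ * t.
have Q0 : 0 <= Q by rewrite !mulr_ge0 ?sqr_ge0 ?expR_ge0.
apply: (le_trans (WV t t0)).
have [h|h] := leP t (4 * r0).
  by apply: (le_trans (seg1 t _)); rewrite ?t0 ?lerDl.
have r4 : 0 <= 4 * r0 by rewrite mulr_ge0.
have := @derive_le_bound R W W' (4 * r0) t
  (2 * ga ^+ 2 * K * expR (2 * ga * ep * t)) (ltW h) (fun u _ => dW u).
have hb u : 4 * r0 <= u <= t ->
    W' u <= 2 * ga ^+ 2 * K * expR (2 * ga * ep * t).
  move=> /andP[u0 ut]; have uu : 0 <= u by exact: le_trans u0.
  apply: (le_trans (W'le u uu)); rewrite -[2 * ga ^+ 2 * K * _]mulrA.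
  apply: ler_wpM2l; first by rewrite mulr_ge0 ?sqr_ge0.
  apply: (@le_trans _ _ (expR (2 * ga * u) * (K *
     expR (- (2 * ga * (1 - ep)) * u)))).
    by rewrite ler_pM2l ?expR_gt0 //; exact: dec.
  rewrite mulrCA -expRD; apply: ler_wpM2l => //; rewrite ler_expR.
  rewrite [leLHS](_ : _ = 2 * ga * ep * u); last by ring.
  by rewrite ler_wpM2l // mulr_ge0 // mulr_ge0.
move=> /(_ hb) hW; apply: (le_trans hW); apply: lerD.
  by apply: seg1; rewrite r4 lexx.
rewrite /Q ler_wpM2l //; last by rewrite gerBl.
by rewrite !mulr_ge0 ?sqr_ge0 ?expR_ge0.
Qed.

End TorusBounds.

(** * Constants depending only on the dimension *)

Section UniformBounds.
Variables (R : realType) (d : nat).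
Hypothesis d_gt0 : (0 < d)%N.
Local Notation dR := (d%:R : R).
Local Notation gap N := (1 - cos (2 * pi / N%:R) : R).
Implicit Types (N k : nat) (t e : R).

(** [ga r0 <= 64 d^2], and the largest exponent, [12 ga r0] in [decay_K], gives [768 d^2]. The
    polynomial factor comes from [decay_c = 2^(d+1) / n] and [decay_beta <= 4]. *)
Definition bound_const : R :=
  expR (768 * dR ^+ 2) * (2 ^+ d.+1 * (1 + 4 * 2 ^+ d.+1)).

(** The factor 4 is Chebyshev's from [dist_lower]; [512 = 8 * 64] bounds the exponent [8 ga r0] of
    the initial segment in [tensor_moment_bound]. *)
Definition lower_const : R :=
  4 * (1 + 512 * dR ^+ 2 * expR (512 * dR ^+ 2) + bound_const).

Lemma cosn1E N : 1 - cosn R N 1 = gap N.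
Proof. by rewrite /cosn /ang mulr1. Qed.

Lemma bound_const_gt0 : 0 < bound_const.
Proof. by rewrite /bound_const !mulr_gt0 ?expR_gt0 ?exprn_gt0 ?addr_gt0 ?mulr_gt0 ?exprn_gt0. Qed.

Let err_ge0 : 0 <= 512 * dR ^+ 2 * expR (512 * dR ^+ 2).
Proof.
apply: mulr_ge0; last exact: expR_ge0.
by apply: mulr_ge0; [exact: ler0n|exact: sqr_ge0].
Qed.

Lemma lower_const_gt0 : 0 < lower_const.
Proof.
have := bound_const_gt0; have := err_ge0; rewrite /lower_const; lra.
Qed.

Section FixedN.
Variable N : nat.
Local Notation M := N.+3.
Local Notation n := ((M%:R : R) ^+ d).
Local Notation ga := (1 - cosn R M 1).
Local Notation r0 := (nash_time R d M).
Local Notation K := (decay_K d M ga).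
Local Notation ep := (decay_eps d M ga).

Let M_gt0 : 0 < M%:R :> R. Proof. by rewrite ltr0n. Qed.
Let n_ge1 : 1 <= n. Proof. by rewrite exprn_ege1 // ler1n. Qed.
Let n_gt0 : 0 < n. Proof. by rewrite exprn_gt0. Qed.
Let ga_ge0 : 0 <= ga. Proof. exact: gap_ge0. Qed.
Let dR_ge1 : 1 <= dR. Proof. by rewrite ler1n. Qed.

Lemma gap_nash_time : ga * r0 <= 64 * dR ^+ 2.
Proof.
have := gap_upper R (isT : (0 < M)%N) => h.
have := ler_wpM2r (_ : 0 <= r0) h.
rewrite {1}/nash_time !mulr_ge0 ?sqr_ge0 // => /(_ isT) /le_trans; apply.
rewrite /nash_time le_eqVlt; apply/orP; left; apply/eqP; field.
by rewrite addr_eq0 -natr1; apply/eqP => e; move: M_gt0; rewrite -natr1; lra.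
Qed.

Let c_bd : decay_c R d M = 2 ^+ d.+1 / n. Proof. by []. Qed.

Let beta_bd : 0 <= decay_beta d ga <= 4.
Proof.
have ga2 : ga <= 2 by have := cos_geN1 (ang R M 1); rewrite /cosn; lra.
rewrite /decay_beta divr_ge0 ?mulr_ge0 //= ler_pdivrMr ?(lt_le_trans _ dR_ge1) //.
by have := ler_wpM2l (ler0n R 4) dR_ge1; lra.
Qed.

Lemma decay_eps_bd : 0 <= ep <= bound_const / n.
Proof.
have /andP[b0 b4] := beta_bd.
have c0 : 0 <= decay_c R d M by rewrite c_bd divr_ge0 ?exprn_ge0.
rewrite /decay_eps; apply/andP; split; first by rewrite !mulr_ge0 ?expR_ge0.
apply: (@le_trans _ _ (4 * decay_c R d M * expR (768 * dR ^+ 2))).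
  apply: ler_pM; rewrite ?mulr_ge0 ?expR_ge0 ?ler_wpM2r //.
  rewrite ler_expR -mulrA; have := gap_nash_time; have := sqr_ge0 dR; lra.
rewrite c_bd /bound_const; set E := expR _; set w := 2 ^+ _.
have E0 : 0 < E by exact: expR_gt0.
have w1 : 1 <= w by rewrite exprn_ege1 //; lra.
rewrite [leLHS](_ : _ = E * (w * 4) / n); last by field; rewrite gt_eqF.
rewrite ler_pM2r ?invr_gt0 // ler_pM2l // ler_pM2l ?(lt_le_trans _ w1) //; lra.
Qed.

Lemma decay_K_bd : 0 <= K <= bound_const / n.
Proof.
have /andP[b0 b4] := beta_bd.
have c0 : 0 <= decay_c R d M by rewrite c_bd divr_ge0 ?exprn_ge0.
have ni : n^-1 <= 1 by rewrite invf_le1.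
have ni0 : 0 < n^-1 by rewrite invr_gt0.
rewrite /decay_K; apply/andP; split.
  by rewrite mulr_ge0 ?expR_ge0 // addr_ge0 // mulr_ge0 // sqr_ge0.
rewrite /bound_const -[leRHS]mulrA; apply: ler_pM; rewrite ?expR_ge0 ?addr_ge0 ?mulr_ge0 ?sqr_ge0 //.
  rewrite ler_expR -mulrA; have := gap_nash_time; lra.
rewrite c_bd; set w := 2 ^+ _.
have w0 : 0 < w by rewrite exprn_gt0.
rewrite mulrDr mulr1 mulrDl lerD2l.
apply: (@le_trans _ _ (4 * (w / n) ^+ 2)); first by rewrite ler_wpM2r ?sqr_ge0.
rewrite [leLHS](_ : _ = w * (4 * w) / n * n^-1); last by field; rewrite gt_eqF.
by rewrite ler_piMr // !mulr_ge0 // ltW.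
Qed.

Lemma nash_time_bd : 4 * r0 <= bound_const * M%:R ^+ 2.
Proof.
rewrite /nash_time mulrA ler_wpM2r ?sqr_ge0 // /bound_const.
have h : 768 * dR ^+ 2 <= expR (768 * dR ^+ 2).
  by have := expR_ge1Dx (768 * dR ^+ 2); lra.
have w1 : 1 <= 2 ^+ d.+1 :> R by rewrite exprn_ege1 //; lra.
apply: (@le_trans _ _ (expR (768 * dR ^+ 2) * 1)); first by have := sqr_ge0 dR; lra.
by rewrite ler_pM2l ?expR_gt0 //; nra.
Qed.

Lemma dist_upper_torus k t e : bound_const * M%:R ^+ 2 <= t -> 0 < e ->
  dist d M k t <= e + e^-1 *
    (k%:R * bound_const * expR (- ((1 - bound_const / n) * (2 * ga * t)))).
Proof.
move=> ht e0; have t4 : 4 * r0 <= t by exact: le_trans nash_time_bd ht.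
have t0 : 0 <= t.
  by apply: le_trans ht; rewrite mulr_ge0 ?sqr_ge0 // ltW // bound_const_gt0.
pose o : torus d M := (0 : {ffun 'I_d -> 'I_M}).
apply: (le_trans (@dist_upper R d M k (isT : (0 < M)%N) t e (ret o t) t0 e0 _)).
  by move=> x; rewrite two_pt_diag_ret.
rewrite lerD2l ler_pM2l ?invr_gt0 // -mulrA ler_wpM2l //.
have := @ret_decay R d N d_gt0 t t4; rewrite -/o => h.
have /andP[K0 K1] := decay_K_bd; have /andP[ep0 ep1] := decay_eps_bd.
have -> : n * ret o t - 1 = n * (ret o t - n^-1) by rewrite mulrBr mulfV // gt_eqF.
apply: (@le_trans _ _ (n * (K * expR (- (2 * ga * (1 - ep)) * t)))); first by rewrite ler_pM2l.
have nK0 : 0 <= n * K by exact: mulr_ge0 (ltW n_gt0) K0.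
rewrite mulrA; apply: ler_pM => //; try exact: expR_ge0.
  have := ler_wpM2l (ltW n_gt0) K1.
  by rewrite [n * (bound_const / n)]mulrC divfK // ?gt_eqF.
rewrite ler_expR.
have : ep * (2 * ga * t) <= bound_const / n * (2 * ga * t).
  by rewrite ler_wpM2r // !mulr_ge0.
lra.
Qed.

Lemma dist_lower_torus k t : (0 < k)%N -> 0 <= t ->
  1 - 8 * (expR (2 * ga * t) / k%:R) - lower_const * ga *
    (1 + 2 * ga * t / n * expR (bound_const * (2 * ga * t / n)))
  <= dist d M k t.
Proof.
move=> k0 t0.
pose i0 : 'I_d := Ordinal d_gt0.
pose o : torus d M := (0 : {ffun 'I_d -> 'I_M}).
set v := two_pt (tensor (@psi R d N i0)) t (o, o).
have eig x : avg_gen (@psi R d N i0) x = (nb_edges R d M - ga) * psi R i0 x.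
  by rewrite avg_genE psi_eig; ring.
apply: le_trans (@dist_lower R d M k (isT : (0 < M)%N) t ga v (@psi R d N i0) o t0 k0
  (@psi_le1 R d N i0) (psi_origin R N i0) (sum_psi R N i0) eig (lexx _)).
rewrite lerD2l lerN2.
have := @tensor_moment_bound R d N d_gt0 t t0; rewrite -/v => hv.
have /andP[K0 K1] := decay_K_bd; have /andP[ep0 ep1] := decay_eps_bd.
have g64 := gap_nash_time.
have x0 : 0 <= 2 * ga * t by rewrite !mulr_ge0.
have h1 : 8 * ga * (ga * r0) * expR (8 * ga * r0) <=
    ga * (512 * dR ^+ 2 * expR (512 * dR ^+ 2)).
  rewrite (_ : 8 * ga * (ga * r0) * _ = ga * (8 * (ga * r0) * expR (8 * ga * r0))); last by ring.
  have gr0 : 0 <= ga * r0 by rewrite mulr_ge0 // /nash_time !mulr_ge0 ?sqr_ge0.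
  apply: ler_wpM2l => //; apply: ler_pM; rewrite ?expR_ge0 ?mulr_ge0 //; first by lra.
  by rewrite ler_expR; lra.
have h2 : 2 * ga ^+ 2 * K * expR (2 * ga * ep * t) * t <=
    ga * (bound_const * (2 * ga * t / n * expR (bound_const * (2 * ga * t / n)))).
  rewrite [leLHS](_ : _ = ga * (K * (2 * ga * t) * expR (2 * ga * ep * t))); last by ring.
  apply: ler_wpM2l => //.
  rewrite [leRHS](_ : _ = bound_const / n * (2 * ga * t) * expR (bound_const * (2 * ga * t / n))); last first.
    by rewrite !mulrA; congr (_ * _); rewrite mulrAC; congr (_ * _); ring.
  have Kx0 : 0 <= K * (2 * ga * t) by exact: mulr_ge0 K0 x0.
  apply: ler_pM => //; try exact: expR_ge0; first exact: ler_wpM2r.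
  rewrite ler_expR (_ : 2 * ga * ep * t = ep * (2 * ga * t)); last by ring.
  rewrite [leRHS]mulrA [leRHS]mulrAC; exact: ler_wpM2r.
have B0 := bound_const_gt0.
set y := 2 * ga * t / n * expR _ in h2 *.
have y0 : 0 <= y by rewrite mulr_ge0 ?expR_ge0 // divr_ge0 // ltW.
have E0 := err_ge0.
have lE : lower_const = 4 * (1 + 512 * dR ^+ 2 * expR (512 * dR ^+ 2) + bound_const) by [].
move: E0 h1 lE; move: (512 * dR ^+ 2 * expR (512 * dR ^+ 2)) => E E0 h1 ->.
have -> : 4 * (1 + E + bound_const) * ga * (1 + y) =
    4 * ((ga + ga * E + ga * bound_const) * (1 + y)) by ring.
have := mulr_ge0 ga_ge0 y0; have := mulr_ge0 (mulr_ge0 ga_ge0 E0) y0.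
have := mulr_ge0 ga_ge0 (ltW B0).
move: hv h1 h2; set q1 := 8 * ga * _ * _; set q2 := 2 * ga ^+ 2 * _ * _ * _.
move=> hv h1 h2 a1 a2 a3.
have : v * expR (2 * ga * t) - 1 <= ga + ga * E + ga * (bound_const * y) by lra.
nra.
Qed.

End FixedN.
End UniformBounds.

(** * Asymptotics *)

Local Open Scope classical_set_scope.

Section Asymptotics.
Variables (R : realType) (d : nat).
Hypothesis d_gt0 : (0 < d)%N.
Local Notation gap N := (1 - cos (2 * pi / N%:R) : R).
Local Notation C := (bound_const R d).
Local Notation C' := (lower_const R d).
Implicit Types (N k : nat) (t e x z : R).

Lemma trelE N : (3 <= N)%N -> trel R d N = (gap N)^-1.
Proof. by case: N => [|[|[|N]]] // _; rewrite (torus_trel R N (Ordinal d_gt0)). Qed.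

Lemma gap_bounds N : (3 <= N)%N -> 0 < gap N <= 32 / N%:R ^+ 2.
Proof.
case: N => [|[|[|N]]] // _; rewrite -cosn1E.
by rewrite gap_gt0 gap_upper.
Qed.

Lemma two_gap_time N x : (3 <= N)%N -> 2 * gap N * (trel R d N / 2 * x) = x.
Proof.
move=> N3; have /andP[g0 _] := gap_bounds N3; rewrite trelE //.
by field; rewrite gt_eqF.
Qed.

Lemma time_ge0 N x : (3 <= N)%N -> 0 <= x -> 0 <= trel R d N / 2 * x.
Proof.
move=> N3 x0; have /andP[g0 _] := gap_bounds N3; rewrite trelE //.
by rewrite mulr_ge0 // divr_ge0 // invr_ge0 ltW.
Qed.

(** The relaxation time is at least [N^2 / 32], so [x >= 64 C] passes the threshold after which the
    decay estimate applies. *)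
Lemma time_ge N x : (3 <= N)%N -> 64 * C <= x -> C * N%:R ^+ 2 <= trel R d N / 2 * x.
Proof.
move=> N3 hx; have /andP[g0 g1] := gap_bounds N3; rewrite trelE //.
have N0 : 0 < N%:R ^+ 2 :> R by rewrite exprn_gt0 // ltr0n (leq_trans _ N3).
have C0 := bound_const_gt0 R d.
have -> : (gap N)^-1 / 2 * x = x / (2 * gap N) by field; rewrite gt_eqF.
rewrite ler_pdivlMr ?mulr_gt0 //.
move: g1; rewrite ler_pdivlMr // => g1.
have : C * (gap N * N%:R ^+ 2) <= C * 32 by rewrite ler_pM2l.
lra.
Qed.

Lemma dist_le_scaled_time N k x z : (3 <= N)%N -> (0 < k)%N -> 64 * C <= x ->
  ln k%:R - (1 - C / N%:R ^+ d) * x <= - z ->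
  dist d N k (trel R d N / 2 * x) <= (1 + C) * expR (- z / 2).
Proof.
move=> N3 k0 hx hz; set t := _ * x.
have kp : 0 < k%:R :> R by rewrite ltr0n.
have e0 := expR_gt0 (- z / 2).
have ht : C * N%:R ^+ 2 <= t by exact: time_ge.
have hxt : 2 * gap N * t = x by exact: two_gap_time.
have : dist d N k t <= expR (- z / 2) + (expR (- z / 2))^-1 *
    (k%:R * C * expR (- ((1 - C / N%:R ^+ d) * (2 * gap N * t)))).
  case: N N3 @t hx hz ht hxt => [|[|[|N]]] // _ t hx hz ht hxt.
  by rewrite -cosn1E; exact: dist_upper_torus.
rewrite hxt => /le_trans; apply; rewrite [leRHS]mulrDl [in leRHS]mul1r lerD2l.
rewrite -[X in X * C](lnK (_ : k%:R \in Num.pos)); last by rewrite posrE.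
rewrite mulrAC [_ * C]mulrC mulrCA ler_pM2l ?bound_const_gt0 //.
rewrite -expRN -!expRD ler_expR; lra.
Qed.

(** With [y = x / N^d], [y exp(C y) <= exp((1 + C) y) <= N], so the variance error is at most
    [C' (1 + N)] times the gap bound [32 / N^2], hence of order [1 / N]. *)
Lemma dist_ge_scaled_time N k x z : (3 <= N)%N -> (0 < k)%N -> 0 <= x -> 0 <= z ->
  x <= ln k%:R - z -> (1 + C) * (ln k%:R / N%:R ^+ d) <= ln N%:R ->
  1 - 8 * expR (- z) - 64 * C' / N%:R <= dist d N k (trel R d N / 2 * x).
Proof.
move=> N3 k0 x0 z0 hx hy; set t := _ * x.
have kp : 0 < k%:R :> R by rewrite ltr0n.
have C0 := bound_const_gt0 R d; have C'0 := lower_const_gt0 R d.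
have t0 : 0 <= t by exact: time_ge0.
have /andP[g0 g1] := gap_bounds N3.
have hxt : 2 * gap N * t = x by exact: two_gap_time.
have Np : 0 < N%:R :> R by rewrite ltr0n (leq_trans _ N3).
have N1 : 1 <= N%:R :> R by rewrite ler1n (leq_trans _ N3).
have np : 0 < N%:R ^+ d :> R by rewrite exprn_gt0.
have : 1 - 8 * (expR (2 * gap N * t) / k%:R) - C' * gap N *
    (1 + 2 * gap N * t / N%:R ^+ d * expR (C * (2 * gap N * t / N%:R ^+ d)))
    <= dist d N k t.
  case: N N3 @t t0 hy g0 g1 hxt Np N1 np => [|[|[|N]]] // _ t t0 *.
  by rewrite -cosn1E; exact: dist_lower_torus.
apply: le_trans; rewrite hxt; apply: lerB.
  rewrite lerD2l lerN2 ler_pM2l // ler_pdivrMr //.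
  rewrite -[X in _ * X](lnK (_ : k%:R \in Num.pos)); last by rewrite posrE.
  by rewrite -expRD ler_expR; lra.
set y := x / N%:R ^+ d.
have y0 : 0 <= y by rewrite divr_ge0 // ltW.
have yN : y * expR (C * y) <= N%:R.
  apply: (@le_trans _ _ (expR y * expR (C * y))).
    by rewrite ler_wpM2r ?expR_ge0 //; have := expR_ge1Dx y; lra.
  rewrite -expRD -[leRHS](lnK (_ : N%:R \in Num.pos)); last by rewrite posrE.
  rewrite ler_expR; apply: (le_trans _ hy).
  rewrite mulrDl mul1r; apply: (@le_trans _ _ ((1 + C) * y)); first by lra.
  rewrite -[X in _ <= X + _]mul1r -mulrDl ler_pM2l ?addr_gt0 //.
  by rewrite ler_pM2r ?invr_gt0 //; lra.
apply: (@le_trans _ _ (C' * (32 / N%:R ^+ 2) * (1 + N%:R))).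
  apply: ler_pM; [by rewrite mulr_ge0 // ltW| |by rewrite ler_pM2l|by rewrite lerD2l].
  by rewrite addr_ge0 // mulr_ge0 ?expR_ge0.
rewrite ler_pdivlMr //.
have -> : C' * (32 / N%:R ^+ 2) * (1 + N%:R) * N%:R = 32 * C' * ((1 + N%:R) / N%:R).
  by field; rewrite gt_eqF.
rewrite (_ : 64 * C' = 32 * C' * 2); last by ring.
apply: ler_wpM2l; first by apply: mulr_ge0 => //; exact: ltW.
by rewrite ler_pdivrMr //; lra.
Qed.

Lemma near_ln (k : nat -> nat) (A : R) : k N @[N --> \oo] --> \oo ->
  \forall N \near \oo, A <= ln (k N)%:R.
Proof.
move=> /cvgnyPge /(_ (Num.bound (expR A)).+1); apply: filterS => N kN.
rewrite -[leLHS]expRK ler_ln ?posrE ?expR_gt0 ?ltr0n ?(leq_trans _ kN) //.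
apply: (@le_trans _ _ (Num.bound (expR A))%:R).
  by apply/ltW/archi_boundP/expR_ge0.
by rewrite ler_nat (leq_trans _ kN).
Qed.

Lemma near_k_gt0 (k : nat -> nat) : k N @[N --> \oo] --> \oo ->
  \forall N \near \oo, (0 < k N)%N.
Proof. by move=> /cvgnyPge /(_ 1%N). Qed.

Lemma near_volume (A : R) : \forall N \near \oo, A <= N%:R ^+ d.
Proof.
near=> N.
have N1 : 1 <= N%:R :> R by rewrite ler1n; near: N; exact: nbhs_infty_ge.
apply: (@le_trans _ _ N%:R); first by near: N; exact: nbhs_infty_ger.
by rewrite -[leLHS]expr1 ler_weXn2l.
Unshelve. all: by end_near. Qed.

Lemma near_small_div (A e : R) : 0 < e -> \forall N \near \oo, A / N%:R ^+ d <= e.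
Proof.
move=> e0; near=> N.
have n0 : 0 < N%:R ^+ d :> R.
  by apply: lt_le_trans (ltr01) _; near: N; exact: near_volume.
rewrite ler_pdivrMr // mulrC -ler_pdivrMr //.
by near: N; exact: near_volume.
Unshelve. all: by end_near. Qed.

Lemma near_ratio (k : nat -> nat) :
  (fun N : nat => ln ((k N)%:R : R)) =o_\oo
    (fun N : nat => (N%:R : R) ^+ d * ln (N%:R : R)) ->
  \forall N \near \oo, (1 + C) * (ln (k N)%:R / N%:R ^+ d) <= ln N%:R.
Proof.
have C0 := bound_const_gt0 R d.
have C1 : 0 < (1 + C)^-1 by rewrite invr_gt0 addr_gt0.
move=> /eqoP /(_ _ C1) h; near=> N.
have N1 : (0 < N)%N by near: N; exact: nbhs_infty_ge.
have Np : 0 < N%:R ^+ d :> R by rewrite exprn_gt0 // ltr0n.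
have lN : 0 <= ln N%:R :> R by rewrite ln_ge0 // ler1n.
rewrite mulrA ler_pdivrMr // mulrC -ler_pdivlMr ?addr_gt0 //.
apply: (le_trans (ler_norm _)).
have : `|ln (k N)%:R| <= (1 + C)^-1 * `|N%:R ^+ d * ln N%:R| by near: N; exact: h.
by rewrite (ger0_norm (mulr_ge0 (ltW Np) lN)) mulrC [_ * ln _]mulrC.
Unshelve. all: by end_near. Qed.

Lemma window_ge N k : 1 <= window R d N k /\ ln k%:R / N%:R ^+ d <= window R d N k.
Proof. by rewrite /window !le_max !lexx orbT. Qed.

(** The error in the rate costs [C ln k / N^d <= C w], with [w] the window, and half of [a w]
    absorbs the same error on [a w]. What is left is [- (a / 2 - C) w], and [w >= 1]. *)
Lemma near_dist_upper (k : nat -> nat) (a : R) : k N @[N --> \oo] --> \oo ->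
  2 * C <= a ->
  \forall N \near \oo,
    0 <= dist d N (k N) (Tcut d N (k N) a) <= (1 + C) * expR (- (a / 2 - C) / 2).
Proof.
move=> hk ha; have C0 := bound_const_gt0 R d; near=> N.
have N3 : (3 <= N)%N by near: N; exact: nbhs_infty_ge.
have k0 : (0 < k N)%N by near: N; exact: near_k_gt0.
have l64 : 64 * C <= ln (k N)%:R by near: N; exact: near_ln.
have small : C / N%:R ^+ d <= 2^-1 by near: N; apply: near_small_div; rewrite invr_gt0.
have [w1 w2] := window_ge N (k N).
have aw0 : 0 <= a * window R d N (k N) by rewrite mulr_ge0; lra.
rewrite /Tcut; apply/andP; split.
  apply: dist_ge0; first by rewrite (leq_trans _ N3).
  by apply: time_ge0 => //; lra.
apply: dist_le_scaled_time => //; first by lra.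
have c0 : 0 <= C / N%:R ^+ d by rewrite divr_ge0 ?exprn_ge0 // ltW.
have h1 : C * (ln (k N)%:R / N%:R ^+ d) <= C * window R d N (k N) by rewrite ler_pM2l.
have h2 := ler_wpM2r aw0 small.
have h3 : (a / 2 - C) * 1 <= (a / 2 - C) * window R d N (k N) by rewrite ler_wpM2l //; lra.
have -> : ln (k N)%:R - (1 - C / N%:R ^+ d) * (ln (k N)%:R + a * window R d N (k N)) =
  C * (ln (k N)%:R / N%:R ^+ d) + C / N%:R ^+ d * (a * window R d N (k N))
   - a * window R d N (k N) by ring.
lra.
Unshelve. all: by end_near. Qed.

Lemma near_dist_lower (k : nat -> nat) (a : R) : k N @[N --> \oo] --> \oo ->
  (fun N : nat => ln ((k N)%:R : R)) =o_\oo
    (fun N : nat => (N%:R : R) ^+ d * ln (N%:R : R)) ->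
  a <= 0 ->
  \forall N \near \oo,
    1 - 9 * expR a <= dist d N (k N) (Tcut d N (k N) a) <= 1.
Proof.
move=> hk ho ha; have C0 := bound_const_gt0 R d; near=> N.
have N3 : (3 <= N)%N by near: N; exact: nbhs_infty_ge.
have k0 : (0 < k N)%N by near: N; exact: near_k_gt0.
have np : 0 < N%:R ^+ d :> R by rewrite exprn_gt0 // ltr0n (leq_trans _ N3).
have la : - a <= ln (k N)%:R by near: N; exact: near_ln.
have na : - a <= N%:R ^+ d by near: N; exact: near_volume.
have l0 : 0 <= ln (k N)%:R :> R by lra.
have [w1 w2] := window_ge N (k N).
(* The time is nonnegative: [- a <= ln k] settles the case where the window is 1, and [- a <= N^d]
   the case where it is [ln k / N^d]. *)
have x0 : 0 <= ln (k N)%:R + a * window R d N (k N).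
  rewrite /window; have [h|h] := leP 1 (ln (k N)%:R / N%:R ^+ d); last by lra.
  have ly : ln (k N)%:R / N%:R ^+ d * N%:R ^+ d = ln (k N)%:R :> R.
    by rewrite divfK // gt_eqF.
  have na0 : 0 <= N%:R ^+ d + a by lra.
  have := mulr_ge0 (le_trans ler01 h) na0; move: ly; lra.
rewrite /Tcut; apply/andP; split; last first.
  apply: dist_le1; first by rewrite (leq_trans _ N3).
  exact: time_ge0.
have e : 64 * C' / N%:R <= expR a.
  rewrite ler_pdivrMr ?ltr0n ?(leq_trans _ N3) // [leRHS]mulrC -ler_pdivrMr ?expR_gt0 //.
  by near: N; exact: nbhs_infty_ger.
have := @dist_ge_scaled_time N (k N) (ln (k N)%:R + a * window R d N (k N)) (- a) N3 k0 x0.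
rewrite opprK oppr_ge0 => /(_ ha) h; apply: le_trans (h _ _); first by lra.
  have : a * window R d N (k N) <= a * 1 by rewrite ler_wnM2l.
  lra.
by near: N; exact: near_ratio.
Unshelve. all: by end_near. Qed.

Lemma limn_esup_le_near (u : nat -> \bar R) (c : \bar R) :
  (\forall N \near \oo, (u N <= c)%E) -> (limn_esup u <= c)%E.
Proof.
move=> uc; rewrite /limn_esup; apply: le_trans (_ : (ereal_sup (u @` [set N | (u N <= c)%E]) <= c)%E).
  by apply: ereal_inf_lbound; exists [set N | (u N <= c)%E].
by apply: ge_ereal_sup => _ [N h <-].
Qed.

Lemma limn_esup_ge_near (u : nat -> \bar R) (c : \bar R) :
  (\forall N \near \oo, (c <= u N)%E) -> (c <= limn_esup u)%E.
Proof.
move=> uc; rewrite /limn_esup; apply: le_ereal_inf_tmp => _ [V VF <-].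
have [N [h1 h2]] : ([set N | (c <= u N)%E] `&` V) !=set0.
  by apply: (@filter_ex _ \oo); exact: filterI.
by apply: (le_trans h1); apply: ereal_sup_ubound; exists N.
Qed.

Lemma limn_einf_ge_near (u : nat -> \bar R) (c : \bar R) :
  (\forall N \near \oo, (c <= u N)%E) -> (c <= limn_einf u)%E.
Proof.
move=> uc; rewrite /limn_einf leeNr; apply: limn_esup_le_near.
by apply: filterS uc => N; rewrite leeN2.
Qed.

Lemma limn_einf_le_near (u : nat -> \bar R) (c : \bar R) :
  (\forall N \near \oo, (u N <= c)%E) -> (limn_einf u <= c)%E.
Proof.
move=> uc; rewrite /limn_einf leeNl; apply: limn_esup_ge_near.
by apply: filterS uc => N; rewrite leeN2.
Qed.

Lemma lower_window (k : nat -> nat) : k N @[N --> \oo] --> \oo ->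
  (fun N : nat => ln ((k N)%:R : R)) =o_\oo
    (fun N : nat => (N%:R : R) ^+ d * ln (N%:R : R)) ->
  limn_einf (fun N : nat => (dist d N (k N) (Tcut d N (k N) a))%:E)
    @[a --> (-oo)%R] --> (1 : R)%:E.
Proof.
move=> hk ho.
apply: (@squeeze_cvge _ _ _ _ (fun a : R => (1 - 9 * expR a)%:E) _ (fun=> 1%:E)).
- near=> a; have ha : a <= 0 by near: a; exact: nbhs_ninfty_le.
  have h := near_dist_lower hk ho ha; apply/andP; split.
    by apply: limn_einf_ge_near; apply: filterS h => N /andP[]; rewrite lee_fin.
  by apply: limn_einf_le_near; apply: filterS h => N /andP[]; rewrite lee_fin.
- apply: cvg_EFin; first exact: nearW.
  rewrite (_ : fine \o _ = fun a : R => 1 - 9 * expR a) //.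
  have e0 : expR a @[a --> -oo] --> (0 : R) by exact/cvgNy_compNP/cvgr_expR.
  rewrite -[X in _ --> X]subr0 -[X in _ - X](mulr0 9).
  by apply: cvgB; [exact: cvg_cst|apply: cvgM => //; exact: cvg_cst].
- exact: cvg_cst.
Unshelve. all: by end_near. Qed.

Lemma upper_window (k : nat -> nat) : k N @[N --> \oo] --> \oo ->
  limn_esup (fun N : nat => (dist d N (k N) (Tcut d N (k N) a))%:E)
    @[a --> (+oo)%R] --> (0 : R)%:E.
Proof.
move=> hk.
apply: (@squeeze_cvge _ _ _ _ (fun=> 0%:E) _
  (fun a : R => ((1 + C) * expR (- (a / 2 - C) / 2))%:E)).
- near=> a; have ha : 2 * C <= a by near: a; apply: nbhs_pinfty_ge; exact: num_real.
  have h := near_dist_upper hk ha; apply/andP; split.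
    by apply: limn_esup_ge_near; apply: filterS h => N /andP[]; rewrite lee_fin.
  by apply: limn_esup_le_near; apply: filterS h => N /andP[]; rewrite lee_fin.
- exact: cvg_cst.
- have C0 := bound_const_gt0 R d.
  apply: cvg_EFin; first exact: nearW.
  apply/cvgrPdist_le => e e0; near=> a => /=.
  have C1 : 0 < 1 + C by rewrite addr_gt0.
  rewrite sub0r normrN ger0_norm; last by rewrite mulr_ge0 ?expR_ge0 // ltW.
  rewrite [leLHS]mulrC -ler_pdivlMr //.
  rewrite -[leRHS](lnK (_ : _ \in Num.pos)) ?posrE ?divr_gt0 // ler_expR.
  suff : 2 * C - 4 * ln (e / (1 + C)) <= a by lra.
  by near: a; apply: nbhs_pinfty_ge; exact: num_real.
Unshelve. all: by end_near. Qed.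

Lemma near_expR_ln (k : nat -> nat) (c e : R) : k N @[N --> \oo] --> \oo ->
  0 < c -> 0 < e -> \forall N \near \oo, expR (- (c * ln (k N)%:R)) <= e.
Proof.
move=> hk c0 e0; apply: filterS (near_ln (- ln e / c) hk) => N.
rewrite ler_pdivrMr // => h.
rewrite -[leRHS](lnK (_ : e \in Num.pos)) ?posrE // ler_expR lerNl mulrC.
exact: h.
Qed.

(** Obtained from the scaled-time bounds directly: the margin [z] is [de * ln k] below the cutoff
    time and [de / 2 * ln k] above it, where the rate error consumes the other half. *)
Lemma cutoff (k : nat -> nat) : k N @[N --> \oo] --> \oo ->
  (fun N : nat => ln ((k N)%:R : R)) =o_\oo
    (fun N : nat => (N%:R : R) ^+ d * ln (N%:R : R)) ->
  tv_cutoff (fun (N : nat) (t : R) => dist d N (k N) t)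
    (fun N : nat => trel R d N / 2 * ln (k N)%:R).
Proof.
move=> hk ho de /andP[de0 de1]; have C0 := bound_const_gt0 R d.
split; apply/cvgrPdist_le => e e0; near=> N.
  have N3 : (3 <= N)%N by near: N; exact: nbhs_infty_ge.
  have k0 : (0 < k N)%N by near: N; exact: near_k_gt0.
  have l0 : 0 <= ln (k N)%:R :> R by near: N; exact: near_ln.
  have x0 : 0 <= (1 - de) * ln (k N)%:R by rewrite mulr_ge0 //; lra.
  rewrite mulrCA.
  have d1 : dist d N (k N) (trel R d N / 2 * ((1 - de) * ln (k N)%:R)) <= 1.
    by apply: dist_le1; [rewrite (leq_trans _ N3)|exact: time_ge0].
  have E1 : expR (- (de * ln (k N)%:R)) <= e / 16.
    by near: N; apply: near_expR_ln => //; rewrite divr_gt0.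
  have E2 : 64 * C' / N%:R <= e / 2.
    rewrite ler_pdivrMr ?ltr0n ?(leq_trans _ N3) // [leRHS]mulrC -ler_pdivrMr ?divr_gt0 //.
    by near: N; exact: nbhs_infty_ger.
  have h : 1 - 8 * expR (- (de * ln (k N)%:R)) - 64 * C' / N%:R <=
      dist d N (k N) (trel R d N / 2 * ((1 - de) * ln (k N)%:R)).
    apply: dist_ge_scaled_time => //; first by rewrite mulr_ge0 // ltW.
      by lra.
    by near: N; exact: near_ratio.
  by rewrite ger0_norm ?subr_ge0 //; lra.
have N3 : (3 <= N)%N by near: N; exact: nbhs_infty_ge.
have k0 : (0 < k N)%N by near: N; exact: near_k_gt0.
have l64 : 64 * C <= ln (k N)%:R by near: N; exact: near_ln.
have l0 : 0 <= ln (k N)%:R :> R by near: N; exact: near_ln.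
have x0 : ln (k N)%:R <= (1 + de) * ln (k N)%:R :> R.
  by rewrite mulrDl mul1r lerDl mulr_ge0 // ltW.
rewrite mulrCA.
have small : C / N%:R ^+ d <= de / 4 by near: N; apply: near_small_div; rewrite divr_gt0.
have d0 : 0 <= dist d N (k N) (trel R d N / 2 * ((1 + de) * ln (k N)%:R)).
  apply: dist_ge0; first by rewrite (leq_trans _ N3).
  by apply: time_ge0 => //; exact: le_trans x0.
have E1 : expR (- (de / 4 * ln (k N)%:R)) <= e / (1 + C).
  by near: N; apply: near_expR_ln => //; rewrite divr_gt0 // addr_gt0.
have h : dist d N (k N) (trel R d N / 2 * ((1 + de) * ln (k N)%:R)) <=
    (1 + C) * expR (- (de / 2 * ln (k N)%:R) / 2).
  apply: dist_le_scaled_time => //; first exact: le_trans x0.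
  have c0 : 0 <= C / N%:R ^+ d by rewrite divr_ge0 ?exprn_ge0 // ltW.
  have q : C / N%:R ^+ d * (1 + de) <= de / 2 by nra.
  have := ler_wpM2r l0 q; lra.
rewrite sub0r normrN ger0_norm //; apply: (le_trans h).
rewrite [leLHS]mulrC -ler_pdivlMr ?addr_gt0 //.
by rewrite (_ : - (de / 2 * _) / 2 = - (de / 4 * ln (k N)%:R)) //; field.
Unshelve. all: by end_near. Qed.

End Asymptotics.

Theorem proposition7p1 (R : realType) (d : nat) (hd : (1 <= d)%N) :
  [/\ (forall N : nat, (3 <= N)%N ->
         trel R d N = (1 - cos (2 * pi / N%:R))^-1),
      (forall k : nat -> nat, k N @[N --> \oo] --> \oo ->
         (fun N : nat => ln ((k N)%:R : R)) =o_\oo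
           (fun N : nat => (N%:R : R) ^+ d * ln (N%:R : R)) ->
         limn_einf (fun N : nat => (dist d N (k N) (Tcut d N (k N) a))%:E)
           @[a --> (-oo)%R] --> (1 : R)%:E),
      (forall k : nat -> nat, k N @[N --> \oo] --> \oo ->
         limn_esup (fun N : nat => (dist d N (k N) (Tcut d N (k N) a))%:E)
           @[a --> (+oo)%R] --> (0 : R)%:E)
    & (forall k : nat -> nat, k N @[N --> \oo] --> \oo ->
         (fun N : nat => ln ((k N)%:R : R)) =o_\oo
           (fun N : nat => (N%:R : R) ^+ d * ln (N%:R : R)) ->
         tv_cutoff (fun (N : nat) (t : R) => dist d N (k N) t)
           (fun N : nat => trel R d N / 2 * ln (k N)%:R))].
Proof.
split.
- by move=> N; exact: trelE.
- by move=> k; exact: lower_window.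
- by move=> k; exact: upper_window.
- by move=> k; exact: cutoff.
Qed.
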